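(* The system $\mathrm{RCA}_0^\omega+\mathrm{IND}$ proves $\mathrm{HBU}\leftrightarrow\mathrm{AS}^-_{\mathrm{net}}$. Here $\mathrm{AS}^-_{\mathrm{net}}$ is the statement: for every net $x_d:D\to\mathbb{R}$ indexed by a subset of Baire space, if there is $F:\mathbb{R}\to\mathbb{R}$ such that for every $x\in[0,1]$ we have $F(x)>0$ and $(\exists d\in D)(\forall e\succeq d)(|x-x_e|\ge F(x))$, then $x_d$ is eventually bounded away from the set $[0,1]$, i.e. $(\exists\delta>0,d\in D)(\forall e\succeq d)(\forall x\in[0,1])(|x-x_e|\ge\delta)$. And $\mathrm{HBU}$ is the statement that for every $\Psi:\mathbb{R}\to\mathbb{R}^+$ there are finitely many $y_1,\dots,y_k\in[0,1]$ such that $(\forall x\in[0,1])(\exists i\le k)\big(x\in(y_i-\Psi(y_i),y_i+\Psi(y_i))\big)$.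
   Context: Base theory. Finite types: $0$ (natural numbers) is a type, and if $\sigma,\tau$ are types then so is $\sigma\to\tau$ (mappings from type $\sigma$ to type $\tau$ objects); $1:=0\to0$ and $n+1:=n\to0$; a superscript on a variable is its type. $L_\omega$ is the language with variables and quantifiers of all finite types, constants $0,1,<_0,+_0,\times_0,=_0$ on $\mathbb{N}$, the combinators $\Pi,\Sigma$ and a recursor constant $\mathbf{R}_0$. Equality at higher types is defined extensionally: $x=_\tau y$ iff $xz_1\dots z_k=_0yz_1\dots z_k$ for all arguments. $\mathrm{QF\text{-}AC}^{\sigma,\tau}$ is the schema $(\forall x^\sigma)(\exists y^\tau)A(x,y)\to(\exists Y^{\sigma\to\tau})(\forall x^\sigma)A(x,Y(x))$ for quantifier-free $A$ of $L_\omega$ (parameters of any type allowed). $\mathrm{RCA}_0^\omega$ is the theory in $L_\omega$ with classical logic and the axioms: $\mathbb{N}$ is an ordered semi-ring; the defining axioms of $\Pi,\Sigma$ (giving $\lambda$-abstraction); $\mathbf{R}_0(f,m,0)=m$ and $\mathbf{R}_0(f,m,n+1)=f(n,\mathbf{R}_0(f,m,n))$; extensionality $x=_\rho y\to\varphi(x)=_\tau\varphi(y)$ for all types $\rho,\tau$ and $\varphi^{\rho\to\tau}$; induction for quantifier-free formulas of $L_\omega$; $\mathrm{QF\text{-}AC}^{1,0}$. $\mathrm{IND}$ is the induction schema for all formulas of $L_\omega$. Reals. A real is a sequence of rationals $(q_n)$ with $|q_n-q_{n+i}|<2^{-n}$ for all $n,i$ (a type 1 object); $(q_n)=_{\mathbb{R}}(r_n)$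 iff $|q_n-r_n|\le2^{-n+1}$ for all $n$. A function $\mathbb{R}\to\mathbb{R}$ is a type $1\to1$ functional mapping equal reals to equal reals. Sets. A subset $D$ of Baire space $\mathbb{N}^{\mathbb{N}}$ is given by a characteristic function $F_D^2\le1$ ($f\in D$ means $F_D(f)=1$); a binary relation $\preceq$ on $D$ is likewise given by a characteristic function of type $(1\times1)\to0$. Via coding (and extensionality with respect to $=_{\mathbb{R}}$), subsets of $\mathbb{R}$ and sets of finite sequences of reals, and relations on them, are included. Nets. $(D,\preceq)$ with $D\neq\emptyset$ is directed if $\preceq$ is transitive and reflexive on $D$ and for all $x,y\in D$ there is $z\in D$ with $x\preceq z$ and $y\preceq z$. A net in $\mathbb{R}$ is a map $x_d:D\to\mathbb{R}$ with $(D,\preceq)$ directed; all index sets are subsets of Baire space given by characteristic functions $F_D^2\le1$, with $\preceq$ given by a characteristic function of type $(1\times1)\to0$ (including, via coding, subsets of $\mathbb{R}$ and sets of finite sequences of reals). *)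

(* Defs.v *)
From Stdlib Require Import List.
Import ListNotations.

Set Implicit Arguments.
Unset Strict Implicit.
Unset Printing Implicit Defensive.

Inductive ty : Type := Nat | Arr (s t : ty).

Declare Scope Lw_ty_scope.
Delimit Scope Lw_ty_scope with ty.
Bind Scope Lw_ty_scope with ty.
Notation "s ⇒ t" := (Arr s t) (at level 60, right associativity) : Lw_ty_scope.
Notation "0" := Nat : Lw_ty_scope.
Notation "1" := (Arr Nat Nat) : Lw_ty_scope.
Notation "2" := (Arr (Arr Nat Nat) Nat) : Lw_ty_scope.

(* Terms and formulas are intrinsically typed and well scoped: [var G s] is a
   de Bruijn index pointing at an entry [s] of the context [G], whose head is
   the most recently bound variable. *)
Definition ctx := list ty.

Inductive var : ctx -> ty -> Type :=
| VZ G s : var (s :: G) s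
| VS G s t : var G t -> var (s :: G) t.
Arguments VZ {G s}.
Arguments VS {G s t} _.

(* [=_0] and [<_0] are not constants but the relation symbols of [form] below. *)
Inductive cst : ty -> Type :=
| CZero : cst 0
| COne : cst 0
| CAdd : cst (0 ⇒ 0 ⇒ 0)
| CMul : cst (0 ⇒ 0 ⇒ 0)
| CPi s t : cst (s ⇒ t ⇒ s)
| CSigma r s t : cst ((r ⇒ s ⇒ t) ⇒ (r ⇒ s) ⇒ r ⇒ t)
| CRec : cst ((0 ⇒ 0 ⇒ 0) ⇒ 0 ⇒ 0 ⇒ 0).

Inductive term (G : ctx) : ty -> Type :=
| Var s : var G s -> term G s
| Cst s : cst s -> term G s
| App s t : term G (s ⇒ t) -> term G s -> term G t.
Arguments Var {G s} _.
Arguments Cst {G s} _.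
Arguments App {G s t} _ _.

Inductive form : ctx -> Type :=
| Bot G : form G
| EqN G : term G 0 -> term G 0 -> form G
| LtN G : term G 0 -> term G 0 -> form G
| Imp G : form G -> form G -> form G
| And G : form G -> form G -> form G
| Or G : form G -> form G -> form G
| All G s : form (s :: G) -> form G
| Ex G s : form (s :: G) -> form G.
Arguments Bot {G}.
Arguments All {G} s _.
Arguments Ex {G} s _.

Definition ren (G D : ctx) := forall s, var G s -> var D s.
Definition sub (G D : ctx) := forall s, var G s -> term D s.

Fixpoint ren_term G D (r : ren G D) s (t : term G s) : term D s :=
  match t with
  | Var v => Var (r _ v)
  | Cst c => Cst c
  | App f u => App (ren_term r f) (ren_term r u)
  end.

Fixpoint subst_term G D (r : sub G D) s (t : term G s) : term D s :=
  match t with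
  | Var v => r _ v
  | Cst c => Cst c
  | App f u => App (subst_term r f) (subst_term r u)
  end.

Definition wk G s t (u : term G t) : term (s :: G) t :=
  ren_term (fun _ v => VS v) u.

Definition scons G D s (u : term D s) (r : sub G D) : sub (s :: G) D :=
  fun t v =>
    match v in var G' t'
      return match G' with
             | [] => unit
             | s0 :: G0 => term D s0 -> sub G0 D -> term D t'
             end
    with
    | VZ => fun u _ => u
    | VS v' => fun _ r => r _ v'
    end u r.

Definition lift_sub G D s (r : sub G D) : sub (s :: G) (s :: D) :=
  scons (Var VZ) (fun t v => wk s (r t v)).
Arguments lift_sub {G D} s r _ _.

Fixpoint subst_form G (A : form G) : forall D, sub G D -> form D :=
  match A with
  | Bot => fun _ _ => Bot
  | EqN u v => fun _ r => EqN (subst_term r u) (subst_term r v)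
  | LtN u v => fun _ r => LtN (subst_term r u) (subst_term r v)
  | Imp B C => fun _ r => Imp (subst_form B r) (subst_form C r)
  | And B C => fun _ r => And (subst_form B r) (subst_form C r)
  | Or B C => fun _ r => Or (subst_form B r) (subst_form C r)
  | All s B => fun _ r => All s (subst_form B (lift_sub s r))
  | Ex s B => fun _ r => Ex s (subst_form B (lift_sub s r))
  end.

Definition wk_form G s (A : form G) : form (s :: G) :=
  subst_form A (fun _ v => Var (VS v)).

Definition inst G s (A : form (s :: G)) (u : term G s) : form G :=
  subst_form A (scons u (fun _ v => Var v)).

Definition lam_var G s t (v : var (s :: G) t) : term G (s ⇒ t) :=
  match v in var G' t'
    return match G' with
           | [] => unit
           | s0 :: G0 => term G0 (s0 ⇒ t')
           end
  with
  | @VZ G0 s0 => App (App (Cst (CSigma s0 (s0 ⇒ s0) s0)) (Cst (CPi s0 (s0 ⇒ s0))))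
                     (Cst (CPi s0 s0))
  | @VS G0 s0 t0 v' => App (Cst (CPi t0 s0)) (Var v')
  end.

Fixpoint lam G s t (u : term (s :: G) t) : term G (s ⇒ t) :=
  match u in term _ t' return term G (s ⇒ t') with
  | Var v => lam_var v
  | @Cst _ t0 c => App (Cst (CPi t0 s)) (Cst c)
  | @App _ t1 t2 f a => App (App (Cst (CSigma s t1 t2)) (lam f)) (lam a)
  end.

(* The bound variable is presented to the body as a term over the extended
   context; objects over the outer context must be weakened with [↑]. *)
Definition lam_in G s t (f : term (s :: G) s -> term (s :: G) t) : term G (s ⇒ t) :=
  lam (f (Var VZ)).
Definition all_in G s (f : term (s :: G) s -> form (s :: G)) : form G :=
  All s (f (Var VZ)).
Definition ex_in G s (f : term (s :: G) s -> form (s :: G)) : form G :=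
  Ex s (f (Var VZ)).

Declare Scope Lw_term_scope.
Delimit Scope Lw_term_scope with tm.
Bind Scope Lw_term_scope with term.
Declare Scope Lw_form_scope.
Delimit Scope Lw_form_scope with fm.
Bind Scope Lw_form_scope with form.
Local Open Scope Lw_ty_scope.
Local Open Scope Lw_term_scope.
Local Open Scope Lw_form_scope.

Notation "t ↑" := (wk _ t) (at level 2, left associativity, format "t ↑") : Lw_term_scope.
Notation "f ⋅ a" := (App f a) (at level 29, left associativity) : Lw_term_scope.
Notation "0" := (Cst CZero) : Lw_term_scope.
Notation "1" := (Cst COne) : Lw_term_scope.
Notation "2" := (App (App (Cst CAdd) (Cst COne)) (Cst COne)) : Lw_term_scope.
Notation "a + b" := (App (App (Cst CAdd) a) b) : Lw_term_scope.
Notation "a * b" := (App (App (Cst CMul) a) b) : Lw_term_scope.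
Notation "λ[ x : s ] t" := (lam_in (s := s%ty) (fun x => t%tm))
  (at level 200, x name, t at level 200) : Lw_term_scope.

Definition Not G (A : form G) : form G := Imp A Bot.
Definition Iff G (A B : form G) : form G := And (Imp A B) (Imp B A).

Notation "a ≐ b" := (EqN a b) (at level 70, no associativity) : Lw_form_scope.
Notation "a ≺ b" := (LtN a b) (at level 70, no associativity) : Lw_form_scope.
Notation "A ∧ B" := (And A B) (at level 80, right associativity) : Lw_form_scope.
Notation "A ∨ B" := (Or A B) (at level 85, right associativity) : Lw_form_scope.
Notation "A ⊃ B" := (Imp A B)
  (at level 99, right associativity, B at level 200) : Lw_form_scope.
Notation "∀[ x : s ] A" := (all_in (s := s%ty) (fun x => A%fm))
  (at level 200, x name, A at level 200) : Lw_form_scope.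
Notation "∃[ x : s ] A" := (ex_in (s := s%ty) (fun x => A%fm))
  (at level 200, x name, A at level 200) : Lw_form_scope.

Fixpoint eqf (t : ty) G : term G t -> term G t -> form G :=
  match t with
  | Nat => fun u v => u ≐ v
  | Arr s t' => fun u v => All s (eqf (App (wk s u) (Var VZ)) (App (wk s v) (Var VZ)))
  end.

Fixpoint qf G (A : form G) : Prop :=
  match A with
  | Bot | EqN _ _ | LtN _ _ => True
  | Imp B C | And B C | Or B C => qf B /\ qf C
  | All _ _ | Ex _ _ => False
  end.

(* A theory is a set of axioms in every context; an axiom with free variables
   stands for its universal closure. *)
Definition theory := forall G, form G -> Prop.

Inductive prf (T : theory) : forall G, list (form G) -> form G -> Prop :=
| prf_ax G H (A : form G) : T G A -> prf T H A
| prf_hyp G H (A : form G) : In A H -> prf T H A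
| prf_impI G H (A B : form G) : prf T (A :: H) B -> prf T H (A ⊃ B)
| prf_impE G H (A B : form G) : prf T H (A ⊃ B) -> prf T H A -> prf T H B
| prf_andI G H (A B : form G) : prf T H A -> prf T H B -> prf T H (A ∧ B)
| prf_andE1 G H (A B : form G) : prf T H (A ∧ B) -> prf T H A
| prf_andE2 G H (A B : form G) : prf T H (A ∧ B) -> prf T H B
| prf_orI1 G H (A B : form G) : prf T H A -> prf T H (A ∨ B)
| prf_orI2 G H (A B : form G) : prf T H B -> prf T H (A ∨ B)
| prf_orE G H (A B C : form G) :
    prf T H (A ∨ B) -> prf T (A :: H) C -> prf T (B :: H) C -> prf T H C
| prf_raa G H (A : form G) : prf T (Not A :: H) Bot -> prf T H A
| prf_allI G H s (A : form (s :: G)) :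
    prf T (map (wk_form s) H) A -> prf T H (All s A)
| prf_allE G H s (A : form (s :: G)) (u : term G s) :
    prf T H (All s A) -> prf T H (inst A u)
| prf_exI G H s (A : form (s :: G)) (u : term G s) :
    prf T H (inst A u) -> prf T H (Ex s A)
| prf_exE G H s (A : form (s :: G)) (C : form G) :
    prf T H (Ex s A) -> prf T (A :: map (wk_form s) H) (wk_form s C) -> prf T H C.

Definition proves (T : theory) (A : form []) : Prop := prf T [] A.

Definition tle G (a b : term G 0) : form G := a ≺ b ∨ a ≐ b.

(* Equality axioms for [=_0]; congruence for terms is part of extensionality. *)
Inductive eq_ax : theory :=
| eqax_refl G (a : term G 0) : eq_ax (a ≐ a)
| eqax_sym G (a b : term G 0) : eq_ax (a ≐ b ⊃ b ≐ a)
| eqax_trans G (a b c : term G 0) : eq_ax (a ≐ b ⊃ b ≐ c ⊃ a ≐ c)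
| eqax_lt G (a b c d : term G 0) : eq_ax (a ≐ b ⊃ c ≐ d ⊃ a ≺ c ⊃ b ≺ d).

(* Discreteness and the minimality of 0 follow from the other axioms by
   quantifier-free induction. *)
Inductive semiring_ax : theory :=
| sr_addA G (a b c : term G 0) : semiring_ax ((a + b) + c ≐ a + (b + c))
| sr_addC G (a b : term G 0) : semiring_ax (a + b ≐ b + a)
| sr_add0 G (a : term G 0) : semiring_ax (a + 0 ≐ a)
| sr_mulA G (a b c : term G 0) : semiring_ax ((a * b) * c ≐ a * (b * c))
| sr_mulC G (a b : term G 0) : semiring_ax (a * b ≐ b * a)
| sr_mul1 G (a : term G 0) : semiring_ax (a * 1 ≐ a)
| sr_mul0 G (a : term G 0) : semiring_ax (a * 0 ≐ 0)
| sr_distr G (a b c : term G 0) : semiring_ax (a * (b + c) ≐ a * b + a * c)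
| sr_irr G (a : term G 0) : semiring_ax (Not (a ≺ a))
| sr_lttrans G (a b c : term G 0) : semiring_ax (a ≺ b ⊃ b ≺ c ⊃ a ≺ c)
| sr_total G (a b : term G 0) : semiring_ax (a ≺ b ∨ a ≐ b ∨ b ≺ a)
| sr_ltadd G (a b c : term G 0) : semiring_ax (a ≺ b ⊃ a + c ≺ b + c)
| sr_ltmul G (a b c : term G 0) : semiring_ax (0 ≺ c ⊃ a ≺ b ⊃ a * c ≺ b * c)
| sr_01 G : semiring_ax (G := G) (0 ≺ 1)
| sr_ge0 G (a : term G 0) : semiring_ax (tle 0 a)
| sr_discr G (a b : term G 0) : semiring_ax (a ≺ b ⊃ tle (a + 1) b).

Inductive const_ax : theory :=
| ax_Pi G s t (x : term G s) (y : term G t) :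
    const_ax (eqf (Cst (CPi s t) ⋅ x ⋅ y) x)
| ax_Sigma G r s t (x : term G (r ⇒ s ⇒ t)) (y : term G (r ⇒ s)) (z : term G r) :
    const_ax (eqf (Cst (CSigma r s t) ⋅ x ⋅ y ⋅ z) (x ⋅ z ⋅ (y ⋅ z)))
| ax_Rec0 G (f : term G (0 ⇒ 0 ⇒ 0)) (m : term G 0) :
    const_ax (Cst CRec ⋅ f ⋅ m ⋅ 0 ≐ m)
| ax_RecS G (f : term G (0 ⇒ 0 ⇒ 0)) (m n : term G 0) :
    const_ax (Cst CRec ⋅ f ⋅ m ⋅ (n + 1) ≐ f ⋅ n ⋅ (Cst CRec ⋅ f ⋅ m ⋅ n)).

Inductive ext_ax : theory :=
| ax_ext G s t (phi : term G (s ⇒ t)) (x y : term G s) :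
    ext_ax (eqf x y ⊃ eqf (phi ⋅ x) (phi ⋅ y)).

(* [A(n+1)], in the same context as [A(n)]. *)
Definition at_succ G (A : form (Nat :: G)) : form (Nat :: G) :=
  subst_form A (scons (Var VZ + 1) (fun _ v => Var (VS v))).

Definition ind_form G (A : form (Nat :: G)) : form G :=
  inst A 0 ⊃ All 0 (A ⊃ at_succ A) ⊃ All 0 A.

(* In [A(x,y)] the variable [y] has index 0 and [x] has index 1. *)
Definition choice_form G s t (A : form (t :: s :: G)) : form G :=
  All s (Ex t A) ⊃
  Ex (s ⇒ t) (All s (subst_form A
    (scons (Var (VS VZ) ⋅ Var VZ)
    (scons (Var VZ)
           (fun _ v => Var (VS (VS v))))))).

Inductive QF_IND : theory :=
| ax_qfind G (A : form (Nat :: G)) : qf A -> QF_IND (ind_form A).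

Inductive QF_AC (s t : ty) : theory :=
| ax_qfac G (A : form (t :: s :: G)) : qf A -> QF_AC s t (choice_form A).

Inductive IND : theory :=
| ax_ind G (A : form (Nat :: G)) : IND (ind_form A).

Definition theory_union (T U : theory) : theory := fun G A => T G A \/ U G A.

Inductive RCA0w : theory :=
| RCA0w_eq G (A : form G) : eq_ax A -> RCA0w A
| RCA0w_semiring G (A : form G) : semiring_ax A -> RCA0w A
| RCA0w_const G (A : form G) : const_ax A -> RCA0w A
| RCA0w_ext G (A : form G) : ext_ax A -> RCA0w A
| RCA0w_qfind G (A : form G) : QF_IND A -> RCA0w A
| RCA0w_qfac G (A : form G) : QF_AC 1 0 A -> RCA0w A.

Definition tpred G (n : term G 0) : term G 0 :=
  Cst CRec ⋅ (λ[k : 0] λ[r : 0] k↑) ⋅ 0 ⋅ n.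

Definition tsub G (m n : term G 0) : term G 0 :=
  Cst CRec ⋅ (λ[k : 0] λ[r : 0] tpred r) ⋅ m ⋅ n.

Definition tpow2 G (n : term G 0) : term G 0 :=
  Cst CRec ⋅ (λ[k : 0] λ[r : 0] r + r) ⋅ 1 ⋅ n.

Definition ttri G (n : term G 0) : term G 0 :=
  Cst CRec ⋅ (λ[k : 0] λ[r : 0] r + (k↑ + 1)) ⋅ 0 ⋅ n.

(* The largest w with ttri w <= n: the recursion adds 1 at step k+1 exactly
   when ttri (r+1) <= k+1, where ttri w = 0 + 1 + ... + w. *)
Definition troot G (n : term G 0) : term G 0 :=
  Cst CRec ⋅ (λ[k : 0] λ[r : 0] r + tsub 1 (tsub (ttri (r + 1)) (k↑ + 1))) ⋅ 0 ⋅ n.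

(* Cantor pairing, so that every number is a pair. *)
Definition tpair G (a b : term G 0) : term G 0 := ttri (a + b) + a.
Definition tfst G (n : term G 0) : term G 0 := tsub n (ttri (troot n)).
Definition tsnd G (n : term G 0) : term G 0 := tsub (troot n) (tfst n).

(* Every number codes a rational: <<a,b>,c> codes (a - b) / (c + 1). *)
Definition mkq G (a b c : term G 0) : term G 0 := tpair (tpair a b) c.
Definition qpos G (q : term G 0) : term G 0 := tfst (tfst q).
Definition qneg G (q : term G 0) : term G 0 := tsnd (tfst q).
Definition qden G (q : term G 0) : term G 0 := tsnd q + 1.

Definition qadd G (q r : term G 0) : term G 0 :=
  mkq (qpos q * qden r + qpos r * qden q)
      (qneg q * qden r + qneg r * qden q)
      (tsub (qden q * qden r) 1).
Definition qopp G (q : term G 0) : term G 0 := mkq (qneg q) (qpos q) (tsnd q).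
Definition qsub G (q r : term G 0) : term G 0 := qadd q (qopp r).
Definition qabs G (q : term G 0) : term G 0 :=
  mkq (tsub (qpos q) (qneg q) + tsub (qneg q) (qpos q)) 0 (tsnd q).

Definition qlt G (q r : term G 0) : form G :=
  qpos q * qden r + qneg r * qden q ≺ qpos r * qden q + qneg q * qden r.
Definition qle G (q r : term G 0) : form G :=
  tle (qpos q * qden r + qneg r * qden q) (qpos r * qden q + qneg q * qden r).

Definition qzero G : term G 0 := mkq 0 0 0.
Definition qone G : term G 0 := mkq 1 0 0.
(* [qeps n] is 2^-n and [qeps2 n] is 2^(-n+1). *)
Definition qeps G (n : term G 0) : term G 0 := mkq 1 0 (tsub (tpow2 n) 1).
Definition qeps2 G (n : term G 0) : term G 0 := mkq 2 0 (tsub (tpow2 n) 1).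

Definition is_real G (x : term G 1) : form G :=
  ∀[n : 0] ∀[i : 0]
    qlt (qabs (qsub (x↑↑ ⋅ n↑) (x↑↑ ⋅ (n↑ + i)))) (qeps n↑).

Definition req G (x y : term G 1) : form G :=
  ∀[n : 0] qle (qabs (qsub (x↑ ⋅ n) (y↑ ⋅ n))) (qeps2 n).

Definition rlt G (x y : term G 1) : form G :=
  ∃[n : 0] qlt (qadd (x↑ ⋅ n) (qeps2 n)) (y↑ ⋅ n).

Definition rle G (x y : term G 1) : form G := Not (rlt y x).

(* The index shift restores the rate of convergence 2^-n. *)
Definition radd G (x y : term G 1) : term G 1 :=
  λ[n : 0] qadd (x↑ ⋅ (n + 1)) (y↑ ⋅ (n + 1)).
Definition rsub G (x y : term G 1) : term G 1 :=
  λ[n : 0] qsub (x↑ ⋅ (n + 1)) (y↑ ⋅ (n + 1)).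
Definition rabs G (x : term G 1) : term G 1 := λ[n : 0] qabs (x↑ ⋅ n).
Definition rzero G : term G 1 := λ[n : 0] qzero _.
Definition rone G : term G 1 := λ[n : 0] qone _.

Definition in01 G (x : term G 1) : form G :=
  is_real x ∧ rle (rzero G) x ∧ rle x (rone G).

Definition is_rfun G (F : term G (1 ⇒ 1)) : form G :=
  (∀[x : 1] is_real x ⊃ is_real (F↑ ⋅ x)) ∧
  (∀[x : 1] ∀[y : 1] is_real x↑ ⊃ is_real y ⊃
     req x↑ y ⊃ req (F↑↑ ⋅ x↑) (F↑↑ ⋅ y)).

Definition is_posrfun G (Psi : term G (1 ⇒ 1)) : form G :=
  is_rfun Psi ∧ (∀[x : 1] is_real x ⊃ rlt (rzero _) (Psi↑ ⋅ x)).

(* The finite sequence is given by its length [k] and the first [k] values of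
   [y], of type 0 -> 1. *)
Definition HBU : form [] :=
  ∀[Psi : 1 ⇒ 1] is_posrfun Psi ⊃
  ∃[k : 0] ∃[y : 0 ⇒ 1]
    (∀[i : 0] i ≺ k↑↑ ⊃ in01 (y↑ ⋅ i)) ∧
    (∀[x : 1] in01 x ⊃
      ∃[i : 0] i ≺ k↑↑↑ ∧
        rlt (rsub (y↑↑ ⋅ i) (Psi↑↑↑↑ ⋅ (y↑↑ ⋅ i))) x↑ ∧
        rlt x↑ (radd (y↑↑ ⋅ i) (Psi↑↑↑↑ ⋅ (y↑↑ ⋅ i)))).

(* [D] and [P] are the characteristic functions of the index set and of the
   relation; the product type (1 x 1) -> 0 is curried. *)
Definition is_charset G (D : term G 2) : form G := ∀[f : 1] tle (D↑ ⋅ f) 1.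
Definition is_charrel G (P : term G (1 ⇒ 1 ⇒ 0)) : form G :=
  ∀[f : 1] ∀[g : 1] tle (P↑↑ ⋅ f↑ ⋅ g) 1.
Definition mem G (f : term G 1) (D : term G 2) : form G := D ⋅ f ≐ 1.
Definition prec G (P : term G (1 ⇒ 1 ⇒ 0)) (f g : term G 1) : form G := P ⋅ f ⋅ g ≐ 1.

Definition is_directed G (D : term G 2) (P : term G (1 ⇒ 1 ⇒ 0)) : form G :=
  (∃[x : 1] mem x D↑) ∧
  (∀[x : 1] ∀[y : 1] ∀[z : 1]
     mem x↑↑ D↑↑↑ ⊃ mem y↑ D↑↑↑ ⊃ mem z D↑↑↑ ⊃
     prec P↑↑↑ x↑↑ y↑ ⊃ prec P↑↑↑ y↑ z ⊃ prec P↑↑↑ x↑↑ z) ∧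
  (∀[x : 1] mem x D↑ ⊃ prec P↑ x x) ∧
  (∀[x : 1] ∀[y : 1] mem x↑ D↑↑ ⊃ mem y D↑↑ ⊃
     ∃[z : 1] mem z D↑↑↑ ∧ prec P↑↑↑ x↑↑ z ∧ prec P↑↑↑ y↑ z).

Definition is_net G (D : term G 2) (P : term G (1 ⇒ 1 ⇒ 0)) (X : term G (1 ⇒ 1)) :
  form G :=
  is_charset D ∧ is_charrel P ∧ is_directed D P ∧
  (∀[d : 1] mem d D↑ ⊃ is_real (X↑ ⋅ d)).

Definition away G (D : term G 2) (P : term G (1 ⇒ 1 ⇒ 0)) (X : term G (1 ⇒ 1))
  (d x eps : term G 1) : form G :=
  ∀[e : 1] mem e D↑ ⊃ prec P↑ d↑ e ⊃ rle eps↑ (rabs (rsub x↑ (X↑ ⋅ e))).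

Definition bounded_away G (D : term G 2) (P : term G (1 ⇒ 1 ⇒ 0))
  (X : term G (1 ⇒ 1)) : form G :=
  ∃[delta : 1] ∃[d : 1]
    is_real delta↑ ∧ rlt (rzero _) delta↑ ∧ mem d D↑↑ ∧
    (∀[e : 1] mem e D↑↑↑ ⊃ prec P↑↑↑ d↑ e ⊃
       ∀[x : 1] in01 x ⊃
         rle delta↑↑↑ (rabs (rsub x (X↑↑↑↑ ⋅ e↑)))).

Definition AS_net_minus : form [] :=
  ∀[D : 2] ∀[P : 1 ⇒ 1 ⇒ 0] ∀[X : 1 ⇒ 1]
    is_net D↑↑ P↑ X ⊃
    (∃[F : 1 ⇒ 1] is_rfun F ∧
       (∀[x : 1] in01 x ⊃
          rlt (rzero _) (F↑ ⋅ x) ∧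
          (∃[d : 1] mem d D↑↑↑↑↑ ∧
             away D↑↑↑↑↑ P↑↑↑↑ X↑↑↑ d x↑ (F↑↑ ⋅ x↑)))) ⊃
    bounded_away D↑↑ P↑ X.

(* Main.v *)
(* Derivability is reduced to truth in all extensional models of the theory by a Henkin
   completeness theorem; reals of a model are handled through the nonstandard ordered
   field [K] of its rationals, with "eventually" ranging over its natural numbers.

   HBU gives AS: apply HBU to [F (clip x) / 2]. Induction over the finite cover yields
   one index above all those attached to its centers and one radius below all the values
   of [F] there; the triangle inequality finishes.

   AS gives HBU: suppose [Psi] has no finite subcover. If each [x] in [0,1] has a
   rational [q] with [|x - q| + Psi x / 2 < Psi q], the indices are the pairs [(n, p)]
   with the rational [p] outside lower approximations of the balls around the first
   [n + 1] rationals, and [F = Psi / 2]. This is decidable, so no choice is needed.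
   Otherwise [Psi] jumps at some [x0] along the rationals, and freezing the approximations
   of [x0] at the first [n] with [f n = 1] turns this jump into a functional deciding
   [exists n, f n = 1] (Grilliot's trick). Then all arithmetical sets of functions exist,
   and the indices are the finite sequences of centers together with a point they leave
   uncovered, ordered by inclusion of the sequences, with [F = Psi]. Indexing by the
   uncovered point as well avoids choosing it. In both cases AS applies to a net in [0,1],
   which is absurd. *)

From HB Require Import structures.
From Stdlib Require Import Cantor.
From mathcomp Require Import all_boot all_order all_algebra boolp.
From mathcomp Require Import ring lra.
Require Import Defs.

Set Implicit Arguments.
Unset Strict Implicit.
Unset Printing Implicit Defensive.

(** * Substitution *)

(** The model may be nonstandard, and this shapes the proof: a finite sequence has its length in the
    model's own [N], so collecting finitely many indices or radii needs induction inside the model,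
    and each such induction must exhibit a formula.

    The obstacle in the converse is that a net needs a characteristic function for its index set,
    while lying outside given open balls is an arithmetical condition on a real. With slack around
    rationals, a rational approximation of the uncovered point and a test of finite precision
    suffice. There [F] is [Psi / 2] because a late point [p] has [|p - q| >= Psi q] up to small
    errors, so that [|x - p| >= |p - q| - |x - q| > Psi x / 2].

    Without slack, every rational [q] has [Psi q <= |x0 - q| + Psi x0 / 2], so near [x0] the values
    of [Psi] at rationals drop to about half of [Psi x0] or less. A sequence frozen at a rational
    approximation is a real equal to that rational, and [Psi] respects equality of reals; comparing
    one approximation of its value with a threshold therefore tells whether freezing took place. *)

Definition var_case G s (P : forall t, var (s :: G) t -> Type)
    (hz : P s VZ) (hs : forall t v, P t (VS v)) t (v : var (s :: G) t) : P t v :=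
  match v as v' in var G' t'
    return match G' as G'' return var G'' t' -> Type with
           | nil => fun _ => unit
           | s0 :: G0 => fun v' => forall P0 : (forall t, var (s0 :: G0) t -> Type),
               P0 s0 VZ -> (forall t v, P0 t (VS v)) -> P0 t' v'
           end v'
  with
  | VZ _ _ => fun _ h _ => h
  | VS _ _ _ v0 => fun _ _ h => h _ v0
  end P hz hs.

Definition var_nil t (P : var nil t -> Type) (v : var nil t) : P v :=
  match v as v' in var G' t'
    return match G' as G'' return var G'' t' -> Type with
           | nil => fun v' => forall P0 : var nil t' -> Type, P0 v'
           | _ :: _ => fun _ => unit
           end v'
  with
  | VZ _ _ => tt
  | VS _ _ _ _ => tt
  end P.

Definition sid G : sub G G := fun _ v => Var v.
Definition sshift G s : sub G (s :: G) := fun _ v => Var (VS v).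
Definition scomp G D E (r1 : sub G D) (r2 : sub D E) : sub G E :=
  fun s v => subst_term r2 (r1 s v).

Lemma var_fun_eq G (F : ty -> Type) (f g : forall t, var G t -> F t) :
  (forall t v, f t v = g t v) -> f = g.
Proof.
by move=> h; apply: functional_extensionality_dep => t;
  apply: functional_extensionality_dep => v.
Qed.

(** Stated for an arbitrary family, so that it serves substitutions and environments alike. Since
    [var_case] computes on both constructors, most of its uses close by reflexivity. *)
Lemma var_cons_eq G s (F : ty -> Type) (f g : forall t, var (s :: G) t -> F t) :
  f s VZ = g s VZ -> (forall t v, f t (VS v) = g t (VS v)) -> f = g.
Proof.
move=> hz hs; apply: var_fun_eq => t v.
exact: (@var_case G s (fun t v => f t v = g t v) hz hs).
Qed.

Lemma subst_id G s (t : term G s) : subst_term (@sid G) t = t.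
Proof. by elim: t => //= {s} s t f -> a ->. Qed.

Lemma ren_subst G D (r : ren G D) s (t : term G s) :
  ren_term r t = subst_term (fun s v => Var (r s v)) t.
Proof. by elim: t => //= {s} s t f -> a ->. Qed.

Lemma wkE G s t (u : term G t) : wk s u = subst_term (sshift s) u.
Proof. exact: ren_subst. Qed.

Lemma subst_comp G D E (r1 : sub G D) (r2 : sub D E) s (t : term G s) :
  subst_term r2 (subst_term r1 t) = subst_term (scomp r1 r2) t.
Proof. by elim: t => //= {s} s t f -> a ->. Qed.

Lemma subst_wk G D s (u : term D s) (r : sub G D) t (v : term G t) :
  subst_term (scons u r) (wk s v) = subst_term r v.
Proof. by rewrite wkE subst_comp. Qed.

Lemma lift_id G s : lift_sub s (@sid G) = @sid (s :: G).
Proof. by apply: var_cons_eq. Qed.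

Lemma lift_wk G D s (r : sub G D) t (v : term G t) :
  subst_term (lift_sub s r) (wk s v) = wk s (subst_term r v).
Proof.
rewrite subst_wk wkE subst_comp; congr (subst_term _ v).
by apply: var_fun_eq => t' v'; rewrite /scomp wkE.
Qed.

Lemma lift_comp G D E s (r1 : sub G D) (r2 : sub D E) :
  scomp (lift_sub s r1) (lift_sub s r2) = lift_sub s (scomp r1 r2).
Proof.
apply: var_cons_eq => //= t v; rewrite /scomp /=.
exact: lift_wk.
Qed.

Lemma substf_id G (A : form G) : subst_form A (@sid G) = A.
Proof. by elim: A => //= *; rewrite ?lift_id ?subst_id; congruence. Qed.

Lemma substf_comp G (A : form G) D E (r1 : sub G D) (r2 : sub D E) :
  subst_form (subst_form A r1) r2 = subst_form A (scomp r1 r2).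
Proof.
elim: A D E r1 r2 => {G} //=.
- by move=> G u v D E r1 r2; rewrite !subst_comp.
- by move=> G u v D E r1 r2; rewrite !subst_comp.
- by move=> G A iA B iB D E r1 r2; rewrite iA iB.
- by move=> G A iA B iB D E r1 r2; rewrite iA iB.
- by move=> G A iA B iB D E r1 r2; rewrite iA iB.
- by move=> G s A iA D E r1 r2; rewrite iA lift_comp.
- by move=> G s A iA D E r1 r2; rewrite iA lift_comp.
Qed.

Lemma scomp_scons G D E s (u : term D s) (r1 : sub G D) (r2 : sub D E) :
  scomp (scons u r1) r2 = scons (subst_term r2 u) (scomp r1 r2).
Proof. by apply: var_cons_eq. Qed.

Lemma scomp_lift_scons G D E s (r1 : sub G D) (u : term E s) (r2 : sub D E) :
  scomp (lift_sub s r1) (scons u r2) = scons u (scomp r1 r2).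
Proof.
apply: var_cons_eq => //= t v.
by rewrite /scomp /= subst_wk.
Qed.

Lemma inst_lift G D s (A : form (s :: G)) (r : sub G D) (u : term D s) :
  inst (subst_form A (lift_sub s r)) u = subst_form A (scons u r).
Proof.
rewrite /inst substf_comp scomp_lift_scons; congr (subst_form A (scons u _)).
by apply: var_fun_eq => t v; exact: subst_id.
Qed.

Lemma substf_inst G D s (A : form (s :: G)) (r : sub G D) (u : term G s) :
  subst_form (inst A u) r = inst (subst_form A (lift_sub s r)) (subst_term r u).
Proof. by rewrite inst_lift /inst substf_comp scomp_scons. Qed.

Lemma substf_eqf t G D (r : sub G D) (u v : term G t) :
  subst_form (eqf u v) r = eqf (subst_term r u) (subst_term r v).
Proof.
elim: t G D r u v => [|s _ t IH] G D r u v //=.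
by rewrite IH /= !lift_wk.
Qed.

Lemma qf_subst G (A : form G) D (r : sub G D) : qf A -> qf (subst_form A r).
Proof.
elim: A D r => {G} //= G A iA B iB D r [hA hB]; split; by [exact: iA|exact: iB].
Qed.

(** The Henkin model interprets the free variables of an axiom by terms over a growing context, so
    the substituted axiom must again be an axiom. *)
Definition subst_closed (T : theory) :=
  forall G (A : form G) D (r : sub G D), T G A -> T D (subst_form A r).

Lemma ind_form_subst G D (A : form (Nat :: G)) (r : sub G D) :
  subst_form (ind_form A) r = ind_form (subst_form A (lift_sub Nat r)).
Proof.
rewrite /ind_form /= substf_inst; do 4 f_equal.
rewrite /at_succ !substf_comp; f_equal.
apply: var_cons_eq => //= t v; rewrite /scomp /=.
by rewrite subst_wk wkE.
Qed.

Lemma choice_form_subst G D s t (A : form (t :: s :: G)) (r : sub G D) :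
  subst_form (choice_form A) r
  = choice_form (subst_form A (lift_sub t (lift_sub s r))).
Proof.
rewrite /choice_form /=; do 3 f_equal.
rewrite !substf_comp; f_equal.
apply: var_cons_eq => // u.
apply: (@var_case _ _ (fun u v => scomp _ _ (VS v) = scomp _ _ (VS v))) => //= {}u v.
by rewrite /scomp /= !subst_wk !wkE subst_comp.
Qed.

Lemma RCA0w_IND_closed : subst_closed (theory_union RCA0w IND).
Proof.
move=> G A D r [hA|hA]; last first.
  by right; case: hA D r => {}G {}A D r; rewrite ind_form_subst; constructor.
left; case: hA D r => {}G {}A hA D r.
- apply: RCA0w_eq; case: hA D r => *; by constructor.
- apply: RCA0w_semiring; case: hA D r => *; by constructor.
- by apply: RCA0w_const; case: hA D r => *; rewrite ?substf_eqf; constructor.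
- by apply: RCA0w_ext; case: hA D r => * /=; rewrite !substf_eqf; constructor.
- apply: RCA0w_qfind; case: hA D r => {}G {}A hA D r.
  by rewrite ind_form_subst; constructor; exact: qf_subst.
- apply: RCA0w_qfac; case: hA D r => {}G {}A hA D r.
  by rewrite choice_form_subst; constructor; exact: qf_subst.
Qed.

(** * Structures and completeness *)

(** Equality has no interpretation of its own: [sat] reads it as identity in [dom M Nat]. The term
    model must therefore be a quotient. *)
Record structure := Structure {
  dom : ty -> Type;
  app : forall s t, dom (s ⇒ t) -> dom s -> dom t;
  cint : forall s, cst s -> dom s;
  ltM : dom Nat -> dom Nat -> Prop }.

Definition env M G := forall s, var G s -> dom M s.
Definition enil M : env M nil := fun s v => var_nil (fun _ => dom M s) v.
Definition econs M G s (x : dom M s) (r : env M G) : env M (s :: G) :=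
  fun t v => var_case (P := fun t _ => dom M t) x r v.

Fixpoint eval M G s (t : term G s) (r : env M G) : dom M s :=
  match t with
  | Var _ v => r _ v
  | Cst _ c => cint M c
  | App _ _ f u => app (eval f r) (eval u r)
  end.

Fixpoint sat M G (A : form G) : env M G -> Prop :=
  match A with
  | Bot _ => fun _ => False
  | EqN _ u v => fun r => eval u r = eval v r
  | LtN _ u v => fun r => ltM (eval u r) (eval v r)
  | Imp _ B C => fun r => sat B r -> sat C r
  | And _ B C => fun r => sat B r /\ sat C r
  | Or _ B C => fun r => sat B r \/ sat C r
  | All _ s B => fun r => forall x : dom M s, sat B (econs x r)
  | Ex _ s B => fun r => exists x : dom M s, sat B (econs x r)
  end.

Definition models M (T : theory) := forall G (A : form G), T G A -> forall r : env M G, sat A r.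
Definition extensional M := forall s t (f g : dom M (s ⇒ t)),
  (forall x, app f x = app g x) -> f = g.

Lemma eval_ren M G D s (t : term G s) (r : ren G D) (e : env M D) :
  eval (ren_term r t) e = eval t (fun s v => e _ (r s v)).
Proof. by elim: t => //= {s} s t f -> a ->. Qed.

Lemma eval_wk M G s t (u : term G t) (x : dom M s) (e : env M G) :
  eval (wk s u) (econs x e) = eval u e.
Proof. exact: eval_ren. Qed.

Lemma eval_subst M G D s (t : term G s) (r : sub G D) (e : env M D) :
  eval (subst_term r t) e = eval t (fun s v => eval (r s v) e).
Proof. by elim: t => //= {s} s t f -> a ->. Qed.

Lemma sat_subst M G (A : form G) D (r : sub G D) (e : env M D) :
  sat (subst_form A r) e = sat A (fun s v => eval (r s v) e).
Proof.
have lift : forall G1 D1 s (r : sub G1 D1) (e : env M D1) (x : dom M s),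
    (fun s v => eval (lift_sub _ r s v) (econs x e))
    = econs x (fun s v => eval (r s v) e).
  move=> G1 D1 s r1 e1 x; apply: var_cons_eq => //= t v.
  by rewrite eval_wk.
elim: A D r e => {G} //=.
- by move=> G u v D r e; rewrite !eval_subst.
- by move=> G u v D r e; rewrite !eval_subst.
- by move=> G A iA B iB D r e; rewrite iA iB.
- by move=> G A iA B iB D r e; rewrite iA iB.
- by move=> G A iA B iB D r e; rewrite iA iB.
- by move=> G s A iA D r e; apply: eq_forall => x; rewrite iA lift.
- by move=> G s A iA D r e; apply: eq_exists => x; rewrite iA lift.
Qed.

(** * Injective numbering of types, terms and formulas *)

Lemma existT_inj T (P : T -> Type) x (a b : P x) : existT P x a = existT P x b -> a = b.
Proof.
move=> h; have := projT2_eq h.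
by rewrite (Prop_irrelevance (projT1_eq h) erefl).
Qed.

Definition ncode (a b : nat) : nat := Cantor.to_nat (a, b).

Lemma ncode_inj a b a' b' : ncode a b = ncode a' b' -> a = a' /\ b = b'.
Proof.
move=> h; have := congr1 Cantor.of_nat h.
by rewrite !Cantor.cancel_of_to => -[-> ->].
Qed.

Fixpoint tycode (t : ty) : nat :=
  match t with
  | Nat => 0
  | Arr s t => (ncode (tycode s) (tycode t)).+1
  end.

Lemma tycode_inj : injective tycode.
Proof.
elim=> [|s IHs t IHt] [|s' t'] //= [] /ncode_inj [h1 h2].
by rewrite (IHs _ h1) (IHt _ h2).
Qed.

Fixpoint varcode G s (v : var G s) : nat :=
  match v with
  | VZ _ _ => 0
  | VS _ _ _ v => (varcode v).+1
  end.

Lemma varcode_inj G s (v : var G s) s' (v' : var G s') :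
  varcode v = varcode v' -> existT (var G) s v = existT (var G) s' v'.
Proof.
elim: v s' v' => {G s} [G s|G s t v IH] s' v'; move: s' v'.
  refine (@var_case G s (fun t v' => 0 = varcode v' ->
    existT (var (s :: G)) s VZ = existT (var (s :: G)) t v') _ _) => //.
refine (@var_case G s (fun u v' => (varcode v).+1 = varcode v' ->
  existT (var (s :: G)) t (VS v) = existT (var (s :: G)) u v') _ _) => // t' v' [].
by move=> /IH h; have /= e := projT1_eq h; subst t'; rewrite (existT_inj h).
Qed.

Definition cstcode s (c : cst s) : nat :=
  match c with
  | CZero => ncode 0 0
  | COne => ncode 1 0
  | CAdd => ncode 2 0
  | CMul => ncode 3 0
  | CPi s t => ncode 4 (ncode (tycode s) (tycode t))
  | CSigma r s t => ncode 5 (ncode (tycode r) (ncode (tycode s) (tycode t)))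
  | CRec => ncode 6 0
  end.

Lemma cstcode_inj s (c : cst s) s' (c' : cst s') :
  cstcode c = cstcode c' -> existT cst s c = existT cst s' c'.
Proof.
case: c => [||||u v|u v w|]; case: c' => [||||u' v'|u' v' w'|] //=;
  move=> /ncode_inj [] // _.
  by move=> /ncode_inj [/tycode_inj -> /tycode_inj ->].
by move=> /ncode_inj [/tycode_inj -> /ncode_inj [/tycode_inj -> /tycode_inj ->]].
Qed.

Fixpoint termcode G s (t : term G s) : nat :=
  match t with
  | Var _ v => ncode 0 (varcode v)
  | Cst _ c => ncode 1 (cstcode c)
  | App _ _ f a => ncode 2 (ncode (termcode f) (termcode a))
  end.

(** The sort of an application does not determine the sort of its argument, so injectivity has to be
    proved for terms paired with their sorts. *)
Lemma termcode_sigma_inj G s (t : term G s) s' (t' : term G s') :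
  termcode t = termcode t' -> existT (term G) s t = existT (term G) s' t'.
Proof.
elim: t s' t' => {s} [s v|s c|s t f IHf a IHa] s' [s1 v'|s1 c'|s1 t1 f' a'] /=;
  move=> /ncode_inj [] // _.
- by move=> /varcode_inj h; have /= e := projT1_eq h; subst s1; rewrite (existT_inj h).
- by move=> /cstcode_inj h; have /= e := projT1_eq h; subst s1; rewrite (existT_inj h).
- move=> /ncode_inj [/IHf hf /IHa ha].
  have /= [es et] := projT1_eq hf; subst t1 s1.
  by rewrite (existT_inj hf) (existT_inj ha).
Qed.

Lemma termcode_inj G s : injective (@termcode G s).
Proof. by move=> t u h; exact: existT_inj (termcode_sigma_inj h). Qed.

Fixpoint formcode G (A : form G) : nat :=
  match A with
  | Bot _ => ncode 0 0
  | EqN _ u v => ncode 1 (ncode (termcode u) (termcode v))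
  | LtN _ u v => ncode 2 (ncode (termcode u) (termcode v))
  | Imp _ B C => ncode 3 (ncode (formcode B) (formcode C))
  | And _ B C => ncode 4 (ncode (formcode B) (formcode C))
  | Or _ B C => ncode 5 (ncode (formcode B) (formcode C))
  | All _ s B => ncode 6 (ncode (tycode s) (formcode B))
  | Ex _ s B => ncode 7 (ncode (tycode s) (formcode B))
  end.

(** A code does not record the context, hence the premise [G = G']; both contexts stay general
    because the induction passes under binders. *)
Lemma formcode_sigma_inj G (A : form G) G' (B : form G') :
  formcode A = formcode B -> G = G' -> existT form G A = existT form G' B.
Proof.
elim: A G' B => {G} [G|G u v|G u v|G A IHA A' IHA'|G A IHA A' IHA'
    |G A IHA A' IHA'|G s A IHA|G s A IHA] G' [{}G'|{}G' u' v'|{}G' u' v'|{}G' B B'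
    |{}G' B B'|{}G' B B'|{}G' s' B|{}G' s' B] /=; move=> /ncode_inj [] // _.
- by move=> _ ->.
- by move=> /ncode_inj [h1 h2] e; subst G'; rewrite (termcode_inj h1) (termcode_inj h2).
- by move=> /ncode_inj [h1 h2] e; subst G'; rewrite (termcode_inj h1) (termcode_inj h2).
- move=> /ncode_inj [h1 h2] e; subst G'.
  by rewrite (existT_inj (IHA _ _ h1 erefl)) (existT_inj (IHA' _ _ h2 erefl)).
- move=> /ncode_inj [h1 h2] e; subst G'.
  by rewrite (existT_inj (IHA _ _ h1 erefl)) (existT_inj (IHA' _ _ h2 erefl)).
- move=> /ncode_inj [h1 h2] e; subst G'.
  by rewrite (existT_inj (IHA _ _ h1 erefl)) (existT_inj (IHA' _ _ h2 erefl)).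
- move=> /ncode_inj [/tycode_inj h1 h2] e; subst G' s'.
  by rewrite (existT_inj (IHA _ _ h2 erefl)).
- move=> /ncode_inj [/tycode_inj h1 h2] e; subst G' s'.
  by rewrite (existT_inj (IHA _ _ h2 erefl)).
Qed.

Lemma formcode_inj G : injective (@formcode G).
Proof. by move=> A B h; exact: existT_inj (formcode_sigma_inj h erefl). Qed.

Lemma Ex_inj G s (A B : form (s :: G)) : Ex s A = Ex s B -> A = B.
Proof. by move=> /(congr1 (@formcode G)) /ncode_inj [_ /ncode_inj [_ /formcode_inj]]. Qed.

Section Decode.
Variables (A : Type) (code : A -> nat) (d : A).

Definition decode (n : nat) : A :=
  if pselect (exists a, code a = n) is left h then projT1 (cid h) else d.

Lemma decodeK : injective code -> forall a, decode (code a) = a.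
Proof.
move=> inj a; rewrite /decode; case: pselect => [h|[]]; last by exists a.
by case: (cid h) => b /= /inj.
Qed.
End Decode.

(** * Carrying an object along a tower of contexts *)

Section Thread.
Variables (F : nat -> Type) (up : forall n, F n -> F n.+1) (d : forall n, F n).

(* At stages [m < j] the value is the default [d m]. *)
Fixpoint thread j (a : F j) (m : nat) : F m :=
  match m with
  | 0 => match pselect (j = 0) with
         | left e => eq_rect j F a 0 e
         | right _ => d 0
         end
  | m'.+1 => match pselect (j = m'.+1) with
         | left e => eq_rect j F a m'.+1 e
         | right _ => up (thread a m')
         end
  end.

Lemma thread_eq j (a : F j) : thread a j = a.
Proof.
by case: j a => [|j] a /=; case: pselect => // e;
  rewrite (Prop_irrelevance e erefl).
Qed.

Lemma thread_up j (a : F j) m : j <= m -> thread a m.+1 = up (thread a m).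
Proof.
move=> h /=; case: pselect => // e.
by move: h; rewrite {1}e ltnn.
Qed.
End Thread.

Fixpoint default_term G (t : ty) : term G t :=
  match t with
  | Nat => Cst CZero
  | Arr s t' => App (Cst (CPi t' s)) (default_term G t')
  end.

Definition ev (P : nat -> Prop) := exists N, forall m, N <= m -> P m.

Lemma ev_and P Q : ev P -> ev Q -> ev (fun m => P m /\ Q m).
Proof.
move=> [N hN] [N' hN']; exists (maxn N N') => m; rewrite geq_max => /andP [h h'].
by split; [exact: hN|exact: hN'].
Qed.

Lemma ev_mono (P Q : nat -> Prop) : (forall m, P m -> Q m) -> ev P -> ev Q.
Proof. by move=> h [N hN]; exists N => m /hN/h. Qed.

Lemma ev_var G (P : nat -> forall s, var G s -> Prop) :
  (forall s v, ev (fun m => P m s v)) -> ev (fun m => forall s v, P m s v).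
Proof.
elim: G P => [|s G IH] P h.
  by exists 0 => m _ s v; apply: (var_nil (fun v => P m s v) v).
have [N hN] := ev_and (h _ VZ) (IH _ (fun t v => h t (VS v))).
exists N => m /hN [h1 h2] t v.
exact: (var_case (P := P m) h1 h2).
Qed.

(** * Henkin construction over a growing context *)

Section Completeness.
Variable T : theory.
Hypothesis T_closed : subst_closed T.
Hypothesis T_eq : forall G (A : form G), eq_ax A -> T A.
Hypothesis T_ext : forall G (A : form G), ext_ax A -> T A.
Variable A0 : form nil.
Hypothesis A0_unprovable : ~ proves T A0.

(* A stage [k] carries a code of the sort of the variable added at that stage
   and a code of the formula to be decided at that stage. *)
Definition sort_at (k : nat) : ty := decode tycode Nat (Cantor.of_nat k).1.

(** Variables of this growing context play the part of Henkin constants, so the language is never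
    extended. The price is that an element of the model is a family of terms, one for each stage. *)
Fixpoint stage_ctx (k : nat) : ctx :=
  match k with
  | 0 => nil
  | k'.+1 => cons (sort_at k') (stage_ctx k')
  end.

Definition sterm s k := term (stage_ctx k) s.
Definition sform k := form (stage_ctx k).
Definition up_term s k (t : sterm s k) : sterm s k.+1 := wk (sort_at k) t.
Definition up_form k (A : sform k) : sform k.+1 := wk_form (sort_at k) A.
Arguments up_term {s k} t.
Arguments up_form {k} A.
Definition thread_term s j (t : sterm s j) :=
  thread (@up_term s) (fun k => default_term (stage_ctx k) s) t.
Definition thread_form j (A : sform j) :=
  thread (@up_form) (fun k => @Bot (stage_ctx k)) A.

Definition task (k : nat) : sform k :=
  let c := Cantor.of_nat (Cantor.of_nat k).2 in
  thread_form (decode (@formcode (stage_ctx c.1)) Bot c.2) k.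

(** Pairing dominates both components, so the number coding [s], [j] and [A] is itself a stage not
    before [j]. *)
Lemma taskP j (A : sform j) s :
  exists k, [/\ j <= k, sort_at k = s & task k = thread_form A k].
Proof.
exists (ncode (tycode s) (ncode j (formcode A))).
rewrite /sort_at /task /ncode !Cantor.cancel_of_to /= ?Cantor.cancel_of_to /=.
split; last 2 first.
- exact: decodeK tycode_inj _.
- by rewrite decodeK //; exact: formcode_inj.
have le a b : (a <= Cantor.to_nat (a, b)) /\ (b <= Cantor.to_nat (a, b)).
  have /leP h : (b + a <= Cantor.to_nat (a, b))%coq_nat := Cantor.to_nat_non_decreasing a b.
  by split; apply: leq_trans h; rewrite ?leq_addl ?leq_addr.
by apply: leq_trans (le _ _).2; exact: (le _ _).1.
Qed.

(** In the last clause the body [B] of the existential already lives in the next context: its bound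
    variable is the variable added at this stage, which thus becomes the witness without any
    substitution. *)
Definition step_ok k (H : list (sform k)) (H' : list (sform k.+1)) :=
  [/\ ~ prf T H' Bot,
      forall B, List.In B H -> List.In (up_form B) H',
      List.In (up_form (task k)) H' \/ List.In (up_form (Not (task k))) H'
    & forall B, task k = Ex (sort_at k) B -> List.In (up_form (task k)) H' ->
        List.In B H'].

(** Every type has a closed term, so the added variable can be generalized and then instantiated
    away. *)
Lemma prf_strengthen G s (H : list (form G)) :
  prf T (List.map (wk_form s) H) Bot -> prf T H Bot.
Proof.
move=> /(@prf_allI T G H s Bot) h.
exact: (prf_allE (default_term G s) h).
Qed.

Lemma step_ex k (H : list (sform k)) : ~ prf T H Bot -> exists H', step_ok H H'.
Proof.
move=> cH; set A := task k.
case: (pselect (prf T (A :: H) Bot)) => hA.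
  have cN : ~ prf T (Not A :: H) Bot.
    move=> h; apply: cH; exact: prf_impE (prf_impI hA) (prf_raa h).
  have cN' : ~ prf T (List.map up_form (Not A :: H)) Bot.
    by move=> h; apply: cN; exact: prf_strengthen h.
  exists (List.map up_form (Not A :: H)); split=> //.
  - by move=> B hB; right; exact: List.in_map.
  - by right; left.
  - move=> B _ hB; case: cN'; apply: prf_impE (prf_hyp _ hB).
    by apply: prf_hyp; left.
(* The formula is now consistent with [H]. If it is existential over the sort of the new variable,
   existential elimination shows that its body may be added as well. *)
case: (pselect (exists B, A = Ex (sort_at k) B)) => [[B eB]|nB].
  exists (B :: List.map up_form (A :: H)); split.
  - move=> h; apply: hA.
    apply: (@prf_exE T _ (A :: H) (sort_at k) B Bot) h.
    by apply: prf_hyp; left; rewrite eB.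
  - by move=> C hC; do 2 right; exact: List.in_map.
  - by left; right; left.
  - by move=> C; rewrite -/A eB => /Ex_inj <- _; left.
exists (List.map up_form (A :: H)); split.
- by move=> h; apply: hA; exact: prf_strengthen h.
- by move=> C hC; right; exact: List.in_map.
- by left; left.
- by move=> B e; case: nB; exists B.
Qed.

Fixpoint stage (k : nat) : list (sform k) :=
  match k with
  | 0 => cons (Not A0) nil
  | k'.+1 => if pselect (exists H', step_ok (stage k') H') is left h
             then projT1 (cid h) else nil
  end.

Lemma stage_spec k : ~ prf T (stage k) Bot /\ step_ok (stage k) (stage k.+1).
Proof.
have step : forall k, ~ prf T (stage k) Bot -> step_ok (stage k) (stage k.+1).
  by move=> j /step_ex h /=; case: pselect => // h'; case: (cid h').
elim: k => [|k [_ IH]]; last by case: (IH) => c _ _ _; split=> //; exact: step.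
suff c : ~ prf T (stage 0) Bot by split=> //; exact: step.
by move=> /prf_raa.
Qed.

(* Stages only accumulate formulas, so truth in the limit is membership at all large stages. *)
Definition tr (A : forall k, sform k) := ev (fun k => List.In (A k) (stage k)).

Lemma tr_congr (A B : forall k, sform k) : (forall k, A k = B k) -> tr A = tr B.
Proof. by move=> h; rewrite (functional_extensionality_dep h). Qed.

Lemma tr_persist (A : forall k, sform k) k :
  List.In (A k) (stage k) -> (forall m, k <= m -> A m.+1 = up_form (A m)) -> tr A.
Proof.
move=> hA stA; exists k; elim=> [|m IH].
  by rewrite leqn0 => /eqP e; subst k.
rewrite leq_eqVlt => /orP [/eqP e|]; first by subst k.
rewrite ltnS => h; rewrite stA //.
by have [_ [_ + _ _]] := stage_spec m; apply; exact: IH.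
Qed.

Definition stable_form (A : forall k, sform k) := ev (fun k => A k.+1 = up_form (A k)).

(** From a stage of stability on, the family is the thread of a single formula, and that thread is
    the task of some later stage. *)
Lemma stable_decided A : stable_form A -> tr A \/ tr (fun k => Not (A k)).
Proof.
move=> [N hN].
have thA : forall m, N <= m -> thread_form (A N) m = A m.
  elim=> [|m IH]; first by rewrite leqn0 => /eqP e; subst N; rewrite [LHS]thread_eq.
  rewrite leq_eqVlt => /orP [/eqP e|]; first by subst N; rewrite [LHS]thread_eq.
  by rewrite ltnS => h; rewrite /thread_form thread_up // hN // -IH.
have [k [Nk _ ek]] := taskP (A N) Nat.
rewrite (thA _ Nk) in ek.
have [_ [_ _ + _]] := stage_spec k; rewrite ek => -[h|h]; [left|right].
  apply: (@tr_persist _ k.+1); first by rewrite hN.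
  by move=> m /ltnW h'; rewrite hN //; exact: leq_trans h'.
apply: (@tr_persist (fun k => Not (A k)) k.+1); first by rewrite hN.
by move=> m /ltnW h'; rewrite hN //; exact: leq_trans h'.
Qed.

Lemma tr_consistent A : tr A -> tr (fun k => Not (A k)) -> False.
Proof.
move=> h1 h2; have [N /(_ _ (leqnn _)) [hA hN]] := ev_and h1 h2.
have [c _] := stage_spec N; apply: c.
exact: prf_impE (prf_hyp _ hN) (prf_hyp _ hA).
Qed.

Lemma tr_prf A : stable_form A -> ev (fun k => prf T (stage k) (A k)) -> tr A.
Proof.
move=> sA hA; case: (stable_decided sA) => // hN.
have [N /(_ _ (leqnn _)) [h1 h2]] := ev_and hA hN.
have [c _] := stage_spec N; case: c.
exact: prf_impE (prf_hyp _ h2) h1.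
Qed.

Lemma tr_not A : stable_form A -> ~ tr A -> tr (fun k => Not (A k)).
Proof. by move=> /stable_decided []. Qed.

(** Early values are arbitrary: only the stable tail counts, since truth is membership at all large
    stages. Making every family total avoids casts between contexts. *)
Record elt s := Elt {
  val_at :> forall k, sterm s k;
  eltP : ev (fun k => val_at k.+1 = up_term (val_at k)) }.

Definition eenv G := forall s, var G s -> elt s.
Definition at_stage G (r : eenv G) k : sub G (stage_ctx k) := fun s v => r s v k.
Arguments at_stage {G} r k _ _.

Definition fits G (r : eenv G) k := forall s v, r s v k.+1 = up_term (r s v k).

Lemma ev_fits G (r : eenv G) : ev (fits r).
Proof. by apply: ev_var => s v; exact: eltP. Qed.

Lemma fits_sub G (r : eenv G) k : fits r k ->
  at_stage r k.+1 = scomp (at_stage r k) (sshift (sort_at k)).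
Proof.
by move=> h; apply: var_fun_eq => s v; rewrite /at_stage h /up_term wkE.
Qed.

Lemma fits_term G (r : eenv G) k s (t : term G s) : fits r k ->
  subst_term (at_stage r k.+1) t = up_term (subst_term (at_stage r k) t).
Proof. by move=> /fits_sub ->; rewrite /up_term wkE subst_comp. Qed.

Lemma fits_form G (r : eenv G) k (A : form G) : fits r k ->
  subst_form A (at_stage r k.+1) = up_form (subst_form A (at_stage r k)).
Proof. by move=> /fits_sub ->; rewrite /up_form /wk_form substf_comp. Qed.

Definition esubst G (r : eenv G) s (t : term G s) : elt s :=
  Elt (ev_mono (fun k => @fits_term G r k s t) (ev_fits r)).

Definition trA G (A : form G) (r : eenv G) := tr (fun k => subst_form A (at_stage r k)).

Lemma stable_trA G (A : form G) (r : eenv G) :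
  stable_form (fun k => subst_form A (at_stage r k)).
Proof. by apply: ev_mono (ev_fits r) => k; exact: fits_form. Qed.

Lemma elt_app_stable s t (f : elt (s ⇒ t)) (x : elt s) :
  ev (fun k => App (f k.+1) (x k.+1) = up_term (App (f k) (x k))).
Proof. by apply: ev_mono (ev_and (eltP f) (eltP x)) => k [-> ->]. Qed.

Definition eapp s t (f : elt (s ⇒ t)) (x : elt s) : elt t := Elt (elt_app_stable f x).

Definition econs_elt G s (x : elt s) (r : eenv G) : eenv (s :: G) :=
  fun t v => var_case (P := fun t _ => elt t) x r v.

Lemma at_econs G s (x : elt s) (r : eenv G) k :
  at_stage (econs_elt x r) k = scons (x k) (at_stage r k).
Proof. exact: var_cons_eq. Qed.

Lemma fresh_stable k : ev (fun m => thread_term (Var VZ : sterm (sort_at k) k.+1) m.+1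
  = up_term (thread_term (Var VZ : sterm (sort_at k) k.+1) m)).
Proof. by exists k.+1 => m h; rewrite [LHS]thread_up. Qed.

Definition fresh k : elt (sort_at k) := Elt (fresh_stable k).

Lemma trA_prf G (A : form G) (r : eenv G) :
  ev (fun k => prf T (stage k) (subst_form A (at_stage r k))) -> trA A r.
Proof. by move=> h; apply: tr_prf h; exact: stable_trA. Qed.

Lemma trA_Imp G (A B : form G) r : trA (Imp A B) r <-> (trA A r -> trA B r).
Proof.
split=> [h hA|h].
  apply: trA_prf; apply: ev_mono (ev_and h hA) => k [h1 h2].
  exact: prf_impE (prf_hyp _ h1) (prf_hyp _ h2).
case: (pselect (trA A r)) => [/h hB|/(tr_not (stable_trA A r)) hN].
  by apply: trA_prf; apply: ev_mono hB => k hB; apply: prf_impI; apply: prf_hyp; right.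
apply: trA_prf; apply: ev_mono hN => k hN; apply: prf_impI; apply: prf_raa.
apply: (prf_impE (A := subst_form A (at_stage r k))); apply: prf_hyp.
  by right; right.
by right; left.
Qed.

Lemma trA_And G (A B : form G) r : trA (And A B) r <-> trA A r /\ trA B r.
Proof.
split=> [h|[hA hB]].
  split; apply: trA_prf; apply: ev_mono h => k h.
    exact: prf_andE1 (prf_hyp _ h).
  exact: prf_andE2 (prf_hyp _ h).
apply: trA_prf; apply: ev_mono (ev_and hA hB) => k [h1 h2].
by apply: prf_andI; apply: prf_hyp.
Qed.

Lemma trA_Or G (A B : form G) r : trA (Or A B) r <-> trA A r \/ trA B r.
Proof.
split=> [h|[h|h]]; last 2 first.
- by apply: trA_prf; apply: ev_mono h => k h; apply/prf_orI1/prf_hyp.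
- by apply: trA_prf; apply: ev_mono h => k h; apply/prf_orI2/prf_hyp.
case: (pselect (trA A r)) => [|/(tr_not (stable_trA A r)) hA]; first by left.
case: (pselect (trA B r)) => [|/(tr_not (stable_trA B r)) hB]; first by right.
have [N /(_ _ (leqnn _)) [h1 [h2 h3]]] := ev_and h (ev_and hA hB).
have [c _] := stage_spec N; case: c.
apply: prf_orE (prf_hyp _ h1) _ _.
  by apply: prf_impE (prf_hyp _ _) (prf_hyp _ _); [right; exact: h2|left].
by apply: prf_impE (prf_hyp _ _) (prf_hyp _ _); [right; exact: h3|left].
Qed.

Lemma trA_Ex G s (B : form (s :: G)) r :
  trA (Ex s B) r <-> exists p, trA B (econs_elt p r).
Proof.
split=> [h|[p h]]; last first.
  apply: trA_prf; apply: ev_mono h => k h; apply: (prf_exI (u := p k)).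
  by apply: prf_hyp; rewrite inst_lift -at_econs.
have [N hN] := ev_and h (ev_fits r).
(* The stage must fit twice: its task is this existential formula and its new variable has the sort
   of the witness. *)
have [k [Nk es]] := taskP (subst_form (Ex s B) (at_stage r N)) s.
have -> : thread_form (subst_form (Ex s B) (at_stage r N)) k
          = subst_form (Ex s B) (at_stage r k).
  elim: k Nk {es} => [|k IH]; first by rewrite leqn0 => /eqP e; subst N; rewrite [LHS]thread_eq.
  rewrite leq_eqVlt => /orP [/eqP e|]; first by subst N; rewrite [LHS]thread_eq.
  rewrite ltnS => hk; rewrite /thread_form thread_up // [thread _ _ _ _]IH // -fits_form //.
  exact: (hN _ hk).2.
subst s => et.
have [_ [_ _ _ /(_ _ et)]] := stage_spec k.
rewrite et -(fits_form _ (hN _ Nk).2) => /(_ (hN _ (leqW Nk)).1) wit.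
exists (fresh k); apply: (@tr_persist _ k.+1).
  rewrite at_econs (_ : fresh k k.+1 = Var VZ); last exact: thread_eq.
  suff -> : scons (Var VZ) (at_stage r k.+1) = lift_sub (sort_at k) (at_stage r k) by [].
  by apply: var_cons_eq => //= t v; rewrite /at_stage (hN _ Nk).2.
set e := econs_elt (fresh k) r.
move=> m km; apply: fits_form => t v; refine (@var_case G (sort_at k) (fun t v =>
  e t v m.+1 = up_term (e t v m)) _ _ t v) => /=.
  exact: thread_up.
by move=> u w; rewrite /e /= (hN _ (leq_trans Nk (ltnW km))).2.
Qed.

Lemma trA_Not G (A : form G) r : trA (Not A) r <-> ~ trA A r.
Proof.
split; first by move=> h h'; exact: tr_consistent h' h.
exact: tr_not (stable_trA A r).
Qed.

Lemma prf_not_all G s (B : form (s :: G)) H :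
  List.In (Not (All s B)) H -> prf T H (Ex s (Not B)).
Proof.
move=> hN; apply: prf_raa.
apply: (prf_impE (A := All s B)); first by apply: prf_hyp; right.
apply: prf_allI; apply: prf_raa.
apply: (prf_impE (A := wk_form s (Ex s (Not B)))).
  by apply: prf_hyp; right; left.
apply: (@prf_exI _ _ _ _ (subst_form (Not B) (lift_sub s (sshift s))) (Var VZ)).
apply: prf_hyp; left; rewrite inst_lift -[LHS]substf_id; congr subst_form.
exact: var_cons_eq.
Qed.

Lemma trA_All G s (B : form (s :: G)) r :
  trA (All s B) r <-> forall p, trA B (econs_elt p r).
Proof.
split=> [h p|h].
  apply: trA_prf; apply: ev_mono h => k /prf_hyp h; rewrite at_econs -inst_lift.
  by apply: prf_allE; exact: h.
case: (pselect (trA (All s B) r)) => // /trA_Not hN.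
have : trA (Ex s (Not B)) r.
  by apply: trA_prf; apply: ev_mono hN => k; exact: prf_not_all.
by move=> /trA_Ex [p /trA_Not].
Qed.

Definition eeq s (x y : elt s) := tr (fun k => eqf (x k) (y k)).

Lemma trA_eqf G s (u v : term G s) r : trA (eqf u v) r <-> eeq (esubst r u) (esubst r v).
Proof. by rewrite /trA (tr_congr (fun k => substf_eqf (at_stage r k) u v)). Qed.

Definition eenv0 : eenv nil := fun s v => var_nil (fun _ => elt s) v.
Definition eenv2 s t (x : elt s) (y : elt t) : eenv (s :: t :: nil) :=
  econs_elt x (econs_elt y eenv0).

Lemma trA_ax G (A : form G) r : T A -> trA A r.
Proof.
by move=> hA; apply: trA_prf; exists 0 => k _; apply: prf_ax; exact: T_closed.
Qed.

Lemma eeq_app s t (x y : elt (s ⇒ t)) :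
  eeq x y <-> forall z, eeq (eapp x z) (eapp y z).
Proof.
have -> : eeq x y = trA (eqf (Var VZ) (Var (VS VZ))) (eenv2 x y).
  by rewrite /trA (tr_congr (fun k => substf_eqf _ _ _)).
rewrite /= trA_All; split=> h z; have := h z.
  by rewrite trA_eqf.
by rewrite trA_eqf.
Qed.

(** Equality axioms exist only at type 0; the higher types inherit them by induction, through
    application. *)
Lemma eeq_equiv s : [/\ forall x : elt s, eeq x x,
  forall x y : elt s, eeq x y -> eeq y x
  & forall x y z : elt s, eeq x y -> eeq y z -> eeq x z].
Proof.
elim: s => [|s _ t [IHr IHs IHt]].
  pose V i : term (Nat :: Nat :: Nat :: nil) Nat := Var i.
  pose r (x y z : elt Nat) : eenv (Nat :: Nat :: Nat :: nil) :=
    econs_elt x (econs_elt y (econs_elt z eenv0)).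
  split=> [x|x y|x y z].
  - change (trA (EqN (V VZ) (V VZ)) (r x x x)).
    by apply: trA_ax; apply: T_eq; constructor.
  - have /trA_Imp := @trA_ax _ _ (r x y y) (T_eq (eqax_sym (V VZ) (V (VS VZ)))).
    exact.
  - have /trA_Imp h := @trA_ax _ _ (r x y z)
      (T_eq (eqax_trans (V VZ) (V (VS VZ)) (V (VS (VS VZ))))).
    by move=> /h/trA_Imp; exact.
split=> [x|x y|x y z]; rewrite ?eeq_app.
- by move=> z; exact: IHr.
- by move=> h z; exact: IHs.
- by move=> h1 h2 w; exact: IHt (h1 w) (h2 w).
Qed.

Lemma eeq_ext s t (f : elt (s ⇒ t)) (x y : elt s) :
  eeq x y -> eeq (eapp f x) (eapp f y).
Proof.
pose G := Arr s t :: s :: s :: nil.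
pose F : term G (s ⇒ t) := Var VZ.
pose X : term G s := Var (VS VZ).
pose Y : term G s := Var (VS (VS VZ)).
pose r : eenv G := econs_elt f (eenv2 x y).
have /trA_Imp := @trA_ax _ _ r (T_ext (ax_ext F X Y)).
by rewrite !trA_eqf.
Qed.

Lemma eeq_lt (x y x' y' : elt Nat) : eeq x x' -> eeq y y' ->
  tr (fun k => LtN (x k) (y k)) -> tr (fun k => LtN (x' k) (y' k)).
Proof.
pose G := Nat :: Nat :: Nat :: Nat :: nil.
pose X : term G Nat := Var VZ.
pose X' : term G Nat := Var (VS VZ).
pose Y : term G Nat := Var (VS (VS VZ)).
pose Y' : term G Nat := Var (VS (VS (VS VZ))).
pose r : eenv G := econs_elt x (econs_elt x' (eenv2 y y')).
have /trA_Imp h := @trA_ax _ _ r (T_eq (eqax_lt X X' Y Y')).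
by move=> /h/trA_Imp h' /h'/trA_Imp; exact.
Qed.

(* Identifying extensionally equal elements makes the model extensional. *)
Definition qdom s := {c : elt s -> Prop | exists x, c = eeq x}.
Definition cls s (x : elt s) : qdom s :=
  exist (fun c => exists x, c = eeq x) (eeq x) (ex_intro _ x erefl).

Lemma clsP s (x y : elt s) : cls x = cls y <-> eeq x y.
Proof.
have [er es et] := eeq_equiv s; split=> [[->] //|h].
by apply: eq_exist => /=; apply/funext => z; apply/propext; split=> h';
  [exact: et (es _ _ h) h'|exact: et h h'].
Qed.

Definition rep s (c : qdom s) : elt s := projT1 (cid (projT2 c)).

Lemma repK s (c : qdom s) : cls (rep c) = c.
Proof. by case: c => c hc; rewrite /rep /cls /=; case: cid => x /= e; apply: eq_exist. Qed.

Definition qapp s t (f : qdom (s ⇒ t)) (x : qdom s) : qdom t := cls (eapp (rep f) (rep x)).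

(** Invariance in the argument is the extensionality axiom; invariance in the functional is the
    definition of equality at arrow types. *)
Lemma qappE s t (f : elt (s ⇒ t)) (x : elt s) : qapp (cls f) (cls x) = cls (eapp f x).
Proof.
have [er es et] := eeq_equiv t; apply/clsP.
apply: et (eeq_ext (rep (cls f)) (_ : eeq _ x)) _; first by apply/clsP; rewrite repK.
by move: x; apply/eeq_app/clsP; rewrite repK.
Qed.

Definition henkin : structure := Structure qapp
  (fun s c => cls (esubst eenv0 (Cst c)))
  (fun x y => tr (fun k => LtN (rep x k) (rep y k))).

Definition cls_env G (r : eenv G) : env henkin G := fun s v => cls (r s v).

Lemma cls_env_surj G (e : env henkin G) : exists r, e = cls_env r.
Proof.
by exists (fun s v => rep (e s v)); apply: var_fun_eq => s v; rewrite /cls_env repK.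
Qed.

Lemma cls_env_cons G s (x : elt s) (r : eenv G) :
  econs (M := henkin) (cls x) (cls_env r) = cls_env (econs_elt x r).
Proof. exact: var_cons_eq. Qed.

Lemma eval_henkin G s (t : term G s) r : eval t (cls_env r) = cls (esubst r t).
Proof.
have er s' (x : elt s') : eeq x x by case: (eeq_equiv s').
elim: t => {s} [s v|s c|s t f IHf a IHa] /=.
- by apply/clsP; exact: er.
- by apply/clsP; exact: er.
- by rewrite IHf IHa qappE; apply/clsP; exact: er.
Qed.

Lemma sat_henkin G (A : form G) r : sat A (cls_env r) <-> trA A r.
Proof.
elim: A r => {G} [G|G u v|G u v|G A IHA B IHB|G A IHA B IHB|G A IHA B IHB
    |G s B IHB|G s B IHB] r /=.
- split=> //; rewrite /trA /= => -[N /(_ _ (leqnn _)) h].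
  by have [c _] := stage_spec N; case: c; exact: prf_hyp.
- by rewrite !eval_henkin clsP.
- rewrite !eval_henkin.
  have er (x : elt Nat) : eeq (rep (cls x)) x by apply/clsP; rewrite repK.
  have es (x : elt Nat) : eeq x (rep (cls x)) by apply/clsP; rewrite repK.
  split; first exact: eeq_lt (er _) (er _).
  exact: (@eeq_lt (esubst r u) (esubst r v) _ _ (es _) (es _)).
- by rewrite trA_Imp IHA IHB.
- by rewrite trA_And IHA IHB.
- by rewrite trA_Or IHA IHB.
- rewrite trA_All; split=> h x; first by rewrite -IHB -cls_env_cons.
  by rewrite -(repK x) cls_env_cons IHB.
- rewrite trA_Ex; split=> -[x h].
    by exists (rep x); rewrite -IHB -cls_env_cons repK.
  by exists (cls x); rewrite cls_env_cons IHB.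
Qed.

Lemma henkin_models : models henkin T.
Proof. by move=> G A hA e; have [r ->] := cls_env_surj e; apply/sat_henkin/trA_ax. Qed.

Lemma henkin_extensional : extensional henkin.
Proof.
move=> s t f g h; rewrite -(repK f) -(repK g); apply/clsP/eeq_app => z.
by apply/clsP; rewrite -!qappE !repK; exact: h.
Qed.

Lemma henkin_refutes (e : env henkin nil) : ~ sat A0 e.
Proof.
have [r ->] := cls_env_surj e; move/sat_henkin.
have : trA (Not A0) r.
  suff -> : r = eenv0.
    apply: (@tr_persist _ 0).
      left; rewrite -[LHS]substf_id; congr subst_form; apply: var_fun_eq => s v.
      exact: (var_nil (fun v => _ = _) v).
    by move=> m _; apply: fits_form => s v; exact: (var_nil (fun v => eenv0 v m.+1 = _) v).
  by apply: var_fun_eq => s v; exact: (var_nil (fun v => r _ v = eenv0 v) v).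
by move=> /trA_Not.
Qed.
End Completeness.

Theorem completeness T (A : form nil) :
  subst_closed T -> (forall G (B : form G), eq_ax B -> T G B) ->
  (forall G (B : form G), ext_ax B -> T G B) ->
  (forall M, models M T -> extensional M -> sat A (@enil M)) -> proves T A.
Proof.
move=> cT eT xT h; case: (pselect (proves T A)) => // nA.
case: (@henkin_refutes T cT eT xT A nA (@enil _)).
by apply: h; [exact: henkin_models|exact: henkin_extensional].
Qed.

(** * The ordered field of fractions of a discretely ordered semiring *)

Section Fractions.
Local Open Scope ring_scope.
Import GRing.Theory.
Variables (N : comPzSemiRingType) (lt : N -> N -> Prop).
Hypothesis lt_irr : forall a, ~ lt a a.
Hypothesis lt_tr : forall a b c, lt a b -> lt b c -> lt a c.
Hypothesis lt_tot : forall a b, [\/ lt a b, a = b | lt b a].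
Hypothesis lt_add : forall a b c, lt a b -> lt (a + c) (b + c).
Hypothesis lt_mul : forall a b c, lt 0 c -> lt a b -> lt (a * c) (b * c).
Hypothesis lt_succ : forall a, lt 0 (a + 1).
Hypothesis lt_sub : forall a b, lt a b -> exists d, b = a + (d + 1).

(* [((a, b), c)] stands for [(a - b) / (c + 1)]. *)
Definition frac : Type := (N * N * N)%type.
Definition feq (t u : frac) : Prop :=
  t.1.1 * (u.2 + 1) + u.1.2 * (t.2 + 1) = u.1.1 * (t.2 + 1) + t.1.2 * (u.2 + 1).

Lemma addr_cancel (a b c : N) : a + c = b + c -> a = b.
Proof.
by move=> h; case: (lt_tot a b) => // /(lt_add c); rewrite h => /lt_irr.
Qed.

Lemma mulr_cancel (a b c : N) : a * (c + 1) = b * (c + 1) -> a = b.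
Proof.
by move=> h; case: (lt_tot a b) => // /(lt_mul (lt_succ c)); rewrite h => /lt_irr.
Qed.

Lemma feq_sym t u : feq t u -> feq u t.
Proof. by rewrite /feq => ->. Qed.

Lemma feq_trans t u v : feq t u -> feq u v -> feq t v.
Proof.
case: t u v => [[a b] c] [[a1 b1] c1] [[a2 b2] c2]; rewrite /feq /= => h1 h2.
apply: (@mulr_cancel _ _ c1).
apply: (@addr_cancel _ _ (a1 * (c + 1) * (c2 + 1) + b1 * (c + 1) * (c2 + 1))).
transitivity ((a * (c1 + 1) + b1 * (c + 1)) * (c2 + 1)
  + (a1 * (c2 + 1) + b2 * (c1 + 1)) * (c + 1)); first by ring.
by rewrite h1 h2; ring.
Qed.

Definition fracq := {P : frac -> Prop | exists t, P = feq t}.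
Definition fcls (t : frac) : fracq :=
  exist (fun P => exists t, P = feq t) (feq t) (ex_intro _ t erefl).

Lemma fclsP t u : fcls t = fcls u <-> feq t u.
Proof.
split=> [[->] //|h]; apply: eq_exist; apply/funext => v; apply/propext.
by split; apply: feq_trans => //; exact: feq_sym.
Qed.

Lemma fcls_surj (q : fracq) : exists t, q = fcls t.
Proof. by case: q => P [t e]; exists t; apply: eq_exist. Qed.

Definition frep (q : fracq) : frac := projT1 (cid (fcls_surj q)).
Lemma frepP t : feq (frep (fcls t)) t.
Proof. by apply/fclsP; rewrite /frep; case: cid => u /= <-. Qed.

Definition fadd (t u : frac) : frac :=
  (t.1.1 * (u.2 + 1) + u.1.1 * (t.2 + 1), t.1.2 * (u.2 + 1) + u.1.2 * (t.2 + 1),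
   t.2 * u.2 + t.2 + u.2).
Definition fmul (t u : frac) : frac :=
  (t.1.1 * u.1.1 + t.1.2 * u.1.2, t.1.1 * u.1.2 + t.1.2 * u.1.1, t.2 * u.2 + t.2 + u.2).
Definition fopp (t : frac) : frac := (t.1.2, t.1.1, t.2).
Definition fpos (t : frac) : Prop := lt t.1.2 t.1.1.

Lemma fden (c d : N) : c * d + c + d + 1 = (c + 1) * (d + 1).
Proof. ring. Qed.

Lemma fadd_feq t u v : feq t u -> feq (fadd t v) (fadd u v).
Proof.
case: t u v => [[a b] c] [[a1 b1] c1] [[a2 b2] c2]; rewrite /feq /= !fden => h.
transitivity ((a * (c1 + 1) + b1 * (c + 1)) * (c2 + 1) * (c2 + 1)
  + (a2 + b2) * (c + 1) * (c1 + 1) * (c2 + 1)); first by ring.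
by rewrite h; ring.
Qed.

Lemma fmul_feq t u v : feq t u -> feq (fmul t v) (fmul u v).
Proof.
case: t u v => [[a b] c] [[a1 b1] c1] [[a2 b2] c2]; rewrite /feq /= !fden => h.
transitivity ((c2 + 1) * (a2 * (a * (c1 + 1) + b1 * (c + 1))
  + b2 * (a1 * (c + 1) + b * (c1 + 1)))); first by ring.
transitivity ((c2 + 1) * (a2 * (a1 * (c + 1) + b * (c1 + 1))
  + b2 * (a * (c1 + 1) + b1 * (c + 1)))); first by rewrite h.
by ring.
Qed.

Lemma fopp_feq t u : feq t u -> feq (fopp t) (fopp u).
Proof. by rewrite /feq /= => h; rewrite addrC -h addrC. Qed.

Lemma lt_addl a b c : lt a b -> lt (c + a) (c + b).
Proof. by rewrite ![c + _]addrC; exact: lt_add. Qed.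

Lemma fpos_feq t u : feq t u -> fpos t -> fpos u.
Proof.
case: t u => [[a b] c] [[a1 b1] c1]; rewrite /feq /fpos /= => h ba.
have h1 : lt (b * (c1 + 1)) (a * (c1 + 1)) by exact: lt_mul.
have h2 : lt (b1 * (c + 1)) (a1 * (c + 1)).
  have h3 := lt_addl (b1 * (c + 1)) h1; rewrite [X in lt _ X]addrC h in h3.
  case: (lt_tot (b1 * (c + 1)) (a1 * (c + 1))) => // [e|l].
    by case: (@lt_irr (a1 * (c + 1) + b * (c1 + 1))); rewrite -{1}e.
  by case: (lt_irr (lt_tr h3 (lt_add _ l))).
case: (lt_tot b1 a1) => // [e|l]; first by move: h2; rewrite e => /lt_irr.
by case: (lt_irr (lt_tr h2 (lt_mul (lt_succ c) l))).
Qed.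

HB.instance Definition _ := gen_eqMixin fracq.
HB.instance Definition _ := gen_choiceMixin fracq.

Definition qadd_ (x y : fracq) := fcls (fadd (frep x) (frep y)).
Definition qmul_ (x y : fracq) := fcls (fmul (frep x) (frep y)).
Definition qopp_ (x : fracq) := fcls (fopp (frep x)).

Lemma faddC t u : fadd t u = fadd u t.
Proof. by rewrite /fadd; congr (_, _, _); ring. Qed.
Lemma fmulC t u : fmul t u = fmul u t.
Proof. by rewrite /fmul; congr (_, _, _); ring. Qed.

Lemma qadd_cls t u : qadd_ (fcls t) (fcls u) = fcls (fadd t u).
Proof.
apply/fclsP; apply: feq_trans (fadd_feq _ (frepP t)) _.
by rewrite ![fadd t _]faddC; exact: fadd_feq (frepP u).
Qed.
Lemma qmul_cls t u : qmul_ (fcls t) (fcls u) = fcls (fmul t u).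
Proof.
apply/fclsP; apply: feq_trans (fmul_feq _ (frepP t)) _.
by rewrite ![fmul t _]fmulC; exact: fmul_feq (frepP u).
Qed.
Lemma qopp_cls t : qopp_ (fcls t) = fcls (fopp t).
Proof. by apply/fclsP; exact: fopp_feq (frepP t). Qed.

Let qE := (qadd_cls, qmul_cls, qopp_cls).
Ltac by_reps := repeat (let x := fresh "x" in move=> x;
  let a := fresh "a" in let b := fresh "b" in let c := fresh "c" in
  have [[[a b] c] ->] := fcls_surj x);
  rewrite ?qE; apply/fclsP; rewrite /feq /= ?fden; ring.

Lemma qaddA : associative qadd_. Proof. by_reps. Qed.
Lemma qaddC : commutative qadd_. Proof. by_reps. Qed.
Lemma qadd0 : left_id (fcls (0, 0, 0)) qadd_. Proof. by_reps. Qed.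
Lemma qaddN : left_inverse (fcls (0, 0, 0)) qopp_ qadd_. Proof. by_reps. Qed.
HB.instance Definition _ := GRing.isZmodule.Build fracq qaddA qaddC qadd0 qaddN.

Lemma qmulA : associative qmul_. Proof. by_reps. Qed.
Lemma qmulC : commutative qmul_. Proof. by_reps. Qed.
Lemma qmul1 : left_id (fcls (1, 0, 0)) qmul_. Proof. by_reps. Qed.
Lemma qmulD : left_distributive qmul_ qadd_. Proof. by_reps. Qed.
Lemma qone_neq0 : fcls (1, 0, 0) != fcls (0, 0, 0).
Proof.
apply/eqP => /fclsP; rewrite /feq /= !mul0r !add0r !mulr1 !addr0 => e.
by have := lt_succ 0; rewrite add0r e => /lt_irr.
Qed.
HB.instance Definition _ := GRing.Zmodule_isComNzRing.Build fracq
  qmulA qmulC qmul1 qmulD qone_neq0.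

Lemma fcls_eq0 t : fcls t = 0 <-> t.1.1 = t.1.2.
Proof.
case: t => [[a b] c]; rewrite (fclsP _ (0, 0, 0)) /feq /= !mul0r !add0r !mulr1 addr0.
by [].
Qed.

(** Distinct elements differ by a successor [d + 1], and denominators are successors too, so the
    reciprocal is again a fraction of the given form, up to sign. *)
Lemma qinv_ex (x : fracq) : x != 0 -> exists y, y * x = 1.
Proof.
have [[[a b] c] ->] := fcls_surj x => /eqP; rewrite fcls_eq0 /= => ab.
case: (lt_tot a b) => [/lt_sub [d e]|//|/lt_sub [d e]].
  exists (fcls (0, c + 1, d)); rewrite [LHS]qmul_cls; apply/fclsP.
  by rewrite /feq /= e !fden; ring.
exists (fcls (c + 1, 0, d)); rewrite [LHS]qmul_cls; apply/fclsP.
by rewrite /feq /= e !fden; ring.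
Qed.

Definition qinv_ (x : fracq) : fracq :=
  if pselect (x <> 0 /\ exists y, y * x = 1) is left h then projT1 (cid h.2) else 0.

Lemma qmulV x : x != 0 -> qinv_ x * x = 1.
Proof.
move=> x0; rewrite /qinv_; case: pselect => [h|[]]; first by case: cid.
by split; [exact/eqP|exact: qinv_ex].
Qed.

Lemma qinv0 : qinv_ 0 = 0.
Proof. by rewrite /qinv_; case: pselect => // -[]. Qed.

HB.instance Definition _ := GRing.ComNzRing_isField.Build fracq qmulV qinv0.

Definition qpos_ (x : fracq) : Prop := fpos (frep x).
Lemma qpos_cls t : qpos_ (fcls t) <-> fpos t.
Proof. by split; apply: fpos_feq; [|apply: feq_sym]; exact: frepP. Qed.

Definition qlt_ (x y : fracq) : bool := `[< qpos_ (y - x) >].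
Definition qle_ (x y : fracq) : bool := (x == y) || qlt_ x y.
Definition qnorm_ (x : fracq) : fracq := if qlt_ x 0 then - x else x.

Lemma qlt0P x : qlt_ 0 x <-> qpos_ x.
Proof. by rewrite /qlt_ subr0; split=> /asboolP. Qed.

Lemma qlt_cls0 t : qlt_ (fcls t) 0 <-> lt t.1.1 t.1.2.
Proof.
rewrite /qlt_ sub0r [- _]qopp_cls; split=> [/asboolP/qpos_cls|h]; first by [].
by apply/asboolP/qpos_cls.
Qed.

Lemma qlt0_add x y : qlt_ 0 x -> qlt_ 0 y -> qlt_ 0 (x + y).
Proof.
rewrite !qlt0P; have [[[a b] c] ->] := fcls_surj x; have [[[a1 b1] c1] ->] := fcls_surj y.
rewrite [_ + _]qadd_cls !qpos_cls /fpos /= => h1 h2.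
exact: lt_tr (lt_add _ (lt_mul (lt_succ _) h1)) (lt_addl _ (lt_mul (lt_succ _) h2)).
Qed.

Lemma qlt0_mul x y : qlt_ 0 x -> qlt_ 0 y -> qlt_ 0 (x * y).
Proof.
rewrite !qlt0P; have [[[a b] c] ->] := fcls_surj x; have [[[a1 b1] c1] ->] := fcls_surj y.
rewrite [_ * _]qmul_cls !qpos_cls /fpos /= => /lt_sub [d ->] /lt_sub [e ->].
have := lt_addl ((b + (d + 1)) * b1 + b * (b1 + (e + 1))) (lt_succ (d * e + d + e)).
rewrite addr0; congr lt; ring.
Qed.

Lemma qlt0_asym x : qlt_ 0 x -> ~~ qlt_ x 0.
Proof.
rewrite qlt0P; have [t ->] := fcls_surj x; rewrite qpos_cls => h.
by apply/negP => /qlt_cls0 /lt_tr /(_ h) /lt_irr.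
Qed.

Lemma qsub_gt0 x y : qlt_ 0 (y - x) = qlt_ x y.
Proof. by rewrite /qlt_ subr0. Qed.

Lemma qlt0_total x : x != 0 -> qlt_ 0 x || qlt_ x 0.
Proof.
have [t ->] := fcls_surj x => /eqP; rewrite fcls_eq0 => h.
case: (lt_tot t.1.1 t.1.2) => // [l|l]; apply/orP; [right|left].
  by apply/qlt_cls0.
by apply/qlt0P/qpos_cls.
Qed.

Lemma qlt_N0 x : qlt_ (- x) 0 = qlt_ 0 x.
Proof. by rewrite -qsub_gt0 sub0r opprK. Qed.

Lemma qnormN x : qnorm_ (- x) = qnorm_ x.
Proof.
rewrite /qnorm_ qlt_N0 opprK; case: (eqVneq x 0) => [->|x0].
  by rewrite oppr0; case: ifP.
case h: (qlt_ 0 x); first by rewrite (negbTE (qlt0_asym h)).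
by have := qlt0_total x0; rewrite h => /= ->.
Qed.

Lemma qge0_norm x : qle_ 0 x -> qnorm_ x = x.
Proof.
rewrite /qnorm_ => /orP [/eqP <-|/qlt0_asym/negbTE -> //].
by rewrite oppr0; case: ifP.
Qed.

Lemma qle_def x y : qle_ x y = (x == y) || qlt_ x y.
Proof. by []. Qed.

HB.instance Definition _ := Num.IntegralDomain_isLtReal.Build fracq
  qlt0_add qlt0_mul qlt0_asym qsub_gt0 qlt0_total qnormN qge0_norm qle_def.

Theorem ordered_fractions : exists (K : realFieldType) (i : N -> K),
  [/\ i 0 = 0, i 1 = 1, {morph i : x y / x + y} & {morph i : x y / x * y}] /\
  (forall a b, lt a b <-> i a < i b) /\
  (forall k : K, exists a b c, k = (i a - i b) / (i c + 1)).
Proof.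
exists (fracq : realFieldType), (fun a => fcls (a, 0, 0)); split; [split=> //|split].
- move=> x y; rewrite [RHS]qadd_cls; apply/fclsP; rewrite /feq /=; ring.
- move=> x y; rewrite [RHS]qmul_cls; apply/fclsP; rewrite /feq /=; ring.
- move=> a b; change (lt a b <-> qlt_ (fcls (a, 0, 0)) (fcls (b, 0, 0))).
  rewrite -qsub_gt0 qlt0P [- _]qopp_cls [_ + _]qadd_cls qpos_cls /fpos /=.
  by rewrite !(mulr1, mulr0, mul0r, addr0, add0r).
- move=> k; have [[[a b] c] ->] := fcls_surj k; exists a, b, c.
  have c0 : fcls (c, 0, 0) + 1 != 0 :> fracq.
    rewrite [_ + _]qadd_cls; apply/eqP.
    rewrite fcls_eq0 /= !(mulr1, mulr0, mul0r, addr0, add0r) => e.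
    by have := lt_succ c; rewrite e => /lt_irr.
  apply: (mulIf c0); rewrite mulfVK //.
  rewrite [- _]qopp_cls [fcls (c, 0, 0) + _]qadd_cls [LHS]qmul_cls [RHS]qadd_cls.
  by apply/fclsP; rewrite /feq /= !(mulr1, mulr0, mul0r, addr0, add0r); ring.
Qed.
End Fractions.

(** * Arithmetic in a model *)

Section Model.
Variable M : structure.
Hypothesis M_ax : models M (theory_union RCA0w IND).
Hypothesis M_ext : extensional M.

Notation N := (dom M Nat).
Local Notation ltM := (@ltM M).

Lemma RCA_ax G (A : form G) (e : env M G) : RCA0w A -> sat A e.
Proof. by move=> h; apply: M_ax; left. Qed.

(** Here extensionality of the model enters: it turns the defined equality of higher types into
    identity, so that the equations for the combinators can be used for rewriting. *)
Lemma sat_eqf t G (u v : term G t) (e : env M G) : sat (eqf u v) e <-> eval u e = eval v e.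
Proof.
elim: t G u v e => [|s _ t IH] G u v e //=.
split=> [h|h x]; last by apply/IH; rewrite /= !eval_wk h.
by apply: M_ext => x; have /IH := h x; rewrite /= !eval_wk.
Qed.

Lemma app_Pi s t (x : dom M s) (y : dom M t) : app (app (cint M (CPi s t)) x) y = x.
Proof.
have /RCA_ax h := RCA0w_const (ax_Pi (Var (VZ : var (s :: t :: nil) s)) (Var (VS VZ))).
by have /sat_eqf := h (econs x (econs y (@enil M))).
Qed.

Lemma app_Sigma r s t (x : dom M (r ⇒ s ⇒ t)) (y : dom M (r ⇒ s)) (z : dom M r) :
  app (app (app (cint M (CSigma r s t)) x) y) z = app (app x z) (app y z).
Proof.
pose G := (r ⇒ s ⇒ t)%ty :: (r ⇒ s)%ty :: r :: nil.
have /RCA_ax h := RCA0w_const (ax_Sigma (Var (VZ : var G _)) (Var (VS VZ)) (Var (VS (VS VZ)))).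
by have /sat_eqf := h (econs x (econs y (econs z (@enil M)))).
Qed.

Lemma eval_lam G s t (u : term (s :: G) t) (e : env M G) (x : dom M s) :
  app (eval (lam u) e) x = eval u (econs x e).
Proof.
elim: u => {t} [t v|t c|t1 t2 f IHf a IHa] /=.
- refine (@var_case G s (fun t v => app (eval (lam_var v) e) x = eval (Var v) (econs x e)) _ _ t v).
    by rewrite /= app_Sigma !app_Pi.
  by move=> u w /=; rewrite app_Pi.
- by rewrite app_Pi.
- by rewrite app_Sigma IHf IHa.
Qed.

Definition zeroM : N := cint M CZero.
Definition oneM : N := cint M COne.
Definition addM (a b : N) : N := app (app (cint M CAdd) a) b.
Definition mulM (a b : N) : N := app (app (cint M CMul) a) b.

(** Induction in a possibly nonstandard [N] holds only for predicates given by a formula with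
    parameters; every later induction starts by supplying this formula and its environment. *)
Definition definable (P : N -> Prop) :=
  exists G (A : form (Nat :: G)) (e : env M G), forall n, P n <-> sat A (econs n e).

Lemma induction (P : N -> Prop) : definable P ->
  P zeroM -> (forall n, P n -> P (addM n oneM)) -> forall n, P n.
Proof.
move=> [G [A [e hA]]] h0 hS n; apply/hA.
have ind : sat (inst A (Cst CZero)) e -> (forall m, sat A (econs m e) ->
    sat (at_succ A) (econs m e)) -> forall m, sat A (econs m e).
  by have : sat (ind_form A) e by apply: M_ax; right; constructor.
apply: ind.
  rewrite /inst sat_subst.
  set e1 := (X in sat A X); suff -> : e1 = econs zeroM e by apply/hA.
  exact: var_cons_eq.
move=> m /hA/hS/hA h; rewrite /at_succ sat_subst.
set e2 := (X in sat A X); suff -> : e2 = econs (addM m oneM) e by [].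
exact: var_cons_eq.
Qed.

Notation env1 a := (econs a (@enil M)).
Notation env2 a b := (econs a (env1 b)).
Notation env3 a b c := (econs a (env2 b c)).

Notation v0 := (Var VZ).
Notation v1 := (Var (VS VZ)).
Notation v2 := (Var (VS (VS VZ))).
Notation v3 := (Var (VS (VS (VS VZ)))).
Notation v4 := (Var (VS (VS (VS (VS VZ))))).
Notation v5 := (Var (VS (VS (VS (VS (VS VZ)))))).
Notation v6 := (Var (VS (VS (VS (VS (VS (VS VZ))))))).

Definition G3 := Nat :: Nat :: Nat :: nil.
Notation ax0 := (Var (VZ : var G3 Nat)).
Notation ax1 := (Var (VS VZ : var G3 Nat)).
Notation ax2 := (Var (VS (VS VZ) : var G3 Nat)).

Lemma use_ax a b c (A : form G3) (h : semiring_ax A) : sat A (env3 a b c).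
Proof. exact: RCA_ax (RCA0w_semiring h). Qed.
Lemma addMA a b c : addM (addM a b) c = addM a (addM b c).
Proof. exact: (use_ax a b c (sr_addA ax0 ax1 ax2)). Qed.
Lemma addMC a b : addM a b = addM b a.
Proof. exact: (use_ax a b zeroM (sr_addC ax0 ax1)). Qed.
Lemma addM0 a : addM a zeroM = a.
Proof. exact: (use_ax a zeroM zeroM (sr_add0 ax0)). Qed.
Lemma mulMA a b c : mulM (mulM a b) c = mulM a (mulM b c).
Proof. exact: (use_ax a b c (sr_mulA ax0 ax1 ax2)). Qed.
Lemma mulMC a b : mulM a b = mulM b a.
Proof. exact: (use_ax a b zeroM (sr_mulC ax0 ax1)). Qed.
Lemma mulM1 a : mulM a oneM = a.
Proof. exact: (use_ax a zeroM zeroM (sr_mul1 ax0)). Qed.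
Lemma mulM0 a : mulM a zeroM = zeroM.
Proof. exact: (use_ax a zeroM zeroM (sr_mul0 ax0)). Qed.
Lemma mulMD a b c : mulM a (addM b c) = addM (mulM a b) (mulM a c).
Proof. exact: (use_ax a b c (sr_distr ax0 ax1 ax2)). Qed.
Lemma ltM_irr a : ~ ltM a a.
Proof. exact: (use_ax a zeroM zeroM (sr_irr ax0)). Qed.
Lemma ltM_trans a b c : ltM a b -> ltM b c -> ltM a c.
Proof. exact: (use_ax a b c (sr_lttrans ax0 ax1 ax2)). Qed.
Lemma ltM_total a b : [\/ ltM a b, a = b | ltM b a].
Proof.
by case: (use_ax a b zeroM (sr_total ax0 ax1)) => [h|[h|h]];
  [apply: Or31|apply: Or32|apply: Or33].
Qed.
Lemma ltM_add a b c : ltM a b -> ltM (addM a c) (addM b c).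
Proof. exact: (use_ax a b c (sr_ltadd ax0 ax1 ax2)). Qed.
Lemma ltM_mul a b c : ltM zeroM c -> ltM a b -> ltM (mulM a c) (mulM b c).
Proof. exact: (use_ax a b c (sr_ltmul ax0 ax1 ax2)). Qed.
Lemma ltM_01 : ltM zeroM oneM.
Proof. exact: (use_ax zeroM zeroM zeroM (sr_01 _)). Qed.
Lemma ltM_ge0 a : ltM zeroM a \/ zeroM = a.
Proof. exact: (use_ax a zeroM zeroM (sr_ge0 ax0)). Qed.
Lemma ltM_discr a b : ltM a b -> ltM (addM a oneM) b \/ addM a oneM = b.
Proof. exact: (use_ax a b zeroM (sr_discr ax0 ax1)). Qed.

Lemma ltM_succ0 a : ltM zeroM (addM a oneM).
Proof.
have h := ltM_add a ltM_01; rewrite addMC addM0 addMC in h.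
by case: (ltM_ge0 a) => [h'|<-] //; [exact: ltM_trans h' h|rewrite addMC addM0; exact: ltM_01].
Qed.

Lemma ltM_succ a : ltM a (addM a oneM).
Proof. by have := ltM_add a ltM_01; rewrite addMC addM0 addMC. Qed.

Lemma ltM_sub a b : ltM a b -> exists d, b = addM a (addM d oneM).
Proof.
move: b; apply: induction.
- by exists (Nat :: nil), (v1 ≺ v0 ⊃ ∃[d : 0] (v0↑ ≐ v1↑ + (d + 1)))%fm, (env1 a).
- by case: (ltM_ge0 a) => [h /(ltM_trans h)/ltM_irr|<- /ltM_irr].
move=> b IH h; case: (ltM_total a b) => [/IH [d ->]|->|h'].
- by exists (addM d oneM); rewrite !addMA.
- by exists zeroM; rewrite [addM zeroM _]addMC addM0.
- case: (ltM_discr h') => [/(ltM_trans h)|e]; first by move/ltM_irr.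
  by case: (@ltM_irr a); rewrite -{2}e.
Qed.

Definition nat_sort : Type := N.
HB.instance Definition _ := gen_eqMixin nat_sort.
HB.instance Definition _ := gen_choiceMixin nat_sort.

Lemma addM_A : associative (addM : nat_sort -> _ -> nat_sort).
Proof. by move=> a b c; rewrite addMA. Qed.
Lemma addM_C : commutative (addM : nat_sort -> _ -> nat_sort).
Proof. by move=> a b; exact: addMC. Qed.
Lemma addM_0 : left_id (zeroM : nat_sort) (addM : nat_sort -> _ -> nat_sort).
Proof. by move=> a; rewrite addMC addM0. Qed.
HB.instance Definition _ := GRing.isNmodule.Build nat_sort addM_A addM_C addM_0.

Lemma mulM_A : associative (mulM : nat_sort -> _ -> nat_sort).
Proof. by move=> a b c; rewrite mulMA. Qed.
Lemma mulM_C : commutative (mulM : nat_sort -> _ -> nat_sort).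
Proof. by move=> a b; exact: mulMC. Qed.
Lemma mulM_1 : left_id (oneM : nat_sort) (mulM : nat_sort -> _ -> nat_sort).
Proof. by move=> a; rewrite mulMC mulM1. Qed.
Lemma mulM_D : left_distributive (mulM : nat_sort -> _ -> nat_sort)
  (addM : nat_sort -> _ -> nat_sort).
Proof. by move=> a b c; rewrite ![mulM _ c]mulMC mulMD. Qed.
Lemma mulM_0 : left_zero (zeroM : nat_sort) (mulM : nat_sort -> _ -> nat_sort).
Proof. by move=> a; rewrite mulMC mulM0. Qed.
HB.instance Definition _ := GRing.Nmodule_isComPzSemiRing.Build nat_sort
  mulM_A mulM_C mulM_1 mulM_D mulM_0.

Local Open Scope ring_scope.
Import Order.TTheory GRing.Theory Num.Theory.

(** Stated as mere existence, so that the sequel sees an abstract ordered field. The arithmetic of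
    the model then becomes accessible to [ring], [lra] and [nra] through the embedding [i]. *)
Lemma fractions_of_model : exists (K : realFieldType) (i : N -> K),
  [/\ i zeroM = 0, i oneM = 1, {morph i : x y / addM x y >-> x + y}
    & {morph i : x y / mulM x y >-> x * y}] /\
  (forall a b, ltM a b <-> i a < i b) /\
  (forall k : K, exists a b c, k = (i a - i b) / (i c + 1)).
Proof.
apply: (@ordered_fractions nat_sort ltM).
- exact: ltM_irr.
- exact: ltM_trans.
- exact: ltM_total.
- by move=> a b c; exact: ltM_add.
- by move=> a b c; exact: ltM_mul.
- exact: ltM_succ0.
- exact: ltM_sub.
Qed.

Variables (K : realFieldType) (i : N -> K).
Hypotheses (i0 : i zeroM = 0) (i1 : i oneM = 1).
Hypotheses (iD : {morph i : x y / addM x y >-> x + y})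
  (iM : {morph i : x y / mulM x y >-> x * y}).
Hypothesis i_lt : forall a b, ltM a b <-> i a < i b.
Hypothesis i_surj : forall k : K, exists a b c, k = (i a - i b) / (i c + 1).

Lemma i_inj a b : i a = i b -> a = b.
Proof. by move=> e; case: (ltM_total a b) => // /i_lt; rewrite e ltxx. Qed.

Lemma i_ge0 a : 0 <= i a.
Proof. by case: (ltM_ge0 a) => [/i_lt|<-]; rewrite i0 // => /ltW. Qed.

Lemma i_discr a b : i a < i b -> i a + 1 <= i b.
Proof. by move=> /i_lt/ltM_discr [/i_lt|<-]; rewrite iD i1 // => /ltW. Qed.

Lemma i_case a : a = zeroM \/ exists b, a = addM b oneM.
Proof.
case: (ltM_ge0 a) => [/ltM_sub [b ->]|->]; last by left.
by right; exists b; apply: i_inj; rewrite iD i0 add0r.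
Qed.

Definition iE := (iD, iM, i0, i1).

Lemma sat_tle G (a b : term G Nat) (e : env M G) : sat (tle a b) e <-> i (eval a e) <= i (eval b e).
Proof.
rewrite le_eqVlt; split=> [[/i_lt ->|/= ->]|/orP [/eqP/i_inj ?|/i_lt ?]].
- by rewrite orbT.
- by rewrite eqxx.
- by right.
- by left.
Qed.

(** * Primitive recursive arithmetic and pairing in the model *)

Definition recM (f : dom M (Nat ⇒ Nat ⇒ Nat)) (m n : N) : N :=
  app (app (app (cint M CRec) f) m) n.

Lemma recM_0 f m : recM f m zeroM = m.
Proof.
pose G := (Nat ⇒ Nat ⇒ Nat)%ty :: Nat :: nil.
have /RCA_ax h := RCA0w_const (ax_Rec0 (Var (VZ : var G _)) v1).
exact: (h (econs f (env1 m))).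
Qed.

Lemma recM_S f m n : recM f m (addM n oneM) = app (app f n) (recM f m n).
Proof.
pose G := (Nat ⇒ Nat ⇒ Nat)%ty :: Nat :: Nat :: nil.
have /RCA_ax h := RCA0w_const (ax_RecS (Var (VZ : var G _)) v1 v2).
exact: (h (econs f (env2 m n))).
Qed.

Lemma eval_rec G (f : term G (Nat ⇒ Nat ⇒ Nat)) m n (e : env M G) :
  eval (Cst CRec ⋅ f ⋅ m ⋅ n)%tm e = recM (eval f e) (eval m e) (eval n e).
Proof. by []. Qed.

Lemma eval_add G (m n : term G Nat) (e : env M G) :
  eval (m + n)%tm e = addM (eval m e) (eval n e).
Proof. by []. Qed.
Lemma eval_mul G (m n : term G Nat) (e : env M G) :
  eval (m * n)%tm e = mulM (eval m e) (eval n e).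
Proof. by []. Qed.

Definition predM n := eval (tpred v0) (env1 n).
Definition subM m n := eval (tsub v0 v1) (env2 m n).
Definition pow2M n := eval (tpow2 v0) (env1 n).
Definition triM n := eval (ttri v0) (env1 n).
Definition rootM n := eval (troot v0) (env1 n).

Lemma eval_pred G (n : term G Nat) (e : env M G) : eval (tpred n) e = predM (eval n e).
Proof. by []. Qed.
Lemma eval_sub G (m n : term G Nat) (e : env M G) :
  eval (tsub m n) e = subM (eval m e) (eval n e).
Proof. by []. Qed.
Lemma eval_pow2 G (n : term G Nat) (e : env M G) : eval (tpow2 n) e = pow2M (eval n e).
Proof. by []. Qed.
Lemma eval_tri G (n : term G Nat) (e : env M G) : eval (ttri n) e = triM (eval n e).
Proof. by []. Qed.
Lemma eval_root G (n : term G Nat) (e : env M G) : eval (troot n) e = rootM (eval n e).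
Proof. by []. Qed.

Lemma predM_0 : predM zeroM = zeroM.
Proof. by rewrite /predM /tpred eval_rec recM_0. Qed.
Lemma predM_S n : predM (addM n oneM) = n.
Proof. by rewrite /predM /tpred eval_rec recM_S /lam_in !eval_lam. Qed.
Lemma subM_0 m : subM m zeroM = m.
Proof. by rewrite /subM /tsub eval_rec recM_0. Qed.
Lemma subM_S m n : subM m (addM n oneM) = predM (subM m n).
Proof. by rewrite {1}/subM /tsub eval_rec recM_S /lam_in !eval_lam. Qed.
Lemma pow2M_0 : pow2M zeroM = oneM.
Proof. by rewrite /pow2M /tpow2 eval_rec recM_0. Qed.
Lemma pow2M_S n : pow2M (addM n oneM) = addM (pow2M n) (pow2M n).
Proof. by rewrite {1}/pow2M /tpow2 eval_rec recM_S /lam_in !eval_lam. Qed.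
Lemma triM_0 : triM zeroM = zeroM.
Proof. by rewrite /triM /ttri eval_rec recM_0. Qed.
Lemma triM_S n : triM (addM n oneM) = addM (triM n) (addM n oneM).
Proof. by rewrite {1}/triM /ttri eval_rec recM_S /lam_in !eval_lam. Qed.
Lemma rootM_0 : rootM zeroM = zeroM.
Proof. by rewrite /rootM /troot eval_rec recM_0. Qed.
Lemma rootM_S n : rootM (addM n oneM) = addM (rootM n)
  (subM oneM (subM (triM (addM (rootM n) oneM)) (addM n oneM))).
Proof. by rewrite {1}/rootM /troot eval_rec recM_S /lam_in !eval_lam. Qed.

Lemma subM_spec m n : m = addM (subM m n) n \/ (subM m n = zeroM /\ ltM m n).
Proof.
move: n; apply: induction.
- by exists (Nat :: nil), ((v1 ≐ tsub v1 v0 + v0) ∨ ((tsub v1 v0 ≐ 0) ∧ (v1 ≺ v0)))%fm, (env1 m).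
- by left; rewrite subM_0 addM0.
move=> n; rewrite subM_S => -[e|[-> h]]; last first.
  by right; rewrite predM_0; split=> //; exact: ltM_trans h (ltM_succ _).
move: e; case: (i_case (subM m n)) => [->|[d ->]] e.
  right; rewrite predM_0; split=> //.
  by apply/i_lt; rewrite e !iE add0r ltrDl ltr01.
by left; rewrite predM_S; apply: i_inj; rewrite {1}e !iE; ring.
Qed.

Lemma i_sub m n : i n <= i m -> i (subM m n) = i m - i n.
Proof.
case: (subM_spec m n) => [e _|[_ /i_lt h]]; last by rewrite leNgt h.
by rewrite [in RHS]e iD addrK.
Qed.

Lemma i_sub0 m n : i m <= i n -> i (subM m n) = 0.
Proof.
case: (subM_spec m n) => [e|[-> _]]; last by rewrite i0.
rewrite {1}e iD => h; apply/eqP; rewrite eq_le i_ge0 andbT; lra.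
Qed.

Lemma i_tri n : 2 * i (triM n) = i n * (i n + 1).
Proof.
suff : addM (triM n) (triM n) = mulM n (addM n oneM).
  by move/(congr1 i); rewrite !iE => <-; ring.
move: n; apply: induction.
- by exists nil, (ttri v0 + ttri v0 ≐ v0 * (v0 + 1))%fm, (@enil M).
- by apply: i_inj; rewrite triM_0 !iE; ring.
- move=> n /(congr1 i); rewrite !iE => h; apply: i_inj; rewrite triM_S !iE.
  by transitivity (i (triM n) + i (triM n) + 2 * (i n + 1)); [ring|rewrite h; ring].
Qed.

Lemma i_root n : i (triM (rootM n)) <= i n < i (triM (addM (rootM n) oneM)).
Proof.
suff [h1 h2] : (ltM (triM (rootM n)) n \/ triM (rootM n) = n) /\
    ltM n (triM (addM (rootM n) oneM)).
  by apply/andP; split; [case: h1 => [/i_lt/ltW|->]|apply/i_lt].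
move: n; apply: induction.
- by exists nil, (tle (ttri (troot v0)) v0 ∧ (v0 ≺ ttri (troot v0 + 1)))%fm, (@enil M).
- rewrite rootM_0 triM_0; split; first by right.
  by apply/i_lt; rewrite triM_S triM_0 !iE; lra.
move=> n; rewrite rootM_S; set r := rootM n; set t := triM (addM r oneM).
case=> hr hn; have ht : i t = i (triM r) + i r + 1 by rewrite /t triM_S !iE; ring.
have tn : i n + 1 <= i t by apply: i_discr; apply/i_lt.
have hr' : i (triM r) <= i n by case: hr => [/i_lt/ltW|->].
(* Because [n < t], the test succeeds only when [t = n + 1]; hence an increment by one is always
   enough. *)
case: (leP (i t) (i n + 1)) => h.
  have -> : subM oneM (subM t (addM n oneM)) = oneM.
    by apply: i_inj; rewrite i_sub ?i_sub0 !iE ?subr0 //; lra.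
  rewrite -/t; split.
    by right; apply: i_inj; rewrite !iE; lra.
  apply/i_lt; rewrite triM_S -/t !iE; have := i_ge0 r; lra.
have h1 : i n + 2 <= i t by have := @i_discr (addM n oneM) t; rewrite !iE; lra.
have -> : subM oneM (subM t (addM n oneM)) = zeroM.
  by apply: i_inj; rewrite i_sub0 !iE // i_sub !iE //; lra.
rewrite addM0 -/r; split; last by apply/i_lt; rewrite -/t !iE; lra.
by left; apply/i_lt; rewrite !iE; lra.
Qed.

Definition pairM a b := addM (triM (addM a b)) a.
Definition fstM n := subM n (triM (rootM n)).
Definition sndM n := subM (rootM n) (fstM n).

(** The intervals between consecutive triangular numbers are disjoint, and [a <= a + b] places the
    code in the interval that begins at [triM (a + b)]. *)
Lemma rootM_pair a b : rootM (pairM a b) = addM a b.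
Proof.
apply: i_inj; set n := pairM a b; have := i_root n; have := i_tri (rootM n).
have := i_tri (addM (rootM n) oneM); have := i_tri (addM a b).
have := i_ge0 a; have := i_ge0 b; have := i_ge0 (rootM n).
have -> : i n = i (triM (addM a b)) + i a by rewrite !iE.
rewrite !iE; set r := i (rootM n) => r_ge0 b_ge0 a_ge0 h1 h2 h3 /andP [h4 h5].
case: (ltgtP r (i a + i b)) => // h.
  have := @i_discr (rootM n) (addM a b); rewrite !iE -/r => /(_ h) h6; nra.
have := @i_discr (addM a b) (rootM n); rewrite !iE -/r => /(_ h) h6; nra.
Qed.

Lemma fstM_pair a b : fstM (pairM a b) = a.
Proof.
apply: i_inj; rewrite /fstM rootM_pair i_sub /pairM !iE; first by ring.
by have := i_ge0 a; lra.
Qed.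
Lemma sndM_pair a b : sndM (pairM a b) = b.
Proof.
apply: i_inj; rewrite /sndM fstM_pair rootM_pair i_sub !iE; first by ring.
by have := i_ge0 b; lra.
Qed.

Lemma eval_pair G (a b : term G Nat) (e : env M G) :
  eval (tpair a b) e = pairM (eval a e) (eval b e).
Proof. by []. Qed.
Lemma eval_fst G (a : term G Nat) (e : env M G) : eval (tfst a) e = fstM (eval a e).
Proof. by []. Qed.
Lemma eval_snd G (a : term G Nat) (e : env M G) : eval (tsnd a) e = sndM (eval a e).
Proof. by []. Qed.

(** * Rationals and reals of a model *)

Definition val (q : N) : K := (i (fstM (fstM q)) - i (sndM (fstM q))) / (i (sndM q) + 1).
Definition eps (n : N) : K := (i (pow2M n))^-1.

Lemma den_gt0 (a : N) : 0 < i a + 1.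
Proof. by have := i_ge0 a; lra. Qed.

Lemma den_neq0 (a : N) : i a + 1 != 0.
Proof. exact: lt0r_neq0 (den_gt0 a). Qed.

Lemma val_mkq G (a b c : term G Nat) (e : env M G) :
  val (eval (mkq a b c) e) = (i (eval a e) - i (eval b e)) / (i (eval c e) + 1).
Proof. by rewrite /mkq /val !eval_pair !(fstM_pair, sndM_pair). Qed.

Lemma val_surj k : exists q, val q = k.
Proof.
have [a [b [c ->]]] := i_surj k.
by exists (eval (mkq v0 v1 v2) (env3 a b c)); rewrite val_mkq.
Qed.

Lemma eval_qpos G (q : term G Nat) (e : env M G) : eval (qpos q) e = fstM (fstM (eval q e)).
Proof. by []. Qed.
Lemma eval_qneg G (q : term G Nat) (e : env M G) : eval (qneg q) e = sndM (fstM (eval q e)).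
Proof. by []. Qed.
Lemma eval_qden G (q : term G Nat) (e : env M G) :
  eval (qden q) e = addM (sndM (eval q e)) oneM.
Proof. by []. Qed.

Definition evalE := (eval_pair, eval_fst, eval_snd, eval_qpos, eval_qneg, eval_qden,
  eval_add, eval_mul, eval_pred, eval_sub, eval_tri, eval_root, eval_pow2).

(* Otherwise rewriting unfolds these terms down to combinators. *)
Opaque tpred tsub tpow2 ttri troot tpair tfst tsnd predM subM pow2M triM rootM.

Lemma den_mul (a b : N) :
  i (subM (mulM (addM a oneM) (addM b oneM)) oneM) + 1 = (i a + 1) * (i b + 1).
Proof.
rewrite i_sub !iE; first by ring.
by have := i_ge0 a; have := i_ge0 b; nra.
Qed.

Lemma val_qadd G (q r : term G Nat) (e : env M G) :
  val (eval (qadd q r) e) = val (eval q e) + val (eval r e).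
Proof.
rewrite /qadd val_mkq !evalE den_mul /val !iE.
by field; rewrite !den_neq0.
Qed.

Lemma val_qopp G (q : term G Nat) (e : env M G) : val (eval (qopp q) e) = - val (eval q e).
Proof. by rewrite /qopp val_mkq !evalE /val; field; rewrite den_neq0. Qed.

Lemma val_qsub G (q r : term G Nat) (e : env M G) :
  val (eval (qsub q r) e) = val (eval q e) - val (eval r e).
Proof. by rewrite /qsub val_qadd val_qopp. Qed.

Lemma val_qabs G (q : term G Nat) (e : env M G) : val (eval (qabs q) e) = `|val (eval q e)|.
Proof.
rewrite /qabs val_mkq !evalE /val normrM normfV (gtr0_norm (den_gt0 _)) !iE.
rewrite subr0; congr (_ / _).
set a := fstM (fstM _); set b := sndM (fstM _).
case: (leP (i a) (i b)) => [h|/ltW h].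
  by rewrite i_sub0 // i_sub // ler0_norm; lra.
by rewrite i_sub // i_sub0 // ger0_norm; lra.
Qed.

Lemma cmp_frac (p n p' n' d d' : K) : 0 < d -> 0 < d' ->
  ((p - n) / d < (p' - n') / d') = (p * d' + n' * d < p' * d + n * d').
Proof.
move=> d0 d0'; rewrite ltr_pdivrMr // mulrAC ltr_pdivlMr //.
by rewrite -subr_gt0 -[in RHS]subr_gt0; congr (0 < _); ring.
Qed.

Lemma sat_lt G (q r : term G Nat) (e : env M G) :
  sat (q ≺ r)%fm e <-> i (eval q e) < i (eval r e).
Proof. exact: i_lt. Qed.

Lemma sat_qlt G (q r : term G Nat) (e : env M G) :
  sat (qlt q r) e <-> val (eval q e) < val (eval r e).
Proof. by rewrite /qlt sat_lt !evalE !iE /val cmp_frac ?den_gt0. Qed.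

Lemma sat_qle G (q r : term G Nat) (e : env M G) :
  sat (qle q r) e <-> val (eval q e) <= val (eval r e).
Proof. by rewrite /qle sat_tle !evalE !iE /val [_ / _ <= _]leNgt cmp_frac ?den_gt0 // -leNgt. Qed.

Lemma pow2M_ge1 n : 1 <= i (pow2M n).
Proof.
suff : ltM zeroM (pow2M n).
  by move=> /i_lt; rewrite i0 => h; have := @i_discr zeroM (pow2M n); rewrite i0; lra.
move: n; apply: induction.
- by exists nil, (0 ≺ tpow2 v0)%fm, (@enil M).
- by rewrite pow2M_0; exact: ltM_01.
- by move=> n /i_lt; rewrite pow2M_S i0 => h; apply/i_lt; rewrite !iE; lra.
Qed.

Lemma pow2M_gt n : i n < i (pow2M n).
Proof.
apply/i_lt; move: n; apply: induction.
- by exists nil, (v0 ≺ tpow2 v0)%fm, (@enil M).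
- by rewrite pow2M_0; exact: ltM_01.
- move=> n /i_lt h; apply/i_lt; rewrite pow2M_S !iE; have := pow2M_ge1 n.
  by have := i_discr h; lra.
Qed.

Lemma pow2M_mono n d : i (pow2M n) <= i (pow2M (addM n d)).
Proof.
move: d; apply: induction.
- exists (Nat :: nil), (tle (tpow2 v1) (tpow2 (v1 + v0)))%fm, (env1 n) => d.
  by rewrite sat_tle.
- by rewrite addM0.
- move=> d; rewrite -addMA pow2M_S !iE; have := pow2M_ge1 (addM n d); lra.
Qed.

Lemma eps_gt0 n : 0 < eps n.
Proof. by rewrite /eps invr_gt0; have := pow2M_ge1 n; lra. Qed.

Lemma epsS n : eps (addM n oneM) = eps n / 2.
Proof.
rewrite /eps pow2M_S !iE.
have -> : i (pow2M n) + i (pow2M n) = i (pow2M n) * 2 by ring.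
by rewrite invfM.
Qed.

Lemma i_leD n m : i n <= i m -> exists d, m = addM n d.
Proof.
rewrite le_eqVlt => /orP [/eqP/i_inj ->|/i_lt/ltM_sub [d ->]].
  by exists zeroM; rewrite addM0.
by exists (addM d oneM).
Qed.

Lemma eps_anti n m : i n <= i m -> eps m <= eps n.
Proof.
move=> /i_leD [d ->]; rewrite /eps lef_pV2 ?posrE ?pow2M_mono //;
  by have := pow2M_ge1 n; have := pow2M_ge1 (addM n d); lra.
Qed.

Lemma val_eps G (n : term G Nat) (e : env M G) : val (eval (qeps n) e) = eps (eval n e).
Proof.
rewrite /qeps val_mkq !evalE -/oneM /eps.
have h := pow2M_ge1 (eval n e).
rewrite -[eval 1%tm e]/oneM -[eval 0%tm e]/zeroM i_sub !iE //.
by rewrite subr0 subrK div1r.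
Qed.

Lemma val_eps2 G (n : term G Nat) (e : env M G) : val (eval (qeps2 n) e) = 2 * eps (eval n e).
Proof.
rewrite /qeps2 val_mkq !evalE /eps.
have h := pow2M_ge1 (eval n e).
rewrite -[eval 1%tm e]/oneM -[eval 0%tm e]/zeroM i_sub !iE // subrK.
by congr (_ * _); ring.
Qed.

Lemma val_zero G (e : env M G) : val (eval (qzero G) e) = 0.
Proof.
rewrite /qzero val_mkq -[eval 0%tm e]/zeroM !iE; by rewrite subr0 mul0r.
Qed.
Lemma val_one G (e : env M G) : val (eval (qone G) e) = 1.
Proof.
rewrite /qone val_mkq -[eval 0%tm e]/zeroM -[eval 1%tm e]/oneM !iE.
by rewrite subr0 add0r divr1.
Qed.

(** Archimedean relative to the model's own naturals: a positive fraction with denominator [c + 1]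
    is at least [1 / (c + 1)], and [c + 1] lies below the power of two with that exponent. *)
Lemma archimedean (d : K) : 0 < d -> exists n, eps n < d.
Proof.
have [a [b [c ->]]] := i_surj d => h.
have ab : i b + 1 <= i a.
  apply: i_discr; have c0 := den_gt0 c.
  by move: h; rewrite pmulr_lgt0 ?invr_gt0 // subr_gt0.
exists (addM c oneM); have := pow2M_gt (addM c oneM); rewrite !iE => hp.
have c0 := den_gt0 c.
rewrite /eps; apply: (@lt_le_trans _ _ (i c + 1)^-1).
  by rewrite ltf_pV2 ?posrE //; lra.
by rewrite -[X in X <= _]mul1r ler_pM2r ?invr_gt0 //; lra.
Qed.

(** * Reals as sequences in the field, compared eventually *)

Definition EvN (P : N -> Prop) := exists n0, forall n, i n0 <= i n -> P n.

Lemma EvN_and P Q : EvN P -> EvN Q -> EvN (fun n => P n /\ Q n).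
Proof.
move=> [n hn] [m hm]; exists (addM n m) => k; rewrite iD => h.
by have := i_ge0 n; have := i_ge0 m => *; split; [apply: hn|apply: hm]; lra.
Qed.

Lemma EvN_mono (P Q : N -> Prop) : (forall n, P n -> Q n) -> EvN P -> EvN Q.
Proof. by move=> h [n hn]; exists n => m /hn/h. Qed.

Lemma EvN_ex P : EvN P -> exists n, P n.
Proof. by move=> [n hn]; exists n; exact: hn. Qed.

Lemma EvN_shift P m : EvN P -> EvN (fun n => P (addM n m)).
Proof. by move=> [n hn]; exists n => k h; apply: hn; rewrite iD; have := i_ge0 m; lra. Qed.

Lemma EvN_ge m : EvN (fun n => i m <= i n).
Proof. by exists m. Qed.

Lemma EvN_all (P : N -> Prop) : (forall n, P n) -> EvN P.
Proof. by move=> h; exists zeroM. Qed.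

Lemma EvN_eps d : 0 < d -> EvN (fun n => eps n < d).
Proof. by move=> /archimedean [n hn]; exists n => m /eps_anti h; exact: le_lt_trans h hn. Qed.

Definition isR (f : N -> K) := forall n k, `|f n - f (addM n k)| < eps n.
Definition Req (f g : N -> K) := forall n, `|f n - g n| <= 2 * eps n.
Definition Rlt (f g : N -> K) := exists n, f n + 2 * eps n < g n.
Definition Rle (f g : N -> K) := ~ Rlt g f.

Lemma isR_le f n m : isR f -> i n <= i m -> `|f n - f m| < eps n.
Proof. by move=> hf /i_leD [d ->]. Qed.

(** This form absorbs the factor [2 * eps n] and the index shifts of [radd] and [rsub] into a margin
    [d]. Facts about several reals can then be read at one common large index and combined
    linearly. *)
Lemma Rlt_ev f g : isR f -> isR g ->
  Rlt f g <-> exists2 d, 0 < d & EvN (fun n => f n + d <= g n).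
Proof.
move=> hf hg; split=> [[n h]|[d d0 h]].
  exists (g n - f n - 2 * eps n); first by lra.
  exists n => m nm; have := isR_le hf nm; have := isR_le hg nm.
  by rewrite !ltr_norml => /andP [? ?] /andP [? ?]; lra.
have d2 : 0 < d / 2 by lra.
have [n [h1 h2]] := EvN_ex (EvN_and h (EvN_eps d2)).
by exists n; lra.
Qed.

Lemma Rle_ev f g : isR f -> isR g ->
  Rle f g <-> forall d, 0 < d -> EvN (fun n => f n <= g n + d).
Proof.
move=> hf hg; split=> [h d d0|h].
  have d2 : 0 < d / 2 by lra.
  apply: EvN_mono (EvN_eps d2) => n hn; rewrite leNgt; apply/negP => h'.
  by apply: h; exists n; lra.
move=> /(Rlt_ev hg hf) [d d0 hd]; have d2 : 0 < d / 2 by lra.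
by have [n [h1 h2]] := EvN_ex (EvN_and hd (h _ d2)); lra.
Qed.

Lemma Req_ev f g : isR f -> isR g ->
  Req f g <-> forall d, 0 < d -> EvN (fun n => `|f n - g n| <= d).
Proof.
move=> hf hg; split=> [h d d0|h n].
  have d2 : 0 < d / 2 by lra.
  by apply: EvN_mono (EvN_eps d2) => n hn; have := h n; lra.
rewrite leNgt; apply/negP => hn.
have d0 : 0 < `|f n - g n| - 2 * eps n by lra.
have [m [h1 nm]] := EvN_ex (EvN_and (h _ d0) (EvN_ge n)).
have := isR_le hf nm; have := isR_le hg nm; rewrite distrC => h2 h3.
have := ler_distD (f m) (f n) (g n); have := ler_distD (g m) (f m) (g n); lra.
Qed.

Definition vx (x : dom M 1) : N -> K := fun n => val (app x n).

(** * Meaning of the formulas in the model *)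

Lemma eval_VZ G s (x : dom M s) (e : env M G) : eval (Var VZ) (econs x e) = x.
Proof. by []. Qed.
Lemma eval_VS G s t (x : dom M s) (v : var G t) (e : env M G) :
  eval (Var (VS v)) (econs x e) = eval (Var v) e.
Proof. by []. Qed.
Lemma eval_app G s t (f : term G (s ⇒ t)) (x : term G s) (e : env M G) :
  eval (f ⋅ x)%tm e = app (eval f e) (eval x e).
Proof. by []. Qed.
Lemma eval_zero G (e : env M G) : eval 0%tm e = zeroM.
Proof. by []. Qed.
Lemma eval_one G (e : env M G) : eval 1%tm e = oneM.
Proof. by []. Qed.
Lemma eval_lam_in G s t (f : term (s :: G) s -> term (s :: G) t) (e : env M G) (x : dom M s) :
  app (eval (lam_in f) e) x = eval (f (Var VZ)) (econs x e).
Proof. exact: eval_lam. Qed.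

Opaque lam_in.

Definition evE := (eval_wk, eval_add, eval_mul, eval_app, eval_VZ, eval_VS, eval_zero, eval_one,
  eval_lam_in).
Definition valE := (val_qabs, val_qsub, val_qopp, val_qadd, val_eps, val_eps2, val_zero, val_one).

Lemma sat_all G s (f : term (s :: G) s -> form (s :: G)) (e : env M G) (Q : dom M s -> Prop) :
  (forall x, sat (f (Var VZ)) (econs x e) <-> Q x) -> sat (all_in f) e <-> forall x, Q x.
Proof. by move=> h; split=> h' x; apply/h. Qed.

Lemma sat_ex G s (f : term (s :: G) s -> form (s :: G)) (e : env M G) (Q : dom M s -> Prop) :
  (forall x, sat (f (Var VZ)) (econs x e) <-> Q x) -> sat (ex_in f) e <-> exists x, Q x.
Proof. by move=> h; split=> -[x /h hx]; exists x. Qed.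

Lemma sat_imp G (A B : form G) (e : env M G) (P Q : Prop) :
  (sat A e <-> P) -> (sat B e <-> Q) -> sat (A ⊃ B)%fm e <-> (P -> Q).
Proof. by move=> h h'; split=> H /h/H/h'. Qed.

Lemma sat_and G (A B : form G) (e : env M G) (P Q : Prop) :
  (sat A e <-> P) -> (sat B e <-> Q) -> sat (A ∧ B)%fm e <-> P /\ Q.
Proof. by move=> h h'; split=> -[/h ? /h' ?]. Qed.

Lemma sat_is_real G (x : term G 1) (e : env M G) :
  sat (is_real x) e <-> isR (vx (eval x e)).
Proof.
apply: sat_all => n; apply: sat_all => k.
by rewrite sat_qlt !valE !evE.
Qed.

Lemma sat_req G (x y : term G 1) (e : env M G) :
  sat (req x y) e <-> Req (vx (eval x e)) (vx (eval y e)).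
Proof. by apply: sat_all => n; rewrite sat_qle !valE !evE. Qed.

Lemma sat_rlt G (x y : term G 1) (e : env M G) :
  sat (rlt x y) e <-> Rlt (vx (eval x e)) (vx (eval y e)).
Proof. by apply: sat_ex => n; rewrite sat_qlt !valE !evE. Qed.

Lemma sat_rle G (x y : term G 1) (e : env M G) :
  sat (rle x y) e <-> Rle (vx (eval x e)) (vx (eval y e)).
Proof. by apply: sat_imp => //; exact: sat_rlt. Qed.

Lemma vx_radd G (x y : term G 1) (e : env M G) :
  vx (eval (radd x y) e)
  = fun n => vx (eval x e) (addM n oneM) + vx (eval y e) (addM n oneM).
Proof. by apply/funext => n; rewrite /vx /radd eval_lam_in !valE !evE. Qed.

Lemma vx_rsub G (x y : term G 1) (e : env M G) :
  vx (eval (rsub x y) e)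
  = fun n => vx (eval x e) (addM n oneM) - vx (eval y e) (addM n oneM).
Proof. by apply/funext => n; rewrite /vx /rsub eval_lam_in !valE !evE. Qed.

Lemma vx_rabs G (x : term G 1) (e : env M G) :
  vx (eval (rabs x) e) = fun n => `|vx (eval x e) n|.
Proof. by apply/funext => n; rewrite /vx /rabs eval_lam_in !valE !evE. Qed.

Lemma vx_rzero G (e : env M G) : vx (eval (rzero G) e) = fun=> 0.
Proof. by apply/funext => n; rewrite /vx /rzero eval_lam_in !valE. Qed.

Lemma vx_rone G (e : env M G) : vx (eval (rone G) e) = fun=> 1.
Proof. by apply/funext => n; rewrite /vx /rone eval_lam_in !valE. Qed.

Definition vxE := (vx_radd, vx_rsub, vx_rabs, vx_rzero, vx_rone).

Definition in01M (f : N -> K) := isR f /\ Rle (fun=> 0) f /\ Rle f (fun=> 1).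

Definition rfun (F : dom M (1 ⇒ 1)) :=
  (forall x, isR (vx x) -> isR (vx (app F x))) /\
  (forall x y, isR (vx x) -> isR (vx y) -> Req (vx x) (vx y) ->
    Req (vx (app F x)) (vx (app F y))).

Definition posrfun (F : dom M (1 ⇒ 1)) :=
  rfun F /\ forall x, isR (vx x) -> Rlt (fun=> 0) (vx (app F x)).

Definition covers (a p x : N -> K) :=
  Rlt (fun n => a (addM n oneM) - p (addM n oneM)) x /\
  Rlt x (fun n => a (addM n oneM) + p (addM n oneM)).

Definition finite_cover (Psi : dom M (1 ⇒ 1)) := exists k (y : dom M (Nat ⇒ 1)),
  (forall j, i j < i k -> in01M (vx (app y j))) /\
  (forall x, in01M (vx x) -> exists j, i j < i k /\
    covers (vx (app y j)) (vx (app Psi (app y j))) (vx x)).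

Definition memM (D : dom M 2) (d : dom M 1) := app D d = oneM.
Definition precM (P : dom M (1 ⇒ 1 ⇒ 0)) (d d' : dom M 1) := app (app P d) d' = oneM.

Definition directed D P :=
  (exists d, memM D d) /\
  (forall x y z, memM D x -> memM D y -> memM D z ->
    precM P x y -> precM P y z -> precM P x z) /\
  (forall x, memM D x -> precM P x x) /\
  (forall x y, memM D x -> memM D y -> exists z, memM D z /\ precM P x z /\ precM P y z).

Definition net D P (X : dom M (1 ⇒ 1)) :=
  (forall d, i (app D d) <= 1) /\ (forall d d', i (app (app P d) d') <= 1) /\
  directed D P /\ (forall d, memM D d -> isR (vx (app X d))).

Definition dist (x y : N -> K) : N -> K := fun n => `|x (addM n oneM) - y (addM n oneM)|.

Definition awayM D P X d x r := forall e, memM D e -> precM P d e ->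
  Rle r (dist x (vx (app X e))).

Definition boundedM D P X := exists delta d, isR (vx delta) /\ Rlt (fun=> 0) (vx delta) /\
  memM D d /\ (forall e, memM D e -> precM P d e -> forall x, in01M (vx x) ->
    Rle (vx delta) (dist (vx x) (vx (app X e)))).

Definition AS_cond D P X (F : dom M (1 ⇒ 1)) := rfun F /\
  forall x, in01M (vx x) -> Rlt (fun=> 0) (vx (app F x)) /\
    exists d, memM D d /\ awayM D P X d (vx x) (vx (app F x)).

Lemma sat_in01 G (x : term G 1) (e : env M G) :
  sat (in01 x) e <-> in01M (vx (eval x e)).
Proof.
apply: sat_and; first exact: sat_is_real.
by apply: sat_and; rewrite sat_rle !vxE.
Qed.

Lemma sat_mem G (d : term G 1) D (e : env M G) :
  sat (mem d D) e <-> memM (eval D e) (eval d e).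
Proof. by []. Qed.
Lemma sat_prec G P (d d' : term G 1) (e : env M G) :
  sat (prec P d d') e <-> precM (eval P e) (eval d e) (eval d' e).
Proof. by []. Qed.

Lemma sat_away G D P X (d x r : term G 1) (e : env M G) :
  sat (away D P X d x r) e <-> awayM (eval D e) (eval P e) (eval X e) (eval d e)
    (vx (eval x e)) (vx (eval r e)).
Proof.
apply: sat_all => c; apply: sat_imp; first by rewrite sat_mem !evE.
apply: sat_imp; first by rewrite sat_prec !evE.
by rewrite sat_rle !vxE !evE.
Qed.

Lemma sat_is_rfun G (F : term G (1 ⇒ 1)) (e : env M G) :
  sat (is_rfun F) e <-> rfun (eval F e).
Proof.
apply: sat_and.
  by apply: sat_all => x; apply: sat_imp; rewrite sat_is_real !evE.
apply: sat_all => x; apply: sat_all => y; apply: sat_imp; first by rewrite sat_is_real !evE.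
apply: sat_imp; first by rewrite sat_is_real !evE.
by apply: sat_imp; rewrite sat_req !evE.
Qed.

Lemma sat_is_posrfun G (F : term G (1 ⇒ 1)) (e : env M G) :
  sat (is_posrfun F) e <-> posrfun (eval F e).
Proof.
apply: sat_and; first exact: sat_is_rfun.
apply: sat_all => x; apply: sat_imp; first by rewrite sat_is_real !evE.
by rewrite sat_rlt !vxE !evE.
Qed.

Lemma sat_is_net G D P (X : term G (1 ⇒ 1)) (e : env M G) :
  sat (is_net D P X) e <-> net (eval D e) (eval P e) (eval X e).
Proof.
apply: sat_and; first by apply: sat_all => x; rewrite sat_tle !evE i1.
apply: sat_and.
  by apply: sat_all => x; apply: sat_all => y; rewrite sat_tle !evE i1.
apply: sat_and; last first.
  by apply: sat_all => x; apply: sat_imp; [rewrite sat_mem !evE|rewrite sat_is_real !evE].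
apply: sat_and; first by apply: sat_ex => x; rewrite sat_mem !evE.
by do ![apply: sat_and|apply: sat_all => ?|apply: sat_imp|apply: sat_ex => ?
  |rewrite sat_mem !evE //|rewrite sat_prec !evE //].
Qed.

Ltac sat_step := lazymatch goal with
  | |- ?P <-> ?P => exact: iff_refl
  | |- Rle _ _ <-> Rle _ _ => exact: iff_refl
  | |- sat (all_in _) _ <-> _ => apply: sat_all => ?
  | |- sat (ex_in _) _ <-> _ => apply: sat_ex => ?
  | |- sat (mem _ _) _ <-> _ => rewrite sat_mem !evE
  | |- sat (prec _ _ _) _ <-> _ => rewrite sat_prec !evE
  | |- sat (is_real _) _ <-> _ => rewrite sat_is_real !evE
  | |- sat (req _ _) _ <-> _ => rewrite sat_req !evE
  | |- sat (rlt (_ ⋅ _)%tm (_ ⋅ _)%tm) _ <-> _ => rewrite sat_rlt !evE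
  | |- sat (rlt _ _) _ <-> _ => rewrite sat_rlt !vxE !evE
  | |- sat (rle _ _) _ <-> _ => rewrite sat_rle !vxE !evE
  | |- sat (in01 _) _ <-> _ => rewrite sat_in01 !evE
  | |- sat (tle _ _) _ <-> _ => rewrite sat_tle !evE
  | |- sat (_ ≺ _)%fm _ <-> _ => rewrite sat_lt !evE
  | |- sat (away _ _ _ _ _ _) _ <-> _ => rewrite sat_away !evE
  | |- sat (is_rfun _) _ <-> _ => rewrite sat_is_rfun !evE
  | |- sat (is_posrfun _) _ <-> _ => rewrite sat_is_posrfun !evE
  | |- sat (is_net _ _ _) _ <-> _ => rewrite sat_is_net !evE
  | |- sat (_ ⊃ _)%fm _ <-> _ => apply: sat_imp
  | |- sat (_ ∧ _)%fm _ <-> _ => apply: sat_and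
  end.
Ltac sat_unfold := repeat sat_step.

Lemma sat_HBU (e : env M nil) :
  sat HBU e <-> forall Psi, posrfun Psi -> finite_cover Psi.
Proof. rewrite /HBU; sat_unfold. Qed.

Lemma sat_AS (e : env M nil) : sat AS_net_minus e <->
  forall D P X, net D P X -> (exists F, AS_cond D P X F) -> boundedM D P X.
Proof. rewrite /AS_net_minus /bounded_away; sat_unfold. Qed.

(** * Eventual forms of covering and distance *)

Lemma isR_lip f h : isR f -> (forall n m, `|h n - h m| <= `|f n - f m|) -> isR h.
Proof. by move=> hf hh n k; exact: le_lt_trans (hh _ _) (hf n k). Qed.

Lemma isR_const (c : K) : isR (fun=> c).
Proof. by move=> n k; rewrite subrr normr0; exact: eps_gt0. Qed.

Lemma isR_shift f n k : isR f ->
  `|f (addM n oneM) - f (addM (addM n k) oneM)| < eps n / 2.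
Proof.
by move=> hf; rewrite -epsS; apply: isR_le => //; rewrite !iE; have := i_ge0 k; lra.
Qed.

Lemma isR_add f g : isR f -> isR g -> isR (fun n => f (addM n oneM) + g (addM n oneM)).
Proof.
move=> hf hg n k; have := isR_shift n k hf; have := isR_shift n k hg.
by rewrite !ltr_norml => /andP [? ?] /andP [? ?]; lra.
Qed.

Lemma isR_sub f g : isR f -> isR g -> isR (fun n => f (addM n oneM) - g (addM n oneM)).
Proof.
move=> hf hg n k; have := isR_shift n k hf; have := isR_shift n k hg.
by rewrite !ltr_norml => /andP [? ?] /andP [? ?]; lra.
Qed.

Lemma isR_dist f g : isR f -> isR g -> isR (dist f g).
Proof. by move=> hf hg; apply: isR_lip (isR_sub hf hg) _ => n m; exact: ler_dist_dist. Qed.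

Lemma EvN_unshift P : EvN (fun n => P (addM n oneM)) -> EvN P.
Proof.
move=> [n hn]; exists (addM n oneM) => m /i_leD [d ->].
have -> : addM (addM n oneM) d = addM (addM n d) oneM by apply: i_inj; rewrite !iE; ring.
by apply: hn; rewrite iD; have := i_ge0 d; lra.
Qed.

Lemma EvN_near f d : isR f -> 0 < d -> EvN (fun n => `|f n - f (addM n oneM)| < d).
Proof. by move=> hf d0; apply: EvN_mono (EvN_eps d0) => n; exact: lt_trans. Qed.

Lemma covers_ev a p x : isR a -> isR p -> isR x ->
  covers a p x <-> exists2 d, 0 < d & EvN (fun n => `|x n - a n| + d <= p n).
Proof.
move=> ha hp hx; rewrite /covers (Rlt_ev (isR_sub ha hp) hx) (Rlt_ev hx (isR_add ha hp)).
split=> [[[d d0 hd] [d' d0' hd']]|[d d0 hd]].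
  pose c := Num.min d d'.
  have c0 : 0 < c by rewrite lt_min d0.
  have [cd cd'] : c <= d /\ c <= d' by rewrite /c !ge_min !lexx orbT.
  exists (c / 2); first by lra.
  have c4 : 0 < c / 4 by lra.
  apply: EvN_unshift; apply: EvN_mono (EvN_and (EvN_and hd hd') (EvN_near hx c4)).
  move=> n [[h1 h2]]; rewrite ltr_norml => /andP [h3 h4].
  by rewrite -lerBrDr ler_norml; apply/andP; split; lra.
have d2 : 0 < d / 2 by lra.
by split; exists (d / 2) => //;
  apply: EvN_mono (EvN_and (EvN_shift oneM hd) (EvN_near hx d2)) => n [];
  rewrite -lerBrDr ler_norml ltr_norml => /andP [? ?] /andP [? ?]; lra.
Qed.

Lemma Rle_dist r x y : isR r -> isR x -> isR y ->
  Rle r (dist x y) <-> forall d, 0 < d -> EvN (fun n => r n <= `|x n - y n| + d).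
Proof.
move=> hr hx hy; rewrite (Rle_ev hr (isR_dist hx hy)).
split=> h d d0; have d2 : 0 < d / 2 by lra.
  apply: EvN_unshift; apply: EvN_mono (EvN_and (h _ d2) (EvN_near hr d2)) => n [].
  by rewrite /dist ltr_norml => ? /andP [? ?]; lra.
apply: EvN_mono (EvN_and (EvN_shift oneM (h _ d2)) (EvN_near hr d2)) => n [].
by rewrite /dist ltr_norml => ? /andP [? ?]; lra.
Qed.

Lemma in01_ev f : isR f ->
  in01M f <-> forall d, 0 < d -> EvN (fun n => - d <= f n <= 1 + d).
Proof.
move=> hf; rewrite /in01M (Rle_ev (isR_const 0) hf) (Rle_ev hf (isR_const 1)).
split=> [[_ [h h']] d d0|h].
  by apply: EvN_mono (EvN_and (h _ d0) (h' _ d0)) => n [? ?]; apply/andP; split; lra.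
split=> //; split=> d /h; apply: EvN_mono => n /andP [? ?]; lra.
Qed.

Lemma Rpos_ev f : isR f ->
  Rlt (fun=> 0) f <-> exists2 d, 0 < d & EvN (fun n => d <= f n).
Proof.
move=> hf; rewrite (Rlt_ev (isR_const 0) hf).
by split=> -[d d0 h]; exists d => //; apply: EvN_mono h => n; rewrite add0r.
Qed.

(** Approximations of a real in [0,1] may lie outside the interval. Clipping them is 1-Lipschitz, so
    it keeps the rate of convergence and retracts all reals onto [0,1]; it also turns every code of
    a rational into a point of [0,1]. *)
Definition clip (a : K) : K := if a < 0 then 0 else if a <= 1 then a else 1.

Lemma clip01 a : 0 <= clip a <= 1.
Proof.
by rewrite /clip; case: (ltP a 0) => ?; [|case: (leP a 1) => ?];
  apply/andP; split; lra.
Qed.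

Lemma clip_lip a b : `|clip a - clip b| <= `|a - b|.
Proof.
have := ler_norm (a - b); have := lerNnormlW (lexx `|a - b|) => h1 h2.
have h3 := normr_ge0 (a - b).
by rewrite ler_norml /clip; case: (ltP a 0) => ?; case: (ltP b 0) => ?;
  case: (leP a 1) => ?; case: (leP b 1) => ?; apply/andP; split; lra.
Qed.

Lemma clip_close a d : - d <= a <= 1 + d -> 0 < d -> `|a - clip a| <= d.
Proof.
move=> /andP [h1 h2] d0.
by rewrite ler_norml /clip; case: (ltP a 0) => ?; case: (leP a 1) => ?; apply/andP; split; lra.
Qed.

(** Subtraction being truncated, [d - (d - (p - n))] is the minimum of the denominator [d] and
    [max(p - n, 0)]. *)
Definition qclip G (q : term G Nat) : term G Nat :=
  mkq (tsub (qden q) (tsub (qden q) (tsub (qpos q) (qneg q)))) (Cst CZero) (tsnd q).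
(** Denominators are stored minus one, and [2 * (c + 1) - 1 = c + c + 1]. *)
Definition qhalf G (q : term G Nat) : term G Nat :=
  mkq (qpos q) (qneg q) (tsnd q + tsnd q + 1)%tm.

Lemma val_qhalf G (q : term G Nat) (e : env M G) : val (eval (qhalf q) e) = val (eval q e) / 2.
Proof.
rewrite /qhalf val_mkq !evalE eval_one !iE /val; set c := sndM (eval q e).
have -> : i c + i c + 1 + 1 = (i c + 1) * 2 by ring.
by rewrite invfM mulrA.
Qed.

Lemma val_qclip G (q : term G Nat) (e : env M G) :
  val (eval (qclip q) e) = clip (val (eval q e)).
Proof.
rewrite /qclip val_mkq !evalE eval_zero i0 subr0 /val.
set p := fstM (fstM _); set n := sndM (fstM _); set c := sndM (eval q e); have c0 := den_gt0 c.
have ci : i (addM c oneM) = i c + 1 by rewrite !iE.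
have q0 : (0 <= (i p - i n) / (i c + 1)) = (i n <= i p).
  by rewrite pmulr_lge0 ?invr_gt0 // subr_ge0.
have q1 : ((i p - i n) / (i c + 1) <= 1) = (i p - i n <= i c + 1).
  by rewrite ler_pdivrMr // mul1r.
rewrite /clip ltNge q0 q1; case: (leP (i n) (i p)) => h /=; last first.
  have e0 : i (subM p n) = 0 by rewrite i_sub0 // ltW.
  have e1 : i (subM (addM c oneM) (subM p n)) = i c + 1 by rewrite i_sub e0 ?subr0 // ci ltW.
  by rewrite i_sub0 ?mul0r // e1 ci.
case: (leP (i p - i n) (i c + 1)) => h'.
  have e1 : i (subM (addM c oneM) (subM p n)) = i c + 1 - (i p - i n).
    by rewrite i_sub i_sub // ci.
  by rewrite i_sub e1 ci; [congr (_ / _); ring|lra].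
have e1 : i (subM (addM c oneM) (subM p n)) = 0 by rewrite i_sub0 // i_sub // ci ltW.
by rewrite i_sub e1 ?ci ?subr0 ?divff ?den_neq0 //; lra.
Qed.

(* Functionals are taken from opaque existence lemmas: as explicit terms they would be
   unfolded into combinators by unification. *)
Lemma clipF_sig : {f : dom M (1 ⇒ 1) | forall x, vx (app f x) = fun n => clip (vx x n)}.
Proof.
exists (eval (λ[x : 1] λ[n : 0] qclip (x↑ ⋅ n))%tm (@enil M)) => x.
by apply/funext => n; rewrite /vx !eval_lam_in val_qclip !evE.
Qed.
Definition clipF := projT1 clipF_sig.
Lemma vx_clipF x : vx (app clipF x) = fun n => clip (vx x n).
Proof. exact: (projT2 clipF_sig). Qed.

Lemma epsF_sig : {f : dom M (Nat ⇒ 1) | forall m, vx (app f m) = fun=> eps m}.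
Proof.
exists (eval (λ[m : 0] λ[n : 0] qeps m↑)%tm (@enil M)) => m.
by apply/funext => n; rewrite /vx !eval_lam_in val_eps !evE.
Qed.
Definition epsF := projT1 epsF_sig.
Lemma vx_epsF m : vx (app epsF m) = fun=> eps m.
Proof. exact: (projT2 epsF_sig). Qed.

Lemma isR_clip x : isR (vx x) -> isR (vx (app clipF x)).
Proof. by rewrite vx_clipF => hx; apply: isR_lip hx _ => n m; exact: clip_lip. Qed.

Lemma in01_clip x : isR (vx x) -> in01M (vx (app clipF x)).
Proof.
move=> /isR_clip hx; apply/(in01_ev hx) => d d0; apply: EvN_all => n.
by rewrite vx_clipF; have /andP [? ?] := clip01 (vx x n); apply/andP; split; lra.
Qed.

Lemma Req_clip x : in01M (vx x) -> Req (vx (app clipF x)) (vx x).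
Proof.
move=> h; have [hx _] := h; apply/(Req_ev (isR_clip hx) hx) => d d0.
move/(in01_ev hx): h => /(_ d d0); apply: EvN_mono => n hn.
by rewrite vx_clipF distrC; exact: clip_close.
Qed.

Lemma Req_clip2 x y : isR (vx x) -> isR (vx y) -> Req (vx x) (vx y) ->
  Req (vx (app clipF x)) (vx (app clipF y)).
Proof.
move=> hx hy h n; rewrite !vx_clipF; exact: le_trans (clip_lip _ _) (h n).
Qed.

Lemma halfF_sig (F : dom M (1 ⇒ 1)) :
  {f : dom M (1 ⇒ 1) | forall x, vx (app f x) = fun n => vx (app F x) n / 2}.
Proof.
exists (eval (λ[x : 1] λ[n : 0] qhalf (v2 ⋅ x↑ ⋅ n))%tm (econs F (@enil M))) => x.
by apply/funext => n; rewrite /vx !eval_lam_in val_qhalf !evE.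
Qed.
Definition halfF F := projT1 (halfF_sig F).
Lemma vx_halfF F x : vx (app (halfF F) x) = fun n => vx (app F x) n / 2.
Proof. exact: (projT2 (halfF_sig F)). Qed.

Lemma half_dist (a b : K) : `|a / 2 - b / 2| = `|a - b| / 2.
Proof. by rewrite -mulrBl normrM normfV (ger0_norm (_ : 0 <= 2)). Qed.

Lemma isR_half F x : isR (vx (app F x)) -> isR (vx (app (halfF F) x)).
Proof.
rewrite vx_halfF => h; apply: isR_lip h _ => n m; rewrite half_dist.
by have := normr_ge0 (vx (app F x) n - vx (app F x) m); lra.
Qed.

Lemma rfun_half F : rfun F -> rfun (halfF F).
Proof.
move=> [h1 h2]; split=> [x /h1|x y hx hy xy n]; first exact: isR_half.
rewrite !vx_halfF half_dist; have := h2 _ _ hx hy xy n.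
have := normr_ge0 (vx (app F x) n - vx (app F y) n); lra.
Qed.

Lemma pos_half F x : isR (vx (app F x)) -> Rlt (fun=> 0) (vx (app F x)) ->
  Rlt (fun=> 0) (vx (app (halfF F) x)).
Proof.
move=> hF /(Rpos_ev hF) [d d0 hd]; apply/(Rpos_ev (isR_half hF)).
exists (d / 2); first by lra.
by apply: EvN_mono hd => n; rewrite vx_halfF; lra.
Qed.

Lemma compF_sig (F F' : dom M (1 ⇒ 1)) :
  {f : dom M (1 ⇒ 1) | forall x, app f x = app F (app F' x)}.
Proof.
exists (eval (λ[x : 1] v1 ⋅ (v2 ⋅ x))%tm (econs F (econs F' (@enil M)))) => x.
by rewrite eval_lam_in !evE.
Qed.
Definition compF F F' := projT1 (compF_sig F F').
Lemma app_compF F F' x : app (compF F F') x = app F (app F' x).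
Proof. exact: (projT2 (compF_sig F F')). Qed.

(** * From finite subcovers to nets *)

Section Forward.
Variables (D : dom M 2) (P : dom M (1 ⇒ 1 ⇒ 0)) (X F : dom M (1 ⇒ 1)).
Hypotheses (hnet : net D P X) (hF : AS_cond D P X F).

(** [F] is known to be positive only on [0,1], while [HBU] asks for positivity everywhere; hence the
    clipping. Halving leaves room for the triangle inequality. *)
Definition PsiF := halfF (compF F clipF).

Lemma vx_PsiF x : vx (app PsiF x) = fun n => vx (app F (app clipF x)) n / 2.
Proof. by rewrite /PsiF vx_halfF app_compF. Qed.

Lemma posrfun_PsiF : posrfun PsiF.
Proof.
have [[F1 F2] Fpos] := hF.
have rf : rfun (compF F clipF).
  split=> [x hx|x y hx hy xy]; rewrite !app_compF.
    exact: F1 (isR_clip hx).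
  by apply: F2; [exact: isR_clip|exact: isR_clip|exact: Req_clip2].
split=> [|x hx]; first exact: rfun_half.
apply: pos_half; rewrite app_compF; first exact/F1/isR_clip.
by case: (Fpos _ (in01_clip hx)).
Qed.

Variables (k : N) (y : dom M (Nat ⇒ 1)).
Hypothesis y01 : forall j, i j < i k -> in01M (vx (app y j)).

(** Directedness joins one index at a time, and [k] may be nonstandard, so the join is made by
    induction in the model. The additional bound [i l < i k] makes the statement meaningful for all
    [j], as induction requires. *)
Lemma common_index j : exists d, memM D d /\ forall l, i l < i j -> i l < i k ->
  awayM D P X d (vx (app y l)) (vx (app F (app y l))).
Proof.
have [_ [_ [[[d0 Dd0] [tr [_ dir]]] _]]] := hnet.
move: j; apply: induction.
- pose G := Nat :: (Nat ⇒ 1)%ty :: 2%ty :: (1 ⇒ 1 ⇒ 0)%ty :: (1 ⇒ 1)%ty :: (1 ⇒ 1)%ty :: nil.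
  pose k' : term (Nat :: G) 0 := v1.
  pose y' : term (Nat :: G) (Nat ⇒ 1) := v2.
  pose D' : term (Nat :: G) 2 := v3.
  pose P' : term (Nat :: G) (1 ⇒ 1 ⇒ 0) := v4.
  pose X' : term (Nat :: G) (1 ⇒ 1) := v5.
  pose F' : term (Nat :: G) (1 ⇒ 1) := v6.
  exists G, (∃[d : 1] mem d D'↑ ∧ ∀[l : 0] l ≺ v2 ⊃ l ≺ k'↑↑ ⊃
      away D'↑↑ P'↑↑ X'↑↑ d↑ (y'↑↑ ⋅ l) (F'↑↑ ⋅ (y'↑↑ ⋅ l)))%fm,
    (econs k (econs y (econs D (econs P (econs X (econs F (@enil M))))))) => n.
  by apply: iff_sym; sat_unfold.
- by exists d0; split=> // l; rewrite i0 ltNge i_ge0.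
move=> j [d [Dd hd]].
case: (ltP (i j) (i k)) => jk; last first.
  by exists d; split=> // l _ lk; apply: hd => //; exact: lt_le_trans lk jk.
have [_ [d' [Dd' hd']]] := hF.2 _ (y01 jk).
have [c [Dc [dc d'c]]] := dir _ _ Dd Dd'.
exists c; split=> // l; rewrite !iE => lj lk e De ce.
case: (ltgtP (i l) (i j)) => [h|h|/i_inj ->].
- by apply: hd => //; exact: tr ce.
- by have := i_discr h; lra.
- by apply: hd' => //; exact: tr ce.
Qed.

Lemma common_radius j : exists m, forall l, i l < i j -> i l < i k ->
  Rlt (fun=> eps m) (vx (app F (app y l))).
Proof.
have [[F1 _] Fpos] := hF.
move: j; apply: induction.
- pose G := Nat :: (Nat ⇒ 1)%ty :: (1 ⇒ 1)%ty :: (Nat ⇒ 1)%ty :: nil.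
  pose y' : term (Nat :: G) (Nat ⇒ 1) := v2.
  pose F' : term (Nat :: G) (1 ⇒ 1) := v3.
  pose E' : term (Nat :: G) (Nat ⇒ 1) := v4.
  exists G, (∃[m : 0] ∀[l : 0] l ≺ v2 ⊃ l ≺ v3 ⊃
      rlt (E'↑↑ ⋅ m↑) (F'↑↑ ⋅ (y'↑↑ ⋅ l)))%fm,
    (econs k (econs y (econs F (econs epsF (@enil M))))) => n.
  by apply: iff_sym; sat_unfold; rewrite vx_epsF; exact: iff_refl.
- by exists zeroM => l; rewrite i0 ltNge i_ge0.
move=> j [m hm].
case: (ltP (i j) (i k)) => jk; last first.
  by exists m => l _ lk; apply: hm => //; exact: lt_le_trans lk jk.
have hFj := F1 _ (y01 jk).1.
have /(Rpos_ev hFj) [d d0 hd] := (Fpos _ (y01 jk)).1.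
have d2 : 0 < d / 2 by lra.
have [m' hm'] := archimedean d2.
exists (addM m m') => l; rewrite !iE => lj lk.
have h1 : eps (addM m m') <= eps m by apply: eps_anti; rewrite iD; have := i_ge0 m'; lra.
have h2 : eps (addM m m') <= eps m' by apply: eps_anti; rewrite iD; have := i_ge0 m; lra.
case: (ltgtP (i l) (i j)) => [h|h|/i_inj ->].
- have [n hn] := hm _ h lk; exists n; lra.
- by have := i_discr h; lra.
- apply/(Rlt_ev (isR_const _) hFj); exists (d / 2) => //.
  by apply: EvN_mono hd => n; lra.
Qed.
End Forward.

Lemma HBU_AS : (forall Psi, posrfun Psi -> finite_cover Psi) ->
  forall D P X, net D P X -> (exists F, AS_cond D P X F) -> boundedM D P X.
Proof.
move=> HBU_M D P X hnet [F hF].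
have [k [y [y01 cov]]] := HBU_M _ (posrfun_PsiF hF).
have [d [Dd hd]] := common_index hnet hF y01 k.
have [m hm] := common_radius hF y01 k.
have [[F1 F2] Fpos] := hF.
(* The radius is [eps m / 2]: from [|x - y| < F y / 2] and [|y - x_e| >= F y] it follows that
   [|x - x_e| >= F y / 2], where [F y > eps m]. *)
exists (app epsF (addM m oneM)), d; rewrite vx_epsF; split; first exact: isR_const.
split.
  (* At index [n], [Rlt] asks for [2 * eps n] below the value [eps m / 2]; with [n = m + 3] this is
     [eps m / 4]. *)
  exists (addM m (addM oneM (addM oneM oneM))); rewrite -!addMA !epsS add0r.
  by have := eps_gt0 m; lra.
split=> // e De de x hx.
have [j [jk cj]] := cov _ hx.
have [xR _] := hx; have [yR _] := y01 _ jk.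
have XR : isR (vx (app X e)) by apply: (proj2 (proj2 (proj2 hnet))).
have hFR := F1 _ yR; have hFcR := F1 _ (isR_clip yR).
have PsiR : isR (vx (app (PsiF F) (app y j))) by apply: isR_half; rewrite app_compF.
have /(covers_ev yR PsiR xR) [c c0 hc] := cj.
(* [PsiF] evaluates [F] at the clipped center, [common_index] at the center itself. These are equal
   reals but different functions, so the values of [F] agree only up to any margin. *)
have /(Req_ev hFcR hFR) hreq := F2 _ _ (isR_clip yR) yR (Req_clip (y01 _ jk)).
have /(Rle_dist hFR yR XR) haway := hd _ jk jk _ De de.
have /(Rlt_ev (isR_const _) hFR) [b b0 hb] := hm _ jk jk.
apply/(Rle_dist (isR_const _) xR XR) => r r0.
have r2 : 0 < r / 2 by lra.
apply: EvN_mono (EvN_and (EvN_and hc (hreq _ r2)) (EvN_and (haway _ r2) hb)) => n.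
rewrite vx_PsiF epsS => -[[h1 h2] [h3 h4]].
move: h2; rewrite ler_norml => /andP [h2 h2'].
have := ler_distD (vx x n) (vx (app y j) n) (vx (app X e) n).
by rewrite (distrC (vx (app y j) n) (vx x n)) => h5; lra.
Qed.

(** * Arithmetical comprehension from a decision functional *)

Definition truth (P : Prop) (b : N) := (P /\ b = oneM) \/ (~ P /\ b = zeroM).

Lemma sub11 : subM oneM oneM = zeroM.
Proof. by apply: i_inj; rewrite i_sub0 !iE. Qed.

Lemma truth_iff (P Q : Prop) b : (P <-> Q) -> truth P b -> truth Q b.
Proof. by move=> h [[/h ? ->]|[hP ->]]; [left|right; split=> // /h]. Qed.

Lemma truth_not P b : truth P b -> truth (~ P) (subM oneM b).
Proof.
case=> -[h ->]; [right|left]; split=> //; first by rewrite sub11.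
by rewrite subM_0.
Qed.

Lemma truth_and P Q a b : truth P a -> truth Q b -> truth (P /\ Q) (mulM a b).
Proof.
case=> -[h ->] [] [h' ->].
- by left; rewrite mulM1.
- by right; rewrite mulM0; split=> // -[].
- by right; rewrite mulM1; split=> // -[].
- by right; rewrite mulM0; split=> // -[].
Qed.

Lemma truth_P P b : truth P b -> (b = oneM <-> P).
Proof.
case=> -[h ->]; split=> // e; exfalso.
by apply: (@ltM_irr zeroM); rewrite {2}e; exact: ltM_01.
Qed.

Lemma truth_le1 P b : truth P b -> i b <= 1.
Proof. by case=> -[_ ->]; rewrite !iE ?ler01. Qed.

(** Kleene's quantifier functional of type 2, normalized to search for the value 1. *)
Definition is_exists2 (E : dom M 2) :=
  forall f, truth (exists n, app f n = oneM) (app E f).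

Definition chi_ex G (E : term G 2) s : term (s :: G) 0 -> term G 0 :=
  match s return term (s :: G) 0 -> term G 0 with
  | Nat => fun b => (E ⋅ lam_in (fun _ => b))%tm
  | _ => fun _ => Cst CZero
  end.

(* Correct for arithmetical formulas, provided [E] decides [exists n, f n = 1];
   quantifiers of higher type get the junk value 0. *)
Fixpoint chi G (A : form G) : term G 2 -> term G 0 :=
  match A with
  | Bot _ => fun _ => Cst CZero
  | EqN _ u v => fun _ => tsub (Cst COne) (tsub u v + tsub v u)%tm
  | LtN _ u v => fun _ => tsub (Cst COne) (tsub (u + 1) v)%tm
  | Imp _ B C => fun E => tsub (Cst COne) (chi B E * tsub (Cst COne) (chi C E))%tm
  | And _ B C => fun E => (chi B E * chi C E)%tm
  | Or _ B C => fun E =>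
      tsub (Cst COne) (tsub (Cst COne) (chi B E) * tsub (Cst COne) (chi C E))%tm
  | All _ s B => fun E => tsub (Cst COne) (chi_ex E (tsub (Cst COne) (chi B (wk s E))))
  | Ex _ s B => fun E => chi_ex E (chi B (wk s E))
  end.

Fixpoint arith G (A : form G) : Prop :=
  match A with
  | Bot _ | EqN _ _ _ | LtN _ _ _ => True
  | Imp _ B C | And _ B C | Or _ B C => arith B /\ arith C
  | All _ s B | Ex _ s B => s = Nat /\ arith B
  end.

Lemma qf_arith G (A : form G) : qf A -> arith A.
Proof. by elim: A => {G} //= G A IHA B IHB [/IHA ? /IHB ?]. Qed.

Lemma truth_ex G (E : term G 2) (b : term (Nat :: G) Nat) (e : env M G) (P : N -> Prop) :
  is_exists2 (eval E e) -> (forall n, truth (P n) (eval b (econs n e))) ->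
  truth (exists n, P n) (eval (chi_ex E b) e).
Proof.
move=> hE hb; rewrite /chi_ex eval_app.
apply: truth_iff (hE _); split=> -[n hn]; exists n; move: hn; rewrite eval_lam_in => hn.
  exact/(truth_P (hb n)).
exact/(truth_P (hb n)).
Qed.

(** The disjunction serves both regimes: quantifier-free formulas are decided with any functional in
    the place of [E], arithmetical ones once the quantifier functional is at hand. *)
Lemma chi_spec G (A : form G) (E : term G 2) (e : env M G) :
  arith A -> qf A \/ is_exists2 (eval E e) -> truth (sat A e) (eval (chi A E) e).
Proof.
elim: A E e => {G} [G|G u v|G u v|G A IHA B IHB|G A IHA B IHB|G A IHA B IHB
    |G s B IHB|G s B IHB] E e.
- by move=> _ _; right; split.
- move=> _ _ /=; rewrite eval_sub eval_add !eval_sub eval_one.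
  set a := eval u e; set b := eval v e.
  case: (ltM_total a b) => [/i_lt h|->|/i_lt h].
  + right; split; first by move=> ab; move: h; rewrite ab ltxx.
    apply: i_inj; rewrite i_sub0 ?i0 // !iE i_sub0 ?i_sub ?(ltW h) //.
    by have := i_discr h; lra.
  + left; split=> //; have -> : subM b b = zeroM by apply: i_inj; rewrite i_sub0 ?i0.
    by rewrite addM0 subM_0.
  + right; split; first by move=> ab; move: h; rewrite ab ltxx.
    apply: i_inj; rewrite i_sub0 ?i0 // !iE i_sub ?i_sub0 ?(ltW h) //.
    by have := i_discr h; lra.
- move=> _ _ /=; rewrite !eval_sub eval_add !eval_one.
  set a := eval u e; set b := eval v e.
  case: (ltP (i a) (i b)) => [h|h].
    left; split; first exact/i_lt.
    have -> : subM (addM a oneM) b = zeroM.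
      by apply: i_inj; rewrite i_sub0 ?i0 // !iE; exact: i_discr.
    exact: subM_0.
  right; split; first by move=> /i_lt; rewrite ltNge h.
  by apply: i_inj; rewrite i_sub0 ?i0 // i_sub !iE; lra.
- move=> /= [a1 a2] h; have h1 : qf A \/ is_exists2 (eval E e) by case: h => [[]|]; [left|right].
  have h2 : qf B \/ is_exists2 (eval E e) by case: h => [[]|]; [left|right].
  rewrite eval_sub eval_mul eval_sub !eval_one.
  apply: truth_iff (truth_not (truth_and (IHA _ _ a1 h1) (truth_not (IHB _ _ a2 h2)))).
  split=> [H hA|H [hA]]; first by apply/not_notP => hB; apply: H.
  by apply; exact: H.
- move=> /= [a1 a2] h; have h1 : qf A \/ is_exists2 (eval E e) by case: h => [[]|]; [left|right].
  have h2 : qf B \/ is_exists2 (eval E e) by case: h => [[]|]; [left|right].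
  exact: truth_and (IHA _ _ a1 h1) (IHB _ _ a2 h2).
- move=> /= [a1 a2] h; have h1 : qf A \/ is_exists2 (eval E e) by case: h => [[]|]; [left|right].
  have h2 : qf B \/ is_exists2 (eval E e) by case: h => [[]|]; [left|right].
  rewrite eval_sub eval_mul !eval_sub !eval_one.
  apply: truth_iff (truth_not (truth_and (truth_not (IHA _ _ a1 h1)) (truth_not (IHB _ _ a2 h2)))).
  split=> [H|[hA|hB] []//].
  by case: (pselect (sat A e)) => hA; [left|right; apply/not_notP => hB; apply: H].
- move=> /= [es aB] [//|hE]; subst s; rewrite eval_sub eval_one.
  have hB n : truth (~ sat B (econs n e)) (eval (tsub (Cst COne) (chi B (wk Nat E))) (econs n e)).
    by rewrite eval_sub eval_one; apply/truth_not/IHB => //; right; rewrite eval_wk.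
  apply: truth_iff (truth_not (truth_ex hE hB)).
  by split=> [H n|H [n]]; [apply/not_notP => hn; apply: H; exists n|apply].
- move=> /= [es aB] [//|hE]; subst s.
  have hB n : truth (sat B (econs n e)) (eval (chi B (wk Nat E)) (econs n e)).
    by apply: IHB => //; right; rewrite eval_wk.
  exact: truth_ex hE hB.
Qed.

Opaque chi_ex.

Lemma set_comprehension G s (A : form (s :: G)) (E : term G 2) (e : env M G) :
  arith A -> qf A \/ is_exists2 (eval E e) ->
  {D : dom M (s ⇒ Nat) | forall x, truth (sat A (econs x e)) (app D x)}.
Proof.
move=> aA hE; exists (eval (lam (chi A (wk s E))) e) => x; rewrite eval_lam.
by apply: chi_spec => //; rewrite eval_wk.
Qed.

Lemma rel_comprehension G s t (A : form (t :: s :: G)) (E : term G 2) (e : env M G) :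
  arith A -> qf A \/ is_exists2 (eval E e) ->
  {D : dom M (s ⇒ t ⇒ Nat) |
    forall x y, truth (sat A (econs y (econs x e))) (app (app D x) y)}.
Proof.
move=> aA hE; exists (eval (lam (lam (chi A (wk t (wk s E))))) e) => x y; rewrite !eval_lam.
by apply: chi_spec => //; rewrite !eval_wk.
Qed.

(** * From nets to finite subcovers *)

Lemma constF_sig : {f : dom M (Nat ⇒ 1) | forall q, vx (app f q) = fun=> clip (val q)}.
Proof.
exists (eval (λ[q : 0] λ[n : 0] qclip q↑)%tm (@enil M)) => m.
by apply/funext => n; rewrite /vx !eval_lam_in val_qclip !evE.
Qed.
Definition constF := projT1 constF_sig.
Lemma vx_constF m : vx (app constF m) = fun=> clip (val m).
Proof. exact: (projT2 constF_sig). Qed.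

Lemma in01_constF q : in01M (vx (app constF q)).
Proof.
rewrite vx_constF; apply/in01_ev; first exact: isR_const.
by move=> d d0; apply: EvN_all => _; have /andP [? ?] := clip01 (val q); apply/andP; split; lra.
Qed.

Lemma Rle_not_covers a p x : isR a -> isR p -> isR x ->
  ~ covers a p x -> forall d, 0 < d -> EvN (fun n => p n <= `|x n - a n| + d).
Proof.
move=> ha hp hx nc; apply/(Rle_dist hp hx ha) => h; apply: nc.
have [d d0 hd] := (Rlt_ev (isR_dist hx ha) hp).1 h.
apply/(covers_ev ha hp hx); have d2 : 0 < d / 2 by lra.
exists (d / 2) => //; apply: EvN_unshift.
apply: EvN_mono (EvN_and hd (EvN_near hp d2)) => n.
by rewrite /dist ltr_norml => -[? /andP [? ?]]; lra.
Qed.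

(** An index lies above itself, and its own value is a point of [0,1] at distance zero. *)
Lemma not_boundedM D P X : (forall d, memM D d -> precM P d d) ->
  (forall d, memM D d -> in01M (vx (app X d))) -> ~ boundedM D P X.
Proof.
move=> rP X01 [delta [d [hR [hpos [Dd h]]]]].
have [XR _] := X01 _ Dd.
move: (h _ Dd (rP _ Dd) _ (X01 _ Dd)) => /(Rle_dist hR XR XR) h1.
have /(Rpos_ev hR) [c c0 hc] := hpos.
have c2 : 0 < c / 2 by lra.
have [n [h2 h3]] := EvN_ex (EvN_and hc (h1 _ c2)).
by move: h3; rewrite subrr normr0; lra.
Qed.

Section Backward.
Hypothesis AS_M : forall D P X, net D P X -> (exists F, AS_cond D P X F) -> boundedM D P X.
Variable Psi : dom M (1 ⇒ 1).
Hypothesis hPsi : posrfun Psi.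
Hypothesis no_cover : ~ finite_cover Psi.

Lemma uncovered k (y : dom M (Nat ⇒ 1)) : (forall j, i j < i k -> in01M (vx (app y j))) ->
  exists x, in01M (vx x) /\ forall j, i j < i k ->
    ~ covers (vx (app y j)) (vx (app Psi (app y j))) (vx x).
Proof.
move=> y01; apply/not_notP => h; apply: no_cover; exists k, y; split=> // x hx.
by apply/not_notP => h'; apply: h; exists x; split=> // j jk c; apply: h'; exists j.
Qed.

(** The real [|x - q| + p / 2], its index shifted by one as in [radd] to restore the rate. *)
Definition ball_slack (x : N -> K) (p : N -> K) (q : N) : N -> K :=
  fun n => `|x (addM n oneM) - clip (val q)| + p (addM n oneM) / 2.

Lemma isR_ball_slack x p q : isR x -> isR p -> isR (ball_slack x p q).
Proof.
move=> hx hp.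
apply: (@isR_add (fun n => `|x n - clip (val q)|) (fun n => p n / 2)).
  apply: isR_lip hx _ => n m; apply: le_trans (ler_dist_dist _ _) _.
  by rewrite opprB addrA subrK.
apply: isR_lip hp _ => n m; rewrite half_dist.
by have := normr_ge0 (p n - p m); lra.
Qed.

(** * First case: rational balls with slack *)

Section RationalBalls.
Hypothesis rational_balls : forall x, in01M (vx x) -> exists q,
  Rlt (ball_slack (vx x) (vx (app Psi x)) q) (vx (app Psi (app constF q))).

(* An index is [f] with [n = f 0] and [p = f 1]; [p] codes a rational outside the
   stage-[n] lower approximations of the balls around the first [n + 1] rationals. *)
Definition far (f : dom M 1) (j : N) : Prop :=
  vx (app Psi (app constF j)) (app f zeroM)
    <= `|clip (val (app f oneM)) - clip (val j)| + 2 * eps (app f zeroM).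

Lemma far_sig : {c : dom M (1 ⇒ Nat ⇒ Nat) | forall f j, truth (far f j) (app (app c f) j)}.
Proof.
pose G := (1 ⇒ 1)%ty :: (Nat ⇒ 1)%ty :: nil.
pose A : form (Nat :: 1%ty :: G) := qle (v2 ⋅ (v3 ⋅ v0) ⋅ (v1 ⋅ 0))%tm
   (qadd (qabs (qsub (v3 ⋅ (v1 ⋅ 1) ⋅ 0) (v3 ⋅ v0 ⋅ 0)))
     (qeps2 (v1 ⋅ 0)))%tm.
have qA : qf A by split.
have [c hc] := @rel_comprehension G 1%ty Nat A (default_term _ _)
  (econs Psi (econs constF (@enil M))) (qf_arith qA) (or_introl qA).
exists c => f j; apply: truth_iff (hc f j); rewrite /A sat_qle val_qadd val_qabs val_qsub val_eps2.
rewrite !eval_app !eval_VS !eval_VZ !eval_zero !eval_one.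
rewrite /far /vx.
have hC q n : val (app (app constF q) n) = clip (val q).
  by have := congr1 (fun g => g n) (vx_constF q).
by rewrite !hC; exact: iff_refl.
Qed.

(* Without a decision functional, only bounded quantifiers can be evaluated. *)
Lemma forall_below_sig : {B : dom M (1 ⇒ Nat ⇒ Nat) | forall c m,
  (forall j, truth (app c j = oneM) (app c j)) ->
  truth (forall j, i j < i m -> app c j = oneM) (app (app B c) m)}.
Proof.
exists (eval (λ[c : 1] λ[m : 0]
  (Cst CRec ⋅ (λ[j : 0] λ[r : 0] r * (c↑↑↑ ⋅ j↑)) ⋅ 1 ⋅ m))%tm (@enil M)).
move=> c m hc; set b := app _ c.
have b0 : app b zeroM = oneM by rewrite /b !eval_lam_in eval_rec recM_0.
have bS n : app b (addM n oneM) = mulM (app b n) (app c n).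
  by rewrite /b !eval_lam_in !eval_rec recM_S !eval_lam_in !eval_mul !eval_app !eval_wk !eval_VZ.
apply: (@truth_iff (forall j, ltM j m -> app c j = oneM)).
  by split=> h j /i_lt; exact: h.
move: b b0 bS => b b0 bS; move: m; apply: induction.
- pose T : form (Nat :: 1%ty :: 1%ty :: nil) := (∀[j : 0] j ≺ v1 ⊃ v3 ⋅ j ≐ 1)%fm.
  by exists (1%ty :: 1%ty :: nil), ((T ∧ (v1 ⋅ v0 ≐ 1)) ∨ (Not T ∧ (v1 ⋅ v0 ≐ 0)))%fm,
    (econs b (econs c (@enil M))).
- by left; rewrite b0; split=> // j /i_lt; rewrite i0 ltNge i_ge0.
move=> m IH; rewrite bS; apply: truth_iff (truth_and IH (hc m)).
split=> [[h e] j /i_lt|h].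
  rewrite !iE => jm; case: (ltgtP (i j) (i m)) => [/i_lt/h //|/i_discr hm|/i_inj -> //].
  by move: (lt_le_trans jm hm); rewrite ltxx.
split=> [j jm|]; first by apply: h; apply: ltM_trans jm (ltM_succ _).
by apply: h; exact: ltM_succ.
Qed.

Lemma index_set_sig : {D : dom M 2 | forall f,
  truth (forall j, i j <= i (app f zeroM) -> far f j) (app D f)}.
Proof.
have [c hc] := far_sig; have [B hB] := forall_below_sig.
pose t : term (1%ty :: (1 ⇒ Nat ⇒ Nat)%ty :: (1 ⇒ Nat ⇒ Nat)%ty :: nil) Nat :=
  (v2 ⋅ (v1 ⋅ v0) ⋅ (v0 ⋅ 0 + 1))%tm.
exists (eval (lam t) (econs c (econs B (@enil M)))) => f.
rewrite eval_lam /t eval_app eval_add !eval_app !eval_VS !eval_VZ eval_zero eval_one.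
apply: truth_iff (hB _ _ _) => [|j]; last first.
  by apply: truth_iff (hc f j); split=> h; apply/(truth_P (hc f j)).
split=> h j hj; first by apply/(truth_P (hc f j))/h; rewrite !iE; lra.
apply/(truth_P (hc f j))/h; move: hj; rewrite !iE => hj.
by rewrite leNgt; apply/negP => /i_discr; lra.
Qed.

Lemma index_rel_sig : {P : dom M (1 ⇒ 1 ⇒ 0) | forall f g,
  truth (i (app f zeroM) <= i (app g zeroM)) (app (app P f) g)}.
Proof.
pose A : form (1%ty :: 1%ty :: nil) := tle (v1 ⋅ 0)%tm (v0 ⋅ 0)%tm.
have qA : qf A by split.
have [c hc] := @rel_comprehension nil 1%ty 1%ty A (default_term _ _) (@enil M)
  (qf_arith qA) (or_introl qA).
exists c => f g; apply: truth_iff (hc f g).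
by rewrite /A sat_tle !eval_app !eval_VS !eval_VZ eval_zero; exact: iff_refl.
Qed.

Lemma index_net_sig : {X : dom M (1 ⇒ 1) | forall f, app X f = app constF (app f oneM)}.
Proof.
exists (eval (lam (v1 ⋅ (v0 ⋅ 1))%tm) (econs constF (@enil M))) => f.
by rewrite eval_lam !eval_app !eval_VS !eval_VZ eval_one.
Qed.

Lemma index_mk n p : exists f : dom M 1, app f zeroM = n /\ app f oneM = p.
Proof.
exists (eval (λ[m : 0] (v1 * tsub 1 m + v2 * tsub 1 (tsub 1 m)))%tm (env2 n p)).
rewrite !eval_lam_in !eval_add !eval_mul !eval_sub !eval_VS !eval_VZ eval_one.
rewrite !(sub11, subM_0) !mulM0 !mulM1 addM0; split=> //.
by rewrite addMC addM0.
Qed.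

(** The point left uncovered by the balls is replaced by its approximation of index [n + 1]. The
    errors, in units of [eps n], are 1 for reading [Psi] at [n], 1/2 for the approximation and 1/8
    each for the uncovering and for clipping; the total stays below the 2 allowed in [far]. *)
Lemma far_point n : exists p, forall f, app f zeroM = n -> app f oneM = p ->
  forall j, i j <= i n -> far f j.
Proof.
have [F1 _] := hPsi.1.
have [x [hx nc]] := @uncovered (addM n oneM) constF (fun j _ => in01_constF j).
have [xR _] := hx.
exists (app x (addM n oneM)) => f fn fp j jn; rewrite /far fn fp -/(vx x (addM n oneM)).
have CR := (in01_constF j).1.
have e0 := eps_gt0 n; have e8 : 0 < eps n / 8 by lra.
have hj : i j < i (addM n oneM) by rewrite !iE; lra.
have h1 := Rle_not_covers CR (F1 _ CR) xR (nc _ hj) e8.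
move/(in01_ev xR): hx => /(_ _ e8) h2.
have [m [[h3 h4] h5]] := EvN_ex (EvN_and (EvN_and h1 h2) (EvN_ge (addM n oneM))).
have nm : i n <= i m by move: h5; rewrite !iE; lra.
have := isR_le (F1 _ CR) nm; have := isR_le xR h5; rewrite epsS.
have := clip_lip (vx x (addM n oneM)) (vx x m); have := clip_close h4 e8.
move: h3; rewrite vx_constF => h3 h6 h7 h8 h9.
have := ler_distD (clip (vx x m)) (vx x m) (clip (val j)).
have := ler_distD (clip (vx x (addM n oneM))) (clip (vx x m)) (clip (val j)).
rewrite (distrC (clip (vx x m)) (clip (vx x (addM n oneM)))).
have := ler_norm (vx (app Psi (app constF j)) n - vx (app Psi (app constF j)) m).
by lra.
Qed.

Lemma rational_balls_absurd : False.
Proof.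
have [F1 F2] := hPsi.1.
have [D hD] := index_set_sig; have [P hP] := index_rel_sig; have [X hX] := index_net_sig.
have memD f : memM D f <-> forall j, i j <= i (app f zeroM) -> far f j := truth_P (hD f).
have precP f g : precM P f g <-> i (app f zeroM) <= i (app g zeroM) := truth_P (hP f g).
have mk n : exists f, memM D f /\ app f zeroM = n.
  have [p hp] := far_point n; have [f [fn fp]] := index_mk n p.
  by exists f; split=> //; apply/memD; rewrite fn; exact: hp.
have nt : net D P X.
  split; first by move=> f; exact: truth_le1 (hD f).
  split; first by move=> f g; exact: truth_le1 (hP f g).
  split; last by move=> f _; rewrite hX; exact: (in01_constF _).1.
  split; first by have [f [hf _]] := mk zeroM; exists f.
  split; first by move=> f g h _ _ _ /precP h1 /precP h2; apply/precP; exact: le_trans h1 h2.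
  split; first by move=> f _; apply/precP.
  move=> f g _ _; have [h [Dh hn]] := mk (addM (app f zeroM) (app g zeroM)).
  exists h; split=> //; rewrite !precP hn !iE.
  by have := i_ge0 (app f zeroM); have := i_ge0 (app g zeroM); split; lra.
apply: (@not_boundedM D P X).
- by move=> f _; apply/precP.
- by move=> f _; rewrite hX; exact: in01_constF.
apply: AS_M nt _; exists (halfF Psi); split; first exact: rfun_half hPsi.1.
move=> x hx; have [xR _] := hx; split; first exact: pos_half (F1 _ xR) (hPsi.2 _ xR).
have [q hq] := rational_balls hx.
have CR := (in01_constF q).1.
have /(Rlt_ev (isR_ball_slack q xR (F1 _ xR)) (F1 _ CR)) [d d0 hd] := hq.
(* Three errors [eps m] are charged to the slack [d]: two come from [far], one from comparing [Psi]
   at [q] at the indices [m] and [k]. *)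
have d4 : 0 < d / 4 by lra.
have [n hn] := archimedean d4.
(* A stage of at least [q] ensures that the ball around the rational coded by [q] is among those
   tested; a stage of at least [n] makes the test precise enough. *)
have [f [Df fn]] := mk (addM n q).
exists f; split=> // e De /precP; rewrite fn hX => fe.
have XR := (in01_constF (app e oneM)).1.
apply/(Rle_dist (isR_half (F1 _ xR)) xR XR) => r r0.
set m := app e zeroM in fe *.
have nm : i n <= i m by move: fe; rewrite !iE; have := i_ge0 q; lra.
have qm : i q <= i m by move: fe; rewrite !iE; have := i_ge0 n; lra.
have := (memD e).1 De q qm; rewrite /far -/m => hfar.
have em := eps_anti nm.
apply: EvN_unshift; apply: EvN_mono (EvN_and hd (EvN_ge m)) => k [].
rewrite /ball_slack vx_halfF vx_constF => h5 mk'.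
have := isR_le (F1 _ CR) mk'.
have := ler_norm (vx (app Psi (app constF q)) k - vx (app Psi (app constF q)) m).
rewrite distrC.
have := ler_distD (vx x (addM k oneM)) (clip (val (app e oneM))) (clip (val q)).
rewrite (distrC (clip (val (app e oneM))) (vx x (addM k oneM))).
by lra.
Qed.
End RationalBalls.

(** * Second case: a jump along the rationals yields a decision functional *)

Section JumpBall.
Variable x0 : dom M 1.
Hypothesis x0_01 : in01M (vx x0).
Hypothesis jump : forall q,
  Rle (vx (app Psi (app constF q))) (ball_slack (vx x0) (vx (app Psi x0)) q).

(* [app (app stopF f) n] is the least [r < n] with [f r = 1] if there is one, and [n] otherwise. *)
Lemma stopF_sig : {T : dom M (1 ⇒ 1) | forall f, app (app T f) zeroM = zeroM /\
  forall n, (app f (app (app T f) n) = oneM -> app (app T f) (addM n oneM) = app (app T f) n) /\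
    (app f (app (app T f) n) <> oneM -> app (app T f) (addM n oneM) = addM n oneM)}.
Proof.
pose A : form (Nat :: 1%ty :: nil) := (v1 ⋅ v0 ≐ 1)%fm.
have qA : qf A by [].
have [c hc] := @rel_comprehension nil 1%ty Nat A (default_term _ _) (@enil M)
  (qf_arith qA) (or_introl qA).
have [F hF] : {F : term (1%ty :: (1 ⇒ Nat ⇒ Nat)%ty :: nil) (Nat ⇒ Nat ⇒ Nat) |
    forall f k r, app (app (eval F (econs f (econs c (@enil M)))) k) r
      = addM (mulM (app (app c f) r) r) (mulM (subM oneM (app (app c f) r)) (addM k oneM))}.
  exists (λ[k : 0] λ[r : 0] v3 ⋅ v2 ⋅ r * r + tsub 1 (v3 ⋅ v2 ⋅ r) * (k↑ + 1))%tm => f k r.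
  rewrite !eval_lam_in eval_add !eval_mul eval_sub eval_add.
  by rewrite !eval_app !eval_wk !eval_VS !eval_VZ eval_one.
exists (eval (lam (Cst CRec ⋅ F ⋅ 0)%tm) (econs c (@enil M))) => f.
set T := app _ f.
have TE n : app T n = recM (eval F (econs f (econs c (@enil M)))) zeroM n.
  by rewrite /T eval_lam.
split=> [|n]; first by rewrite TE recM_0.
have : app T (addM n oneM) = addM (mulM (app (app c f) (app T n)) (app T n))
    (mulM (subM oneM (app (app c f) (app T n))) (addM n oneM)).
  by rewrite !TE recM_S hF.
move=> ->; case: (hc f (app T n)) => -[h ->]; split=> h' //.
  by rewrite sub11 mulMC mulM1 mulMC mulM0 addM0.
by rewrite subM_0 mulMC mulM0 mulMC mulM1 addMC addM0.
Qed.
Definition stopF := projT1 stopF_sig.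
Notation stop f n := (app (app stopF f) n).

Lemma stop_spec f n : (stop f n = n /\ forall j, ltM j n -> app f j <> oneM) \/
  (ltM (stop f n) n /\ app f (stop f n) = oneM).
Proof.
have [T0 TS] := projT2 stopF_sig f; rewrite -/stopF in T0 TS.
move: n; apply: induction.
- pose G := 1%ty :: (1 ⇒ 1)%ty :: nil.
  pose f' : term (Nat :: G) 1 := v1.
  pose T' : term (Nat :: G) (1 ⇒ 1) := v2.
  by exists G, (((T' ⋅ f' ⋅ v0 ≐ v0) ∧ (∀[j : 0] j ≺ v1 ⊃ Not (f'↑ ⋅ j ≐ 1)))
    ∨ ((T' ⋅ f' ⋅ v0 ≺ v0) ∧ (f' ⋅ (T' ⋅ f' ⋅ v0) ≐ 1)))%fm,
    (econs f (econs stopF (@enil M))).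
- by left; rewrite T0; split=> // j /i_lt; rewrite i0 ltNge i_ge0.
move=> n; have [TS1 TS2] := TS n.
case: (pselect (app f (stop f n) = oneM)) => hf.
  rewrite (TS1 hf) => h; right; split=> //; case: h => [[-> _]|[h _]]; first exact: ltM_succ.
  exact: ltM_trans h (ltM_succ _).
rewrite (TS2 hf) => -[[e h]|[]//]; left; split=> // j /i_lt; rewrite !iE => jn.
case: (ltgtP (i j) (i n)) => [/i_lt/h //|/i_discr hm|/i_inj ->]; last by rewrite -{1}e.
by move: (lt_le_trans jn hm); rewrite ltxx.
Qed.

Lemma stop_const f n d : app f (stop f n) = oneM -> stop f (addM n d) = stop f n.
Proof.
move=> h; have [T0 TS] := projT2 stopF_sig f; rewrite -/stopF in T0 TS.
move: d; apply: induction.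
- by exists (Nat :: 1%ty :: (1 ⇒ 1)%ty :: nil), (v3 ⋅ v2 ⋅ (v1 + v0) ≐ v3 ⋅ v2 ⋅ v1)%fm,
    (econs n (econs f (econs stopF (@enil M)))).
- by rewrite addM0.
- by move=> d e; rewrite -addMA (TS _).1 e.
Qed.

Lemma freezeF_sig m : {Z : dom M (1 ⇒ 1) |
  forall f, vx (app Z f) = fun n => clip (vx x0 (addM m (stop f n)))}.
Proof.
exists (eval (λ[f : 1] λ[n : 0] qclip (v2 ⋅ (v4 + v3 ⋅ f↑ ⋅ n)))%tm
  (econs x0 (econs stopF (env1 m)))) => f.
apply/funext => n; rewrite {1}/vx !eval_lam_in val_qclip eval_app eval_add !eval_app.
by rewrite !eval_wk !eval_VS !eval_VZ.
Qed.
Definition freezeF m := projT1 (freezeF_sig m).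
Lemma vx_freezeF m f : vx (app (freezeF m) f) = fun n => clip (vx x0 (addM m (stop f n))).
Proof. exact: (projT2 (freezeF_sig m)). Qed.

(** After the stop the sequence is constant. If nothing is found below [n], both values are
    approximations of [x0] of index at least [n], because a later stop cannot lie below [n]. *)
Lemma isR_freeze m f : isR (vx (app (freezeF m) f)).
Proof.
have [x0R _] := x0_01; move=> n k; rewrite vx_freezeF.
apply: le_lt_trans (clip_lip _ _) _.
have near t : i n <= i t -> `|vx x0 (addM m n) - vx x0 (addM m t)| < eps n.
  move=> nt; apply: lt_le_trans (isR_le x0R _) _; first by rewrite !iE lerD2l.
  by apply: eps_anti; rewrite !iE; have := i_ge0 m; lra.
case: (stop_spec f n) => [[-> hn]|[_ h]]; last first.
  by rewrite stop_const // subrr normr0 eps_gt0.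
case: (stop_spec f (addM n k)) => [[-> _]|[_ h]].
  by apply: near; rewrite iD; have := i_ge0 k; lra.
by apply: near; rewrite leNgt; apply/negP => /i_lt /hn.
Qed.

Lemma freeze_none m f : ~ (exists n, app f n = oneM) ->
  Req (vx (app (freezeF m) f)) (vx x0).
Proof.
have [x0R _] := x0_01; move=> nf; apply/(Req_ev (isR_freeze m f) x0R) => d d0.
have d2 : 0 < d / 2 by lra.
move/(in01_ev x0R): x0_01 => /(_ _ d2) h.
apply: EvN_mono (EvN_and h (EvN_eps d2)) => n [h1 h2]; rewrite vx_freezeF.
have -> : stop f n = n by case: (stop_spec f n) => -[] // _ e; case: nf; exists (stop f n).
have nm : i n <= i (addM m n) by rewrite iD; have := i_ge0 m; lra.
have h3 := isR_le x0R nm; have h4 := clip_lip (vx x0 (addM m n)) (vx x0 n).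
have h5 := clip_close h1 d2.
rewrite distrC in h3; rewrite distrC in h4; rewrite distrC.
have := ler_distD (clip (vx x0 n)) (vx x0 n) (clip (vx x0 (addM m n))); lra.
Qed.

Lemma freeze_some m f : (exists n, app f n = oneM) -> exists q,
  Req (vx (app (freezeF m) f)) (vx (app constF q)) /\
  forall d, 0 < d -> EvN (fun n => `|vx x0 n - clip (val q)| <= eps m + d).
Proof.
have [x0R _] := x0_01; move=> [l fl].
set r := stop f (addM l oneM).
have rE d : stop f (addM (addM l oneM) d) = r.
  have fr : app f r = oneM.
    by case: (stop_spec f (addM l oneM)) => -[] // _ /(_ l (ltM_succ l)).
  exact: stop_const.
exists (app x0 (addM m r)); rewrite -/(vx x0 (addM m r)); split.
  apply/(Req_ev (isR_freeze m f) (in01_constF _).1) => d d0.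
  exists (addM l oneM) => n /i_leD [k ->].
  by rewrite vx_freezeF vx_constF rE -/(vx x0 _) subrr normr0 ltW.
move=> d d0; move/(in01_ev x0R): x0_01 => /(_ _ d0) h.
apply: EvN_mono (EvN_and h (EvN_ge (addM m r))) => n [h1 h2].
have h3 := isR_le x0R h2; have h4 := clip_lip (vx x0 (addM m r)) (vx x0 n).
have h5 := clip_close h1 d0.
have h6 : eps (addM m r) <= eps m by apply: eps_anti; rewrite iD; have := i_ge0 r; lra.
have := ler_distD (clip (vx x0 n)) (vx x0 n) (clip (vx x0 (addM m r))).
rewrite (distrC (clip (vx x0 n)) (clip (vx x0 (addM m r)))).
rewrite /vx in h3 h4 h5 *; lra.
Qed.

(* Freezing the approximations of [x0] at the first [n] with [f n = 1] moves [x0] to a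
   nearby rational, where [Psi] is markedly smaller, exactly if such an [n] exists. *)
Lemma exists2_ex : exists E, is_exists2 E.
Proof.
have [x0R _] := x0_01; have [F1 F2] := hPsi.1.
have PR := F1 _ x0R.
have /(Rpos_ev PR) [c c0 hc] := hPsi.2 _ x0R.
have c32 : 0 < c / 32 by lra.
have [m hm] := archimedean c32.
(* At a frozen rational the jump puts [Psi] lower than at [x0] by at least [c / 2], up to errors;
   the threshold sits halfway. At most seven errors of size [c / 32] occur, which is less than the
   remaining [c / 4]. *)
have [th hth] := val_surj (vx (app Psi x0) m - c / 4).
pose A : form (1%ty :: (1 ⇒ 1)%ty :: (1 ⇒ 1)%ty :: Nat :: Nat :: nil) :=
  qlt (v1 ⋅ (v2 ⋅ v0) ⋅ v3)%tm v4.
have [E hE] := @set_comprehension _ 1%ty A (default_term _ _)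
  (econs Psi (econs (freezeF m) (env2 m th))) (qf_arith (I : qf A)) (or_introl (I : qf A)).
exists E => f; apply: truth_iff (hE f).
rewrite /A sat_qlt !eval_app !eval_VS !eval_VZ hth -/(vx (app Psi (app (freezeF m) f)) m).
have ZR := isR_freeze m f; have PZR := F1 _ ZR.
have em := eps_gt0 m.
split=> h; last first.
  have [q [hq near]] := freeze_some m h.
  have CR := (in01_constF q).1; have PCR := F1 _ CR.
  have h1 := F2 _ _ ZR CR hq m.
  have /(Rle_ev PCR (isR_ball_slack q x0R PR)) h2 := @jump q.
  have [n [[[h3 h4] h5] h6]] := EvN_ex (EvN_and (EvN_and (EvN_and (h2 _ c32)
    (EvN_shift oneM (near _ c32))) (EvN_shift oneM hc)) (EvN_ge m)).
  move: h3; rewrite /ball_slack => h3.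
  have h6' : i m <= i (addM n oneM) by rewrite !iE; lra.
  have := isR_le PCR h6; have := isR_le PR h6'; move: h1.
  rewrite ler_norml !ltr_norml => /andP [? ?] /andP [? ?] /andP [? ?]; lra.
apply/not_notP => nh.
have := F2 _ _ ZR x0R (freeze_none m nh) m.
by rewrite ler_norml => /andP [? ?]; lra.
Qed.

(** * The net of finite sequences of arbitrary centers *)

Lemma rowF_sig : {W : dom M (1 ⇒ Nat ⇒ 1) |
  forall f j n, app (app (app W f) j) n = app f (pairM j n)}.
Proof.
exists (eval (λ[f : 1] λ[j : 0] λ[n : 0] (f↑↑ ⋅ tpair j↑ n))%tm (@enil M)) => f j n.
by rewrite !eval_lam_in eval_app eval_pair !eval_wk !eval_VZ.
Qed.
Definition rowF := projT1 rowF_sig.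
Notation row f j := (app (app rowF f) j).
Lemma app_row f j n : app (row f j) n = app f (pairM j n).
Proof. exact: (projT2 rowF_sig). Qed.

(** An index is a single function, split into rows by pairing: the first entry of row 0 is the
    length, row 1 is the uncovered point, and the centers start at row 2. *)
Notation twoM := (addM oneM oneM).
Notation len f := (app (row f zeroM) zeroM).
Notation point f := (row f oneM).
Notation center f j := (row f (addM j twoM)).

(** The term [1 - (a - b)] is the indicator of [a <= b]; the case distinctions in [encode] and
    [concat] are sums of products with such factors. *)
Lemma sg_le a b : i a <= i b -> subM oneM (subM a b) = oneM.
Proof.
move=> h; have -> : subM a b = zeroM by apply: i_inj; rewrite i_sub0 ?i0.
exact: subM_0.
Qed.

Lemma sg_gt a b : i b < i a -> subM oneM (subM a b) = zeroM.
Proof.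
move=> h; apply: i_inj; rewrite i0 i_sub0 // i_sub ?(ltW h) // i1.
by have := i_discr h; lra.
Qed.

Lemma mul_0M a : mulM zeroM a = zeroM. Proof. by rewrite mulMC mulM0. Qed.
Lemma add_0M a : addM zeroM a = a. Proof. by rewrite addMC addM0. Qed.

Lemma encode k x (w : dom M (Nat ⇒ 1)) : exists f, [/\ len f = k, point f = x &
  forall j, center f j = app w j].
Proof.
have [f hf] : exists f : dom M 1, forall j n, app f (pairM j n) =
    addM (addM (mulM k (subM oneM j))
      (mulM (app x n) (mulM (subM oneM (subM oneM j)) (subM oneM (subM j oneM)))))
    (mulM (app (app w (subM j twoM)) n) (subM oneM (subM twoM j))).
  exists (eval (λ[n : 0] (v1 * tsub 1 (tfst n)
  + (v2 ⋅ tsnd n) * (tsub 1 (tsub 1 (tfst n)) * tsub 1 (tsub (tfst n) 1))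
  + (v3 ⋅ tsub (tfst n) 2 ⋅ tsnd n) * tsub 1 (tsub 2 (tfst n))))%tm
  (econs k (econs x (econs w (@enil M))))) => j n.
  rewrite eval_lam_in !(eval_fst, eval_snd, eval_sub, eval_add, eval_mul, eval_app).
  by rewrite !eval_VS !eval_VZ !eval_one fstM_pair sndM_pair.
exists f; split.
- rewrite app_row hf subM_0 mulM1 sub11 mul_0M mulM0 addM0 sg_gt ?mulM0 ?addM0 //.
  by rewrite !iE; lra.
- apply: M_ext => n; rewrite app_row hf sub11 mulM0 add_0M subM_0 !mulM1.
  by rewrite sg_gt ?mulM0 ?addM0 // !iE; lra.
- move=> j; apply: M_ext => n; rewrite app_row hf; have j0 := i_ge0 j.
  have -> : subM oneM (addM j twoM) = zeroM by apply: i_inj; rewrite i_sub0 ?i0 // !iE; lra.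
  have -> : subM (addM j twoM) twoM = j by apply: i_inj; rewrite i_sub !iE; lra.
  rewrite mulM0 subM_0 (@sg_gt (addM j twoM) oneM) ?sg_le ?mulM0 ?mulM1 ?add_0M //.
  + by rewrite !iE; lra.
  + by rewrite !iE; lra.
Qed.

Lemma concat k (a b : dom M (Nat ⇒ 1)) : exists w : dom M (Nat ⇒ 1),
  (forall j, i j < i k -> app w j = app a j) /\ forall j, app w (addM k j) = app b j.
Proof.
have [w hw] : exists w : dom M (Nat ⇒ 1), forall j n, app (app w j) n =
    addM (mulM (app (app a j) n) (subM oneM (subM (addM j oneM) k)))
      (mulM (app (app b (subM j k)) n) (subM oneM (subM k j))).
  exists (eval (λ[j : 0] λ[n : 0] ((v3 ⋅ j↑ ⋅ n) * tsub 1 (tsub (j↑ + 1) v2)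
   + (v4 ⋅ tsub j↑ v2 ⋅ n) * tsub 1 (tsub v2 j↑)))%tm
   (econs k (econs a (econs b (@enil M))))) => j n.
  rewrite !eval_lam_in !eval_add !eval_mul !eval_sub eval_add.
  rewrite eval_app eval_app eval_app eval_app eval_sub.
  by rewrite !eval_wk !eval_VS !eval_VZ !eval_one.
exists w; split=> j => [jk|]; apply: M_ext => n; rewrite hw.
  rewrite sg_le; last by rewrite iD i1; exact: i_discr.
  by rewrite sg_gt // mulM1 mulM0 addM0.
rewrite sg_gt; last by rewrite !iE; have := i_ge0 j; lra.
rewrite sg_le; last by rewrite !iE; have := i_ge0 j; lra.
have -> : subM (addM k j) k = j by apply: i_inj; rewrite i_sub iD; have := i_ge0 j; lra.
by rewrite mulM1 mulM0 add_0M.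
Qed.

Definition uncov_index f := in01M (vx (point f)) /\ forall j, i j < i (len f) ->
  in01M (vx (center f j)) /\
  ~ covers (vx (center f j)) (vx (app Psi (center f j))) (vx (point f)).

Lemma sat_not G (A : form G) (e : env M G) (P : Prop) :
  (sat A e <-> P) -> sat (Not A) e <-> ~ P.
Proof. by move=> h; split=> H /h. Qed.

Lemma uncov_set_sig E : is_exists2 E ->
  {D : dom M 2 | forall f, truth (uncov_index f) (app D f)}.
Proof.
move=> hE.
pose G := (1 ⇒ Nat ⇒ 1)%ty :: (1 ⇒ 1)%ty :: 2%ty :: nil.
have [c hc] : {c : term (Nat :: 1%ty :: G) 1 | forall (j : N) (f : dom M 1),
    eval c (econs j (econs f (econs rowF (econs Psi (econs E (@enil M)))))) = center f j}.
  exists (v2 ⋅ v1 ⋅ (v0 + (1 + 1)))%tm => j f.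
  by rewrite eval_app eval_app !eval_add !eval_VS !eval_VZ eval_one.
pose A : form (1%ty :: G) := (in01 (v1 ⋅ v0 ⋅ 1)%tm ∧ ∀[j : 0] (j ≺ v2 ⋅ v1 ⋅ 0 ⋅ 0 ⊃
  in01 c ∧ Not (rlt (rsub c (v3 ⋅ c)) (v2 ⋅ v1 ⋅ 1) ∧ rlt (v2 ⋅ v1 ⋅ 1) (radd c (v3 ⋅ c)))))%fm.
have aA : arith A by do !split.
have [D hD] := @set_comprehension _ _ A v2 (econs rowF (econs Psi (econs E (@enil M))))
  aA (or_intror hE).
exists D => f; apply: truth_iff (hD f); apply: sat_and.
  by rewrite sat_in01 !eval_app !eval_VS !eval_VZ eval_one; exact: iff_refl.
apply: sat_all => j; apply: sat_imp.
  by rewrite sat_lt !eval_app !eval_VS !eval_VZ eval_zero; exact: iff_refl.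
apply: sat_and; first by rewrite sat_in01 hc; exact: iff_refl.
apply: sat_not; apply: sat_and.
  by rewrite sat_rlt vx_rsub !eval_app hc !eval_VS !eval_VZ eval_one; exact: iff_refl.
by rewrite sat_rlt vx_radd !eval_app hc !eval_VS !eval_VZ eval_one; exact: iff_refl.
Qed.

(** Centers are compared as functions: by extensionality of the model this says that all their
    values agree, which is arithmetical, and it lets [Psi] and the balls be carried over by
    rewriting. *)
Definition sub_index f g := forall j, i j < i (len f) -> exists l, i l < i (len g) /\
  center f j = center g l.

Lemma sub_rel_sig E : is_exists2 E ->
  {P : dom M (1 ⇒ 1 ⇒ 0) | forall f g, truth (sub_index f g) (app (app P f) g)}.
Proof.
move=> hE.
pose G := (1 ⇒ Nat ⇒ 1)%ty :: 2%ty :: nil.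
pose A : form (1%ty :: 1%ty :: G) := (∀[j : 0] (j ≺ v3 ⋅ v2 ⋅ 0 ⋅ 0 ⊃
  ∃[l : 0] (l ≺ v4 ⋅ v2 ⋅ 0 ⋅ 0 ∧ ∀[n : 0]
    (v5 ⋅ v4 ⋅ (v2 + (1 + 1)) ⋅ n ≐ v5 ⋅ v3 ⋅ (v1 + (1 + 1)) ⋅ n))))%fm.
have aA : arith A by do !split.
have [P hP] := @rel_comprehension _ _ _ A v1 (econs rowF (econs E (@enil M)))
  aA (or_intror hE).
exists P => f g; apply: truth_iff (hP f g); apply: sat_all => j; apply: sat_imp.
  by rewrite sat_lt !eval_app !eval_VS !eval_VZ eval_zero; exact: iff_refl.
apply: sat_ex => l; apply: sat_and.
  by rewrite sat_lt !eval_app !eval_VS !eval_VZ eval_zero; exact: iff_refl.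
split=> [h|h n]; last exact: (congr1 (fun w => app w n) h).
by apply: M_ext => n; exact: h n.
Qed.

Lemma jump_absurd : False.
Proof.
have [F1 F2] := hPsi.1; have [E hE] := exists2_ex.
have [D hD] := uncov_set_sig hE; have [P hP] := sub_rel_sig hE.
have memD f : memM D f <-> uncov_index f := truth_P (hD f).
have precP f g : precM P f g <-> sub_index f g := truth_P (hP f g).
have [X hX] : exists X : dom M (1 ⇒ 1), forall f, app X f = point f.
  exists (eval (λ[f : 1] (v1 ⋅ f ⋅ 1))%tm (econs rowF (@enil M))) => f.
  by rewrite eval_lam_in !eval_app !eval_VS !eval_VZ eval_one.
have mk k (w : dom M (Nat ⇒ 1)) : (forall j, i j < i k -> in01M (vx (app w j))) ->
    exists f, [/\ memM D f, len f = k & forall j, center f j = app w j].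
  move=> h; have [x [hx nc]] := uncovered h; have [f [fl fp fc]] := encode k x w.
  exists f; split=> //; apply/memD; split; first by rewrite fp.
  by move=> j; rewrite fl fp fc => jk; split; [exact: h|exact: nc].
have mk1 k : exists w : dom M (Nat ⇒ 1), forall j, app w j = k.
  by exists (app (cint M (CPi 1%ty Nat)) k) => j; rewrite app_Pi.
have refl f : precM P f f by apply/precP => j jf; exists j.
have nt : net D P X.
  split; first by move=> f; exact: truth_le1 (hD f).
  split; first by move=> f g; exact: truth_le1 (hP f g).
  split; last by move=> f /memD [[fR _] _]; rewrite hX.
  split; last split; last split=> //.
  - have [|f [Df _ _]] := mk zeroM constF; last by exists f.
    by move=> j; rewrite i0 ltNge i_ge0.
  - move=> f g h _ _ _ /precP fg /precP gh; apply/precP => j /fg [l [/gh [t [ht e]] ->]].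
    by exists t.
  move=> f g /memD [_ hf] /memD [_ hg].
  have [a ha] : exists a : dom M (Nat ⇒ 1), forall j, app a j = center f j.
    exists (eval (λ[j : 0] (v1 ⋅ v2 ⋅ (j + (1 + 1))))%tm (econs rowF (econs f (@enil M)))) => j.
    by rewrite eval_lam_in eval_app eval_app !eval_add !eval_VS !eval_VZ eval_one.
  have [b hb] : exists b : dom M (Nat ⇒ 1), forall j, app b j = center g j.
    exists (eval (λ[j : 0] (v1 ⋅ v2 ⋅ (j + (1 + 1))))%tm (econs rowF (econs g (@enil M)))) => j.
    by rewrite eval_lam_in eval_app eval_app !eval_add !eval_VS !eval_VZ eval_one.
  (* An upper bound is the concatenation together with some point that it leaves uncovered; such a
     point exists because there is no finite cover. *)
  have [w [wa wb]] := concat (len f) a b.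
  have [j|h [Dh hl hc]] := mk (addM (len f) (len g)) w.
    rewrite iD => jl; case: (ltP (i j) (i (len f))) => jf.
      by rewrite wa // ha; exact: (hf _ jf).1.
    have [d ej] := i_leD jf; rewrite ej wb hb; apply: (hg _ _).1.
    by move: jl; rewrite ej iD ltrD2l.
  exists h; split=> //; rewrite !precP; split=> j jl.
    exists j; rewrite hl hc wa // ha; split=> //.
    by rewrite iD; have := i_ge0 (len g); lra.
  by exists (addM (len f) j); rewrite hl hc wb hb !iD ltrD2l.
apply: (@not_boundedM D P X) => [f _ //|f /memD [? _]|]; first by rewrite hX.
apply: AS_M nt _; exists Psi; split; first exact: hPsi.1.
move=> x hx; have [xR _] := hx; split; first exact: hPsi.2.
(* The index for [x] is the one-term sequence with center [x]. Every later index has [x] among its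
   centers, so its point lies outside the ball around [x], at distance at least [Psi x]. *)
have [w hw] := mk1 x.
have [j _|f [Df fl fc]] := mk oneM w; first by rewrite hw.
exists f; split=> // e /memD [[eR _] he] /precP.
case/(_ zeroM); first by rewrite fl; exact/i_lt/ltM_01.
move=> l [le]; rewrite fc hw => ex; have [_] := he _ le; rewrite -ex hX.
move/(Rle_not_covers xR (F1 _ xR) eR) => h.
apply/(Rle_dist (F1 _ xR) xR eR) => d /h; apply: EvN_mono => n.
by rewrite distrC.
Qed.
End JumpBall.

Lemma no_cover_absurd : False.
Proof.
apply: rational_balls_absurd => x hx; apply/not_notP => nq.
by apply: (jump_absurd hx) => q hq; apply: nq; exists q.
Qed.
End Backward.

Lemma AS_HBU : (forall D P X, net D P X -> (exists F, AS_cond D P X F) -> boundedM D P X) ->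
  forall Psi, posrfun Psi -> finite_cover Psi.
Proof. by move=> hAS Psi hPsi; apply/not_notP => nc; exact (no_cover_absurd hAS hPsi nc). Qed.

Lemma sat_HBU_AS (e : env M nil) : sat (Iff HBU AS_net_minus) e.
Proof.
split; first by move/sat_HBU => h; apply/sat_AS; exact: HBU_AS.
by move/sat_AS => h; apply/sat_HBU; exact: AS_HBU.
Qed.
End Model.

Theorem theorem3p15 :
  proves (theory_union RCA0w IND) (Iff HBU AS_net_minus).
Proof.
apply: completeness; first exact: RCA0w_IND_closed.
- by move=> G B hB; left; exact: RCA0w_eq.
- by move=> G B hB; left; exact: RCA0w_ext.
move=> M M_ax M_ext.
have [K [i [[i0 i1 iD iM] [i_lt i_surj]]]] := fractions_of_model M_ax.
exact: (sat_HBU_AS M_ax M_ext i0 i1 iD iM i_lt i_surj).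
Qed.
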